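(* Let $\ell\ge1$ and let $$\dot{\mathfrak g}=\left\{\begin{pmatrix}a&b\\c&-a^T\end{pmatrix}\in M_{4\ell+4}(\mathbb C)\ \Big|\ b^T=-b,\ c^T=-c\right\}$$ ($a,b,c$ being $(2\ell+2)\times(2\ell+2)$ blocks), the simple Lie algebra of type $D_{2\ell+2}$. Put $$\sigma_0=\mathrm{Ad}\Big(E_{2\ell+2,4\ell+4}-E_{4\ell+4,2\ell+2}+\sum_{j=1}^{2\ell+1}\big((-1)^jE_{4\ell+4-j,j}-(-1)^jE_{2\ell+2-j,2\ell+2+j}\big)\Big),$$ $$\sigma_1=\mathrm{Ad}\Big(iE_{2\ell+2,4\ell+4}+iE_{4\ell+4,2\ell+2}+\sum_{j=1}^{2\ell+1}\big(E_{j,j}-E_{2\ell+2+j,2\ell+2+j}\big)\Big),\qquad i=\sqrt{-1},$$ which are commuting automorphisms of orders 2 and 4 respectively. Then $\dot{\mathfrak g}_{(\overline0,\overline0)}$ is the simple Lie algebra of type $B_\ell$ (with $B_1=A_1$), and as modules over it: $\dot{\mathfrak g}_{(\overline0,\overline1)},\dot{\mathfrak g}_{(\overline1,\overline1)},\dot{\mathfrak g}_{(\overline0,\overline3)},\dot{\mathfrak g}_{(\overline1,\overline3)}$ are all irreducible of dimension $2\ell+1$; $\dot{\mathfrak g}_{(\overline1,\overline0)}$ is the direct sum of a one-dimensional and the $(2\ell^2+3\ell)$-dimensional irreducible representation; $\dot{\mathfrak g}_{(\overline0,\overline2)}$ is the adjoint representation; and $\dot{\mathfrak g}_{(\overline1,\overline2)}$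 is the direct sum of the adjoint representation and a one-dimensional trivial one. The set $R$ of non-isotropic roots of the twisted 2-toroidal Lie algebra $\mathfrak g(\sigma_0,\sigma_1)$ is the extended affine root system $BC_\ell^{(2,4)}$: $$\begin{aligned}R=&\{\alpha+m\delta_0+n\delta_1\mid\alpha\in R(B_\ell)\text{ short},\ m,n\in\mathbb Z\}\cup\{\alpha+m\delta_0+2n\delta_1\mid\alpha\in R(B_\ell)\text{ long},\ m,n\in\mathbb Z\}\\&\cup\{\alpha+(2m+1)\delta_0+4n\delta_1\mid\alpha\in R(C_\ell)\text{ long},\ m,n\in\mathbb Z\}.\end{aligned}$$ Here $R(B_\ell)$ is the root system of $\dot{\mathfrak g}_{(\overline0,\overline0)}$ with respect to its Cartan subalgebra $\dot{\mathfrak h}_{\overline0}$, and the long roots of $R(C_\ell)$ are the elements $2\alpha$ with $\alpha\in R(B_\ell)$ short.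
   Context: For $\ell=1$ all roots of $B_1=A_1$ are regarded as short. $E_{ij}$ are matrix units and $\mathrm{Ad}(A)(X)=AXA^{-1}$. Work over $\mathbb C$. Let $\dot{\mathfrak g}$ be a simple finite-dimensional Lie algebra with Killing form $(\cdot,\cdot)$, and $\sigma_0,\sigma_1$ commuting automorphisms of finite orders $n_0,n_1$ (order 1 allowed). Put $\epsilon_j=\exp(2\pi i/n_j)$ and, for $p,q\in\mathbb Z$, $\dot{\mathfrak g}_{(\overline p,\overline q)}=\{g\in\dot{\mathfrak g}\mid\sigma_0(g)=\epsilon_0^p g,\ \sigma_1(g)=\epsilon_1^q g\}$, where $\overline p=p \bmod n_0$, $\overline q=q\bmod n_1$. Let $\mathcal R=\mathbb C[t_0^{\pm1},t_1^{\pm1}]$, $\mathcal K=\Omega^1_{\mathcal R}/d\mathcal R$, $k_i=t_i^{-1}dt_i$, and let $\mathcal K(\Sigma)\subset\mathcal K$ be spanned by the elements $t_0^{n_0a}t_1^{n_1b}k_i$ ($a,b\in\mathbb Z$, $i=0,1$). The twisted 2-toroidal Lie algebra is $$\mathfrak g(\sigma_0,\sigma_1)=\bigoplus_{m,n\in\mathbb Z}\dot{\mathfrak g}_{(\overline m,\overline n)}\otimes t_0^mt_1^n\ \oplus\ \mathcal K(\Sigma)\ \oplus\ \mathbb Cd_0\oplus\mathbb Cd_1,$$ with bracket $[g_1\otimes f_1,g_2\otimes f_2]=[g_1,g_2]\otimes f_1f_2+(g_1,g_2)f_2\,df_1$; $\mathcal K(\Sigma)$ commutes with itself and with all $g\otimes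 f$; $d_j=t_j\partial/\partial t_j$ acts by $[d_j,g\otimes t_0^{r_0}t_1^{r_1}]=r_j\,g\otimes t_0^{r_0}t_1^{r_1}$, $[d_j,t_0^{r_0}t_1^{r_1}k_i]=r_j\,t_0^{r_0}t_1^{r_1}k_i$; and $[d_0,d_1]=0$. Let $\dot{\mathfrak h}_{\overline 0}$ be a Cartan subalgebra of the reductive algebra $\dot{\mathfrak g}_{(\overline 0,\overline 0)}$ and $\mathfrak h=\dot{\mathfrak h}_{\overline 0}\oplus\mathbb Cd_0\oplus\mathbb Cd_1\oplus\mathbb Ck_0\oplus\mathbb Ck_1$. Elements of $\dot{\mathfrak h}_{\overline 0}^*$ are extended to $\mathfrak h$ by $0$ on all $d_i,k_i$; $\delta_i\in\mathfrak h^*$ is defined by $\delta_i(d_j)=\delta_{ij}$ and zero on $\dot{\mathfrak h}_{\overline 0}$ and all $k_j$. Let $V=\dot{\mathfrak h}_{\overline 0}^*\oplus\mathbb C\delta_0\oplus\mathbb C\delta_1$ with the bilinear form $(\cdot,\cdot)_V$ which on $\dot{\mathfrak h}_{\overline 0}^*$ is dual to the restriction of the Killing form to $\dot{\mathfrak h}_{\overline 0}$ and has $\delta_0,\delta_1$ in its radical. Then $R$ is the set of $\beta\in V$ with $(\beta,\beta)_V\ne0$ whose weight space in $\mathfrak g(\sigma_0,\sigma_1)$ under the adjoint action of $\mathfrak h$ is nonzero. *)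

(* Defs.v *)
From HB Require Import structures.
From mathcomp Require Import all_boot all_order all_algebra.
From mathcomp Require Import generic_quotient ring_quotient.
From mathcomp Require Import boolp classical_sets functions cardinality fsbigop.
From mathcomp Require Import reals trigo.
From mathcomp Require Import complex.
From mathcomp Require Import ring.

Set Implicit Arguments.
Unset Strict Implicit.
Unset Printing Implicit Defensive.

Import Order.TTheory GRing.Theory Num.Theory.

Local Open Scope classical_set_scope.
Local Open Scope ring_scope.

Section MatrixLie.
Variables (K : fieldType) (N : nat).
Local Notation M := 'M[K]_N.
Implicit Types (g h a U V W I : {vspace M}) (x y : M).

Definition lie x y : M := x *m y - y *m x.

(* [U, V]: by bilinearity, brackets of basis vectors suffice. *)
Definition lie_span U V : {vspace M} :=
  <<[seq lie u v | u <- vbasis U, v <- vbasis V]>>%VS.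

Definition lie_subalgebra g : Prop := (lie_span g g <= g)%VS.

Definition lie_ideal g I : Prop := (I <= g)%VS /\ (lie_span g I <= I)%VS.

Definition lie_simple g : Prop :=
  [/\ lie_subalgebra g, lie_span g g <> 0%VS &
      forall I, lie_ideal g I -> I = 0%VS \/ I = g].

Definition lie_nilpotent h : Prop := exists n, iter n (lie_span h) h = 0%VS.

Definition cartan_subalgebra g h : Prop :=
  [/\ (h <= g)%VS, lie_subalgebra h, lie_nilpotent h &
      forall x, x \in g -> (forall y, y \in h -> lie x y \in h) -> x \in h].

(* Trace of (ad x) (ad y) on g, computed in a basis of g. *)
Definition killing g x y : K :=
  \sum_(i < \dim g) coord (vbasis g) i (lie x (lie y (vbasis g)`_i)).

Definition dual h := 'Hom(subvs_of h, K^o).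

Definition lie_roots g h : set (dual h) :=
  [set al | al <> 0 /\ exists x, [/\ x \in g, x <> 0 &
    forall s : subvs_of h, lie (vsval s) x = al s *: x]].
Arguments lie_roots : clear implicits.

(* The element t_al of h representing al through the Killing form of g; it is
   unique when that form is nondegenerate on h. *)
Definition dual_vec g h (al : dual h) : subvs_of h :=
  xget 0 [set t | forall s, killing g (vsval t) (vsval s) = al s].

Definition dual_form g h (al be : dual h) : K :=
  killing g (vsval (dual_vec g al)) (vsval (dual_vec g be)).

(* Root systems of type B_n (n >= 1, B_1 being A_1) and D_n, up to a linear
   isomorphism. *)
Definition root_system_B h (n : nat) (S : set (dual h)) : Prop :=
  exists e : n.-tuple (dual h), basis_of fullv e /\
    S = [set al | exists (i : 'I_n) (b : bool), al = (-1) ^+ b *: tnth e i] `|`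
        [set al | exists (i j : 'I_n) (b c : bool), i != j /\
          al = (-1) ^+ b *: tnth e i + (-1) ^+ c *: tnth e j].

Definition root_system_D h (n : nat) (S : set (dual h)) : Prop :=
  exists e : n.-tuple (dual h), basis_of fullv e /\
    S = [set al | exists (i j : 'I_n) (b c : bool), i != j /\
          al = (-1) ^+ b *: tnth e i + (-1) ^+ c *: tnth e j].

Definition simple_of_type_B g (n : nat) : Prop :=
  lie_simple g /\
  exists h, cartan_subalgebra g h /\ root_system_B n (lie_roots g h).

Definition simple_of_type_D g (n : nat) : Prop :=
  lie_simple g /\
  exists h, cartan_subalgebra g h /\ root_system_D n (lie_roots g h).

(* Subspaces of matrices as modules over a, acting by the bracket. *)
Definition lie_submodule a W : Prop := (lie_span a W <= W)%VS.

Definition lie_irreducible a W : Prop :=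
  [/\ lie_submodule a W, W <> 0%VS &
      forall U, (U <= W)%VS -> lie_submodule a U -> U = 0%VS \/ U = W].

Definition lie_trivial a W : Prop :=
  {in a & W, forall x w, lie x w = 0}.

(* W is isomorphic to U as an a-module; only the values of f on W matter. *)
Definition module_iso a W U : Prop :=
  [/\ lie_submodule a W, lie_submodule a U &
      exists f : 'End(M),
        [/\ (f @: W)%VS = U, {in W &, injective f} &
            {in a & W, forall x w, f (lie x w) = lie x (f w)}]].

Definition module_sum a W U1 U2 : Prop :=
  [/\ lie_submodule a U1, lie_submodule a U2, W = (U1 + U2)%VS &
      (U1 :&: U2)%VS = 0%VS].

Definition lie_automorphism g (s : 'End(M)) : Prop :=
  [/\ (s @: g)%VS = g, {in g &, injective s} &
      {in g &, forall x y, s (lie x y) = lie (s x) (s y)}].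

Definition has_order g (s : 'End(M)) (n : nat) : Prop :=
  [/\ (0 < n)%N, {in g, forall x, iter n s x = x} &
      forall m, (0 < m < n)%N -> ~ {in g, forall x, iter m s x = x}].

Definition Ad (A : M) : 'End(M) := linfun (mulmxr (invmx A) \o mulmx A).

Lemma AdE (A X : M) : Ad A X = A *m X *m invmx A.
Proof. by rewrite lfunE. Qed.

(* Matrix units with 1-based indices. *)
Definition E (i j : nat) : M :=
  \matrix_(r, c) ((r.+1 == i) && (c.+1 == j))%:R.

End MatrixLie.
Arguments lie_roots {K N} g h _.

(* Lengths of roots, for the form dual to the Killing form of g. A root is
   short when it has minimal length, so that all roots are short when there is
   only one length. *)
Section Lengths.
Variables (K : numFieldType) (N : nat) (g h : {vspace 'M[K]_N}).

Definition short_roots (S : set (dual h)) : set (dual h) :=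
  [set al | S al /\ forall be, S be -> dual_form g al al <= dual_form g be be].

Definition long_roots (S : set (dual h)) : set (dual h) :=
  S `\` short_roots S.

End Lengths.

(* The matrices (a, b; c, -a^T) with b and c skew-symmetric. *)
Section SoEven.
Variables (K : fieldType) (n : nat).
Local Notation M := 'M[K]_(n + n).

Definition so_diag (X : M) : 'M[K]_n := drsubmx X + (ulsubmx X)^T.
Definition so_up (X : M) : 'M[K]_n := (ursubmx X)^T + ursubmx X.
Definition so_down (X : M) : 'M[K]_n := (dlsubmx X)^T + dlsubmx X.

Lemma so_diag_is_linear : linear so_diag.
Proof. by move=> k A B; apply/matrixP=> i j; rewrite !mxE; ring. Qed.
Lemma so_up_is_linear : linear so_up.
Proof. by move=> k A B; apply/matrixP=> i j; rewrite !mxE; ring. Qed.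
Lemma so_down_is_linear : linear so_down.
Proof. by move=> k A B; apply/matrixP=> i j; rewrite !mxE; ring. Qed.

HB.instance Definition _ := GRing.isLinear.Build K M _ _ so_diag so_diag_is_linear.
HB.instance Definition _ := GRing.isLinear.Build K M _ _ so_up so_up_is_linear.
HB.instance Definition _ := GRing.isLinear.Build K M _ _ so_down so_down_is_linear.

Definition so_even : {vspace M} :=
  (lker (linfun so_diag) :&: lker (linfun so_up) :&: lker (linfun so_down))%VS.

Lemma so_evenP (X : M) :
  X \in so_even <-> exists a b c : 'M[K]_n,
    [/\ X = block_mx a b c (- a^T), b^T = - b & c^T = - c].
Proof.
rewrite /so_even !memv_cap !memv_ker !lfunE /= !addr_eq0.
split=> [/andP[/andP[/eqP d /eqP b] /eqP c]|[a [b [c [-> hb hc]]]]].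
  exists (ulsubmx X), (ursubmx X), (dlsubmx X); split=> //.
  by rewrite -d submxK.
by rewrite block_mxKul block_mxKur block_mxKdl block_mxKdr hb hc !eqxx.
Qed.

End SoEven.

(* Finitely supported families (v_r), r in Z^2, of vectors of V, that is, the
   elements of V (x) C[t0^+-1, t1^+-1]; v_r is the coefficient of
   t^r = t0^r.1 t1^r.2. *)
Section Laurent.
Variables (K : fieldType) (V : lmodType K).

Definition fin_supp : {pred (int * int -> V)} :=
  fun f => `[< finite_set [set r | f r <> 0] >].

Lemma fin_supp_submod : submod_closed fin_supp.
Proof.
split=> [|k f f' /asboolP hf /asboolP hf'].
  apply/asboolP; rewrite (_ : [set r | _] = set0) ?finite_set0//.
  by apply/seteqP; split=> r //=.
apply/asboolP; apply: (@sub_finite_set _ _ ([set r | f r <> 0] `|`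
    [set r | f' r <> 0])); last by rewrite finite_setU.
move=> r /=; case: (pselect (f r = 0)) => [fr0|]; last by left.
case: (pselect (f' r = 0)) => [fr0'|]; last by right.
by case; rewrite fctE /= [X in X + _]/= /GRing.scale /= fr0 fr0' scaler0 addr0.
Qed.

HB.instance Definition _ :=
  GRing.isSubmodClosed.Build K (int * int -> V) fin_supp fin_supp_submod.

Record laurent := Laurent {
  coef :> int * int -> V;
  coef_fin_supp : coef \in fin_supp }.

HB.instance Definition _ := [isSub for coef].
HB.instance Definition _ := [Choice of laurent by <:].
HB.instance Definition _ := [SubChoice_isSubLmodule of laurent by <:].

Definition mono_fun (r : int * int) (v : V) : int * int -> V :=
  fun s => if s == r then v else 0.

Lemma mono_subproof r v : mono_fun r v \in fin_supp.
Proof.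
apply/asboolP; apply: (@sub_finite_set _ _ [set r]); last exact: finite_set1.
by move=> s /=; rewrite /mono_fun; case: eqP.
Qed.

(* v (x) t^r *)
Definition mono r v : laurent := Laurent (mono_subproof r v).

(* Index j = 0 is false and j = 1 is true. *)
Definition crd (j : bool) (r : int * int) : int := if j then r.2 else r.1.

Definition der_fun (j : bool) (f : laurent) : int * int -> V :=
  fun r => (crd j r)%:~R *: f r.

Lemma der_subproof j f : der_fun j f \in fin_supp.
Proof.
apply/asboolP; have /asboolP := coef_fin_supp f.
apply: sub_finite_set => r /=; rewrite /der_fun => h f0; apply: h.
by rewrite f0 scaler0.
Qed.

(* d_j = t_j d/dt_j *)
Definition der j f : laurent := Laurent (der_subproof j f).

Lemma der_is_linear j : linear (der j).
Proof.
move=> k f f'; apply/val_inj/funext => r /=.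
have E : (k *: f + f') r = k *: f r + f' r by [].
have E' (u v : int * int -> V) : (k *: u + v) r = k *: u r + v r by [].
by rewrite E' /der_fun E scalerDr !scalerA mulrC.
Qed.

HB.instance Definition _ j :=
  GRing.isLinear.Build K laurent laurent _ (der j) (der_is_linear j).

End Laurent.

(* Omega^1 is free over C[t0^+-1, t1^+-1] on k_i = t_i^-1 dt_i; the pair
   (f0, f1) is f0 k_0 + f1 k_1. *)
Section Kaehler.
Variable K : fieldType.

Definition Omega := (laurent K^o * laurent K^o)%type.

Definition dR (f : laurent K^o) : Omega := (der false f, der true f).

Definition exact_form : {pred Omega} := fun w => `[< exists f, w = dR f >].

Lemma dR_is_linear : linear dR.
Proof. by move=> k f f'; rewrite /dR !linearP. Qed.

Lemma exact_form_submod : submod_closed exact_form.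
Proof.
split=> [|k w w' /asboolP[f ->] /asboolP[f' ->]]; apply/asboolP.
  by exists 0; rewrite /dR !linear0.
by exists (k *: f + f'); rewrite dR_is_linear.
Qed.

HB.instance Definition _ :=
  GRing.isSubmodClosed.Build K Omega exact_form exact_form_submod.

(* Omega^1 / dR as a vector space. *)
Definition kaehler := Quotient.quot exact_form.
HB.instance Definition _ := GRing.Zmodule.on kaehler.

Definition class_form (w : Omega) : kaehler :=
  (\pi_(Quotient.quot exact_form) w)%qT.

Lemma class_formP w w' :
  class_form w = class_form w' <-> exists f, w - w' = dR f.
Proof.
split=> [/eqP|h]; first by rewrite -Quotient.idealrBE => /asboolP.
by apply/eqP; rewrite -Quotient.idealrBE; apply/asboolP.
Qed.

Definition repr_form (q : kaehler) : Omega := repr q.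

Lemma repr_formK q : class_form (repr_form q) = q.
Proof. exact: reprK. Qed.

Lemma class_formD w w' : class_form (w + w') = class_form w + class_form w'.
Proof. exact: raddfD. Qed.

Definition kscale (k : K) (q : kaehler) : kaehler :=
  class_form (k *: repr_form q).

Lemma kscaleE k w : kscale k (class_form w) = class_form (k *: w).
Proof.
have [f hf] := (class_formP _ _).1 (repr_formK (class_form w)).
apply/class_formP; exists (k *: f).
by rewrite -scalerBr hf /dR !linearZ.
Qed.

Lemma kscaleA a b q : kscale a (kscale b q) = kscale (a * b) q.
Proof. by rewrite -[q]repr_formK !kscaleE scalerA. Qed.
Lemma kscale1 : left_id 1 kscale.
Proof. by move=> q; rewrite -[q]repr_formK kscaleE scale1r. Qed.
Lemma kscaleDr : right_distributive kscale +%R.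
Proof.
move=> k q q'; rewrite -[q]repr_formK -[q']repr_formK.
by rewrite -class_formD !kscaleE scalerDr class_formD.
Qed.
Lemma kscaleDl q : {morph kscale^~ q : a b / a + b}.
Proof.
by move=> a b; rewrite -[q]repr_formK !kscaleE scalerDl class_formD.
Qed.

HB.instance Definition _ :=
  GRing.Zmodule_isLmodule.Build K kaehler kscaleA kscale1 kscaleDr kscaleDl.

(* The class of t^r k_j. *)
Definition kmono (r : int * int) (j : bool) : kaehler :=
  class_form (if j then (0, mono r (1 : K^o)) else (mono r (1 : K^o), 0)).

(* The action of d_j, induced by d_j (t^r k_i) = r_j t^r k_i. *)
Definition kder (j : bool) (q : kaehler) : kaehler :=
  class_form (der j (repr_form q).1, der j (repr_form q).2).

Lemma kderE j w : kder j (class_form w) = class_form (der j w.1, der j w.2).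
Proof.
have [f hf] := (class_formP _ _).1 (repr_formK (class_form w)).
apply/class_formP; exists (der j f).
have derC i (f' : laurent K^o) : der i (der j f') = der j (der i f').
  by apply/val_inj/funext => r /=; rewrite /der_fun /= /der_fun !scalerA mulrC.
have h1 := congr1 fst hf; have h2 := congr1 snd hf.
by rewrite /dR !derC -[der false f]h1 -[der true f]h2 /= !linearB.
Qed.

(* K(Sigma): the finite linear combinations of the t0^(n0 a) t1^(n1 b) k_i. *)
Definition kaehler_sigma (n0 n1 : nat) : set kaehler :=
  [set q | exists s : seq (K * (int * int) * bool),
    q = \sum_(u <- s)
      u.1.1 *: kmono (n0%:Z * u.1.2.1, n1%:Z * u.1.2.2) u.2].

End Kaehler.

Section Toroidal.
Variables (K : fieldType) (N : nat).
Local Notation M := 'M[K]_N.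

(* e0 and e1 are meant to be primitive roots of unity of orders n0 and n1. *)
Variables (g : {vspace M}) (s0 s1 : 'End(M)) (n0 n1 : nat) (e0 e1 : K).

Definition graded (p q : int) : {vspace M} :=
  (g :&: passmx.leigenspace s0 (e0 ^ p)%R
     :&: passmx.leigenspace s1 (e1 ^ q)%R)%VS.

Lemma leigenspaceP (s : 'End(M)) (a : K) x :
  (x \in passmx.leigenspace s a) = (s x == a *: x).
Proof.
rewrite memv_ker add_lfunE opp_lfunE.
by rewrite [(_ *: \1%VF)%R x]scale_lfunE id_lfunE subr_eq0.
Qed.

Lemma gradedP p q x :
  x \in graded p q <->
  [/\ x \in g, s0 x = e0 ^ p *: x & s1 x = e1 ^ q *: x].
Proof.
rewrite /graded 2!memv_cap !leigenspaceP.
split=> [/andP[/andP[-> /eqP ->] /eqP ->]//|].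
by move=> [-> -> ->]; rewrite !eqxx.
Qed.

(* (X, k, c) stands for X + k + c.1 d_0 + c.2 d_1, X being a Laurent
   polynomial with matrix coefficients. *)
Definition tor := (laurent M * kaehler K * (K^o * K^o))%type.

Definition twisted_toroidal : set tor :=
  [set x : tor | (forall r, x.1.1 r \in graded r.1 r.2) /\
           kaehler_sigma n0 n1 x.1.2].

Definition loop_bracket (X Y : laurent M) : laurent M :=
  \sum_(a \in [set: int * int]) \sum_(b \in [set: int * int])
    mono (a + b) (lie (X a) (Y b)).

(* (g1, g2) t^b d(t^a), where t^b d(t^a) = t^(a+b) (a.1 k_0 + a.2 k_1). *)
Definition cocycle (X Y : laurent M) : kaehler K :=
  \sum_(a \in [set: int * int]) \sum_(b \in [set: int * int])
    killing g (X a) (Y b) *: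
      (a.1%:~R *: kmono K (a + b) false + a.2%:~R *: kmono K (a + b) true).

(* The action of c0 d_0 + c1 d_1. *)
Definition lder (c0 c1 : K) (X : laurent M) : laurent M :=
  c0 *: der false X + c1 *: der true X.
Definition qder (c0 c1 : K) (q : kaehler K) : kaehler K :=
  c0 *: kder false q + c1 *: kder true q.

Definition tor_bracket (x y : tor) : tor :=
  let: (X, k, c) := x in let: (Y, k', c') := y in
  (loop_bracket X Y + lder c.1 c.2 Y - lder c'.1 c'.2 X,
   cocycle X Y + qder c.1 c.2 k' - qder c'.1 c'.2 k,
   0).

Lemma tor_bracket_loop a b x y :
  tor_bracket (mono a x, 0, 0) (mono b y, 0, 0) =
  (mono (a + b) (lie x y),
   killing g x y *:
     (a.1%:~R *: kmono K (a + b) false + a.2%:~R *: kmono K (a + b) true), 0).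
Proof.
have lie0 u : lie 0 u = 0 :> M by rewrite /lie mul0mx mulmx0 subrr.
have lier0 u : lie u 0 = 0 :> M by rewrite /lie mul0mx mulmx0 subrr.
have kill0 u : killing g 0 u = 0.
  by rewrite /killing big1// => i _; rewrite lie0 linear0.
have killr0 u : killing g u 0 = 0.
  by rewrite /killing big1// => i _; rewrite lie0 lier0 linear0.
have monoE r (v : M) s : mono r v s = if s == r then v else 0 by [].
have mono0 r : mono r (0 : M) = 0.
  by apply/val_inj/funext => s /=; rewrite /mono_fun; case: ifP.
have sum1 (T : zmodType) (F : int * int -> int * int -> T) :
    (forall r s, r != a \/ s != b -> F r s = 0) ->
    \sum_(r \in [set: int * int]) \sum_(s \in [set: int * int]) F r s = F a b.
  move=> F0; rewrite -(@fsbig_widen _ _ _ _ [set a])//; last first.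
    move=> r [_ /= /eqP ra]; apply: fsbig1 => s _.
    by apply: F0; left.
  rewrite fsbig_set1 -(@fsbig_widen _ _ _ _ [set b]) ?fsbig_set1//.
  by move=> s [_ /= /eqP sb]; apply: F0; right.
rewrite /tor_bracket /lder /qder /= !scale0r !addr0 !subr0; congr (_, _, _).
  rewrite /loop_bracket sum1 ?monoE ?eqxx// => r s rs; rewrite !monoE.
  by case: rs => /negbTE ->; rewrite ?lie0 ?lier0 mono0.
rewrite /cocycle sum1 ?monoE ?eqxx// => r s rs; rewrite !monoE.
by case: rs => /negbTE ->; rewrite ?kill0 ?killr0 scale0r.
Qed.

Variable h : {vspace M}.

(* s + c.1 d_0 + c.2 d_1 + z.1 k_0 + z.2 k_1 *)
Definition cartan_elt (s : subvs_of h) (c z : K^o * K^o) : tor :=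
  (mono 0 (vsval s), (z.1 : K) *: kmono K 0 false + (z.2 : K) *: kmono K 0 true, c).

(* (al, x, y) stands for al + x delta_0 + y delta_1. *)
Definition Vspace := (dual h * K^o * K^o)%type.

Definition Vinj (al : dual h) : Vspace := (al, 0, 0).
Definition delta0 : Vspace := (0, 1, 0).
Definition delta1 : Vspace := (0, 0, 1).

Definition Veval (be : Vspace) (s : subvs_of h) (c : K^o * K^o) : K :=
  be.1.1 s + be.1.2 * c.1 + be.2 * c.2.

Definition Vform (be ga : Vspace) : K := dual_form g be.1.1 ga.1.1.

(* The set R. Weight spaces are those of the subspace twisted_toroidal of tor,
   which is stable under the elements cartan_elt. *)
Definition nonisotropic_roots : set Vspace :=
  [set be : Vspace | Vform be be <> 0 /\
    exists x : tor, [/\ twisted_toroidal x, x <> 0 &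
      forall s c z, tor_bracket (cartan_elt s c z) x = Veval be s c *: x]].

End Toroidal.
Arguments nonisotropic_roots {K N} g s0 s1 n0 n1 e0 e1 h _.

Section TypeD.
Variables (R : realType) (l : nat).
Local Notation C := R[i].
Local Notation n := (2 * l + 2)%N.
Local Notation E := (@E C (n + n)).

(* exp(2 pi i / m) *)
Definition eps (m : nat) : C :=
  (cos (2%:R * pi / m%:R) +i* sin (2%:R * pi / m%:R))%C.

Definition gD : {vspace 'M[C]_(n + n)} := so_even C n.

Definition A0 : 'M[C]_(n + n) :=
  E (2 * l + 2) (4 * l + 4) - E (4 * l + 4) (2 * l + 2)
  + \sum_(1 <= j < (2 * l + 1).+1)
      ((-1) ^+ j *: E (4 * l + 4 - j) j
       - (-1) ^+ j *: E (2 * l + 2 - j) (2 * l + 2 + j)).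

Definition A1 : 'M[C]_(n + n) :=
  'i%C *: E (2 * l + 2) (4 * l + 4) + 'i%C *: E (4 * l + 4) (2 * l + 2)
  + \sum_(1 <= j < (2 * l + 1).+1) (E j j - E (2 * l + 2 + j) (2 * l + 2 + j)).

Definition sigma0 := Ad A0.
Definition sigma1 := Ad A1.

Definition gpart (p q : int) := graded gD sigma0 sigma1 (eps 2) (eps 4) p q.

End TypeD.

(* Main.v *)
Require Import Defs.
From HB Require Import structures.
From mathcomp Require Import all_boot all_order all_algebra.
From mathcomp Require Import boolp classical_sets functions cardinality fsbigop.
From mathcomp Require Import reals trigo.
From mathcomp Require Import complex.
From mathcomp Require Import ring zify.

Set Implicit Arguments.
Unset Strict Implicit.
Unset Printing Implicit Defensive.

Import Order.TTheory GRing.Theory Num.Theory.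

Local Open Scope classical_set_scope.
Local Open Scope ring_scope.

(* In a suitable basis of C^(4l+4) = (C^2 (x) C^d) + C^2, d = 2l+1, the form
   defining gD and the matrices of sigma_0 and sigma_1 consist of scalar blocks,
   and the graded pieces can be read off blockwise: as modules over
   g_(0,0) = so(d) they are the skew matrices in degrees (0,0), (0,2) and (1,2)
   (plus an invariant line in the last one), the symmetric matrices in degree
   (1,0), and the column vectors when the second degree is odd.

   Let h be a Cartan subalgebra of so(d). The semisimple part of x in h is an
   odd polynomial in x, hence skew, and belongs to h because h is its own
   normalizer; by Engel's theorem h is the centralizer of its diagonalizable
   elements. So h is diagonal in a basis in which the symmetric form pairs every
   coordinate with its opposite, exactly one coordinate being its own opposite.
   The weights of h on C^d are then 0 and +-e_k; those of the skew (symmetric)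
   matrices are the sums of the weights of two distinct (arbitrary) coordinates,
   so that 2 e_k occurs only in degrees (odd, 0 mod 4).

   In the toroidal algebra a weight vector whose weight is nonzero on h has no
   component in K(Sigma) or on d_0, d_1, so that the non-isotropic roots are the
   non-isotropic weights of h on the graded pieces. *)

(** The root clause concerns every Cartan subalgebra [h], nilpotent and self-normalizing, so a basis
    adapted to [h] has to be extracted from [h] itself. Two points need care. The semisimple part of
    an element must stay skew, whence interpolation by an odd polynomial on a spectrum closed under
    negation. And diagonalizing [h] does not by itself separate the coordinates: if two of them had
    the same weight, a matrix built from some u v^T - v u^T would be forced into [h] and give a
    contradiction. Only then does the Gram matrix of the basis pair each coordinate with a single
    one. The degrees modulo 4 come from the eigenvalues of the matrix of sigma_1, which are 1, -1 on
    the large summand and i, -i on C^2: quotients within a summand are 1 or -1, quotients across the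
    two are i or -i. Odd second degrees are therefore the off-diagonal blocks, that is, vectors. For
    l = 1 the fixed algebra is so(3). Since so(4) is not simple, irreducibility of the skew matrices
    is proved for d = 3 and d >= 5 only, which covers d = 2l+1 and d = 4l+4. *)

Section LieBracket.
Variables (K : fieldType) (N : nat).
Local Notation M := 'M[K]_N.
Implicit Types (x y z : M) (U V W a g h : {vspace M}).

Lemma lie_linear_r x : linear (lie x).
Proof.
move=> k y z; rewrite /lie mulmxDr mulmxDl -scalemxAr -scalemxAl scalerBr.
by rewrite opprD addrACA.
Qed.
HB.instance Definition _ x := GRing.isLinear.Build K M M _ (lie x) (lie_linear_r x).

Lemma lieN x y : lie x y = - lie y x. Proof. by rewrite /lie opprB. Qed.

Lemma lieDl x y z : lie (x + y) z = lie x z + lie y z.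
Proof. by rewrite /lie mulmxDl mulmxDr opprD addrACA. Qed.

Lemma lieZl k x z : lie (k *: x) z = k *: lie x z.
Proof. by rewrite lieN linearZ /= -scalerN -lieN. Qed.

Lemma lie0l y : lie 0 y = 0. Proof. by rewrite /lie mul0mx mulmx0 subrr. Qed.

Lemma lieNl x y : lie (- x) y = - lie x y.
Proof. by rewrite -scaleN1r lieZl scaleN1r. Qed.

Lemma lie_suml I (r : seq I) P (F : I -> M) y :
  lie (\sum_(i <- r | P i) F i) y = \sum_(i <- r | P i) lie (F i) y.
Proof.
by rewrite lieN linear_sum -sumrN; apply: eq_bigr => i _; rewrite -lieN.
Qed.

Lemma conj_lie P x y : P \in unitmx ->
  P *m lie x y *m invmx P = lie (P *m x *m invmx P) (P *m y *m invmx P).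
Proof. by move=> Pu; rewrite /lie mulmxBr mulmxBl !mulmxA !mulmxKV. Qed.

Lemma jacobi x y z : lie x (lie y z) = lie (lie x y) z + lie y (lie x z).
Proof.
rewrite /lie !(mulmxDl, mulmxDr, mulNmx, mulmxN) !mulmxA.
set p := x *m y *m z; set q := x *m z *m y; set r := y *m z *m x.
set s := z *m y *m x; set t := y *m x *m z; set u := z *m x *m y.
apply/matrixP => i j; rewrite !mxE; ring.
Qed.

Lemma lie_spanP U V W :
  (lie_span U V <= W)%VS <-> {in U & V, forall x y, lie x y \in W}.
Proof.
split=> [/subvP h x y Ux Vy|h]; last first.
  apply/span_subvP => _ /allpairsP[[u v] [/= /vbasis_mem hu /vbasis_mem hv ->]].
  exact: h.
apply: h; rewrite (coord_vbasis Ux) lie_suml memv_suml// => i _.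
rewrite lieZl memvZ// (coord_vbasis Vy) linear_sum memv_suml// => j _.
rewrite linearZ memvZ//; apply: memv_span.
by apply/allpairsP; exists ((vbasis U)`_i, (vbasis V)`_j); rewrite !mem_nth ?size_tuple.
Qed.

Lemma mem_lie_span U V x y : x \in U -> y \in V -> lie x y \in lie_span U V.
Proof. by move=> Ux Vy; apply: (lie_spanP U V _).1 Ux Vy. Qed.

Lemma lie_span0 U V :
  lie_span U V = 0%VS <-> {in U & V, forall x y, lie x y = 0}.
Proof.
split=> [h x y Ux Vy|h].
  by apply/eqP; rewrite -memv0 -h mem_lie_span.
apply/eqP; rewrite -subv0; apply/lie_spanP => x y Ux Vy.
by rewrite h ?mem0v.
Qed.

Lemma lie_submoduleP a W :
  lie_submodule a W <-> {in a & W, forall x w, lie x w \in W}.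
Proof. exact: lie_spanP. Qed.

Lemma irreducible_adjoint_simple g :
  lie_span g g <> 0%VS -> lie_irreducible g g -> lie_simple g.
Proof.
move=> gg [sub _ irr]; split=> // I [Ig gI].
exact: irr.
Qed.

End LieBracket.

(** * Traces and dimensions of subspaces of matrices *)

Section SubspaceTrace.
Variables (K : fieldType) (m n : nat).
Local Notation M := 'M[K]_(m, n).

Lemma sum_coord_delta (f : M -> K) (X : M) : scalar f ->
  f X = \sum_i \sum_j X i j * f (delta_mx i j).
Proof.
move=> lf; pose F : {linear M -> K^o} := HB.pack f (GRing.isLinear.Build K M K^o _ f lf).
rewrite -[f]/(F : M -> K^o) {1}(matrix_sum_delta X) linear_sum; apply: eq_bigr => i _.
by rewrite linear_sum; apply: eq_bigr => j _; rewrite linearZ.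
Qed.

(** If [p] projects onto [U], then [f \o p] maps the whole matrix space into [U] and agrees with [f]
    there, so both have the same trace. The right-hand side is that trace in the basis of matrix
    units, which makes dimensions and the Killing form computable. *)
Lemma subspace_trace (U : {vspace M}) (p f : {linear M -> M}) :
  (forall x, p x \in U) -> {in U, forall x, p x = x} ->
  {in U, forall x, f x \in U} ->
  \sum_(i < \dim U) coord (vbasis U) i (f (vbasis U)`_i) =
  \sum_i \sum_j (f (p (delta_mx i j))) i j.
Proof.
move=> pU pid fU.
have c_scal k : scalar (fun x : M => coord (vbasis U) k (p x)).
  by move=> c x y; rewrite linearP /= linearP.
transitivity (\sum_i \sum_j \sum_(k < \dim U)
    coord (vbasis U) k (p (delta_mx i j)) * (f (vbasis U)`_k) i j).
  under [RHS]eq_bigr do rewrite exchange_big /=.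
  rewrite exchange_big /=; apply: eq_bigr => k _.
  have kU : (vbasis U)`_k \in U by apply: vbasis_mem; rewrite mem_nth ?size_tuple.
  rewrite -[f _ in LHS]pid ?fU// (sum_coord_delta _ (c_scal k)).
  by apply: eq_bigr => i _; apply: eq_bigr => j _; rewrite mulrC.
apply: eq_bigr => i _; apply: eq_bigr => j _.
rewrite [in RHS](coord_vbasis (pU (delta_mx i j))) linear_sum summxE.
by apply: eq_bigr => k _; rewrite linearZ mxE.
Qed.

Lemma dim_trace (U : {vspace M}) (p : {linear M -> M}) :
  (forall x, p x \in U) -> {in U, forall x, p x = x} ->
  (\dim U)%:R = \sum_i \sum_j (p (delta_mx i j)) i j.
Proof.
move=> pU pid; rewrite -(subspace_trace (f := idfun) pU pid)//.
rewrite (eq_bigr (fun=> 1)) ?sumr_const ?card_ord// => i _ /=.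
by rewrite coord_free ?eqxx// (basis_free (vbasisP U)).
Qed.

End SubspaceTrace.

(** * Irreducible modules of the orthogonal algebra *)

Section SkewModel.
Variables (K : numFieldType) (d : nat).
Local Notation M := 'M[K]_d.
Implicit Types (X Y : M) (U : {vspace M}).

Definition skewv : {vspace M} := lker (linfun (@trmx K d d) + \1)%VF.
Definition symv : {vspace M} := lker (linfun (@trmx K d d) - \1)%VF.
Definition tracelessv : {vspace M} := lker (linfun (@mxtrace K d : M -> K^o)).

Lemma skewvP X : reflect (X^T = - X) (X \in skewv).
Proof.
rewrite memv_ker add_lfunE id_lfunE lfunE /= addr_eq0.
exact: eqP.
Qed.

Lemma symvP X : reflect (X^T = X) (X \in symv).
Proof.
rewrite memv_ker add_lfunE opp_lfunE id_lfunE lfunE /= subr_eq0.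
exact: eqP.
Qed.

Lemma tracelessvP X : reflect (\tr X = 0) (X \in tracelessv).
Proof. rewrite memv_ker lfunE; exact: eqP. Qed.

Lemma trmx_lie X Y : (lie X Y)^T = - lie X^T Y^T.
Proof. by rewrite /lie linearB /= !trmx_mul opprB. Qed.

Lemma skewv_lie X Y : X \in skewv -> Y \in skewv -> lie X Y \in skewv.
Proof.
move=> /skewvP hX /skewvP hY; apply/skewvP.
by rewrite trmx_lie hX hY lieNl opprK raddfN.
Qed.

Lemma symv_lie X Y : X \in skewv -> Y \in symv -> lie X Y \in symv.
Proof.
move=> /skewvP hX /symvP hY; apply/symvP.
by rewrite trmx_lie hX hY lieNl opprK.
Qed.

Lemma tracelessv_lie X Y : lie X Y \in tracelessv.
Proof. by apply/tracelessvP; rewrite /lie linearB /= mxtrace_mulC subrr. Qed.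

Lemma mul_deltaE n (a b p : 'I_d) (X : 'M[K]_(d, n)) q :
  (delta_mx a b *m X) p q = (p == a)%:R * X b q.
Proof.
rewrite mxE (bigD1 b)//= big1 => [|i ib]; rewrite !mxE ?eqxx ?andbT ?addr0//.
by rewrite (negbTE ib) andbF mul0r.
Qed.

Lemma mulmx_deltaE (a b : 'I_d) X p q : (X *m delta_mx a b) p q = X p a * (q == b)%:R.
Proof.
rewrite mxE (bigD1 a)//= big1 => [|i ib]; rewrite !mxE ?eqxx ?andbT ?addr0//=.
by rewrite (negbTE ib) mulr0.
Qed.

(** The infinitesimal rotation in the plane of coordinates [a] and [b]. Bracketing with it sends
    index [b] to [a], and index [a] to [b] with a sign. *)
Definition rotm (a b : 'I_d) : M := delta_mx a b - delta_mx b a.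

Lemma rot_skew a b : rotm a b \in skewv.
Proof. by apply/skewvP; rewrite linearB /= !trmx_delta opprB. Qed.

Lemma rotE a b p q :
  rotm a b p q = (p == a)%:R * (q == b)%:R - (p == b)%:R * (q == a)%:R.
Proof. by rewrite !mxE -!natrM !mulnb. Qed.

Lemma rotN a b : rotm a b = - rotm b a. Proof. by rewrite opprB. Qed.

Lemma lie_rotE a b X p q : lie (rotm a b) X p q =
  (p == a)%:R * X b q - (p == b)%:R * X a q - X p a * (q == b)%:R + X p b * (q == a)%:R.
Proof.
have subE (A B : M) i j : (A - B) i j = A i j - B i j by rewrite !mxE.
rewrite /lie /rotm mulmxBl mulmxBr !subE !mul_deltaE !mulmx_deltaE; ring.
Qed.

Lemma lie_rot a b c : a != b -> b != c -> a != c -> lie (rotm a b) (rotm b c) = rotm a c.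
Proof.
move=> ab bc ac; apply/matrixP => p q; rewrite lie_rotE !rotE !eqxx.
rewrite (negbTE ab) (negbTE bc) (negbTE ac) /=.
ring.
Qed.

Lemma skewv_sub U : (forall a b, a != b -> rotm a b \in U) -> (skewv <= U)%VS.
Proof.
move=> h; apply/subvP => X /skewvP hX.
have -> : X = 2^-1 *: (X - X^T).
  by rewrite hX opprK -mulr2n -scaler_nat scalerA mulVf ?scale1r// pnatr_eq0.
rewrite {2}(matrix_sum_delta X) linear_sum /= {1}(matrix_sum_delta X) -sumrB.
rewrite memvZ// memv_suml// => i _; rewrite linear_sum -sumrB memv_suml// => j _.
rewrite linearZ /= trmx_delta -scalerBr memvZ// -/(rotm i j).
by have [->|/h//] := eqVneq i j; rewrite /rotm subrr mem0v.
Qed.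

Definition ad_stable U := {in skewv & U, forall x y, lie x y \in U}.

(** Replacing one end of a pair at a time, and exchanging the ends, leads from one pair of distinct
    indices to any other. This spreads membership in a stable subspace from a single [rotm] or [spr]
    to all of them. *)
Lemma pair_connected (P : 'I_d -> 'I_d -> Prop) a b :
  (forall i j, P i j -> P j i) ->
  (forall i j k, i != j -> k != j -> k != i -> P i j -> P k j) ->
  a != b -> P a b -> forall i j, i != j -> P i j.
Proof.
move=> sym step ab Pab.
have step' i j k : i != j -> k != j -> P i j -> P k j.
  move=> ij kj Pij; have [->//|ki] := eqVneq k i; exact: step Pij.
move=> i j ij; have [ib|ib] := eqVneq i b.
  rewrite ib in ij *; apply/sym; apply: step' Pab => //; first by rewrite eq_sym.
have Pib : P i b by apply: step' Pab.
by apply/sym; apply: step' (sym _ _ Pib); rewrite eq_sym.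
Qed.

Lemma ad_stable_rot U a b : ad_stable U -> a != b -> rotm a b \in U -> (skewv <= U)%VS.
Proof.
move=> hU ab h; apply: skewv_sub; apply: (pair_connected _ _ ab h).
  by move=> i j; rewrite [rotm j i]rotN memvN.
move=> i j k ij kj ki hij.
by rewrite -(lie_rot ki ij kj) hU// rot_skew.
Qed.

Section Word.
Variables (a b c : 'I_d) (X : M).
Hypotheses (ab : a != b) (ac : a != c) (bc : b != c) (hX : X \in skewv).

Let X_skew i j : X i j = - X j i.
Proof. by move/skewvP: hX => /matrixP/(_ j i); rewrite !mxE. Qed.
Let X_diag i : X i i = 0.
Proof.
by have /eqP := X_skew i i; rewrite -addr_eq0 -mulr2n mulrn_eq0 => /eqP.
Qed.

Let neqs := (eqxx, negbTE ab, negbTE ac, negbTE bc).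
Let ba : (b == a) = false. Proof. by rewrite eq_sym (negbTE ab). Qed.
Let ca : (c == a) = false. Proof. by rewrite eq_sym (negbTE ac). Qed.
Let cb : (c == b) = false. Proof. by rewrite eq_sym (negbTE bc). Qed.

Lemma skew_word2E p q : lie (rotm c a) (lie (rotm a b) X) p q =
  (p == c)%:R * X b q - (q == c)%:R * X b p
  - X a b * ((p == a)%:R * (q == c)%:R - (p == c)%:R * (q == a)%:R)
  + X a c * ((p == b)%:R * (q == a)%:R - (p == a)%:R * (q == b)%:R).
Proof.
rewrite !lie_rotE !(neqs, ba, ca, cb) /= (X_skew p a) (X_skew p b) (X_skew c b) (X_skew c a) (X_skew b a).
rewrite !X_diag; ring.
Qed.

(** Write e_p ^ e_q for [rotm p q] and X_b for row [b] of [X]. By [skew_word2E] two brackets give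
    e_c ^ X_b - X_ab e_a ^ e_c + X_ac e_b ^ e_a. The third moves [a] to the new index [e] and makes
    the terms in e_c ^ e_e cancel; the fourth moves [b] to [f] and keeps only the term in X_ac. *)
Lemma skew_word4 e f : uniq [:: a; b; c; e; f] ->
  lie (rotm f b) (lie (rotm e a) (lie (rotm c a) (lie (rotm a b) X))) = X a c *: rotm f e.
Proof.
rewrite /= !inE !negb_or !andbT.
move=> /and4P[/and4P[_ _ ae af] /and3P[_ be bf] /andP[ce cf] ef].
have ea : (e == a) = false by rewrite eq_sym (negbTE ae).
have eb : (e == b) = false by rewrite eq_sym (negbTE be).
have ec : (e == c) = false by rewrite eq_sym (negbTE ce).
have fa : (f == a) = false by rewrite eq_sym (negbTE af).
have fb : (f == b) = false by rewrite eq_sym (negbTE bf).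
have fc : (f == c) = false by rewrite eq_sym (negbTE cf).
have fe : (f == e) = false by rewrite eq_sym (negbTE ef).
apply/matrixP => p q; rewrite [RHS]mxE rotE.
have ZE := skew_word2E; set Z := lie (rotm c a) _ in ZE *; clearbody Z.
rewrite [LHS]lie_rotE !(lie_rotE e a) !ZE.
rewrite !(neqs, ba, ca, cb, ea, eb, ec, fa, fb, fc, fe).
rewrite !(negbTE ae, negbTE af, negbTE be, negbTE bf, negbTE ce, negbTE cf, negbTE ef).
rewrite !X_diag (X_skew b a) /=; ring.
Qed.

(** With three indices only X_ba and X_bc are left in row [b], and e_c ^ X_b cancels the term in
    X_ab: two brackets already isolate X_ac. *)
Lemma skew_word2_dim3 : (forall i, i \in [:: a; b; c]) ->
  lie (rotm c a) (lie (rotm a b) X) = X a c *: rotm b a.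
Proof.
move=> abc; apply/matrixP => p q; rewrite skew_word2E mxE rotE.
have := abc p; have := abc q; rewrite !inE.
by case/or3P => /eqP-> /or3P[]/eqP->;
  rewrite !(neqs, ba, ca, cb) /= ?X_diag ?(X_skew b a) ?(X_skew b c) /=; ring.
Qed.

End Word.

Lemma ex_notin (s : seq 'I_d) : (size s < d)%N -> exists i, i \notin s.
Proof.
move=> sd; apply/existsP; rewrite -negb_forall; apply/negP => /forallP h.
have : (#|'I_d| <= size s)%N.
  apply: leq_trans (card_size s); apply: subset_leq_card; apply/fintype.subsetP => i _.
  exact: h.
by rewrite card_ord leqNgt sd.
Qed.

(** A nonzero entry X_ac is isolated by a word in the rotations, which puts one [rotm] into [U],
    hence all of them. The word of length four needs five distinct indices, the one of length two
    exactly three. The gap d = 4 is genuine, so(4) being a sum of two ideals. *)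
Lemma skewv_irreducible U : d = 3 \/ (5 <= d)%N -> (U <= skewv)%VS -> ad_stable U ->
  U = 0%VS \/ U = skewv.
Proof.
move=> hd /subvP US hU; have [->|U0] := eqVneq U 0%VS; [by left|right].
pose X := vpick U.
have XU : X \in U by rewrite memv_pick.
have XS := US _ XU.
have [a [c Xac]] : exists a c, X a c != 0.
  apply: contrapT => h; case/eqP: U0; apply/eqP; rewrite -vpick0 -/X; apply/eqP/matrixP => i j.
  by apply/eqP; rewrite mxE; apply: contrapT => /negP hij; apply: h; exists i, j.
have ac : a != c.
  apply: contraNneq Xac => <-; move/skewvP/matrixP/(_ a a): XS; rewrite !mxE => /eqP.
  by rewrite -addr_eq0 -mulr2n mulrn_eq0.
apply/eqP; rewrite eqEsubv; apply/andP; split; first exact/subvP.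
have stab i j Y : Y \in U -> lie (rotm i j) Y \in U by move=> YU; rewrite hU ?rot_skew.
have [b hb] : exists b, b \notin [:: a; c] by apply: ex_notin => /=; lia.
move: (hb); rewrite !inE negb_or => /andP[ba bc].
have ab : a != b by rewrite eq_sym.
case: hd => [d3|d5].
  have abc i : i \in [:: a; b; c].
    have u : uniq [:: a; b; c] by rewrite /= !inE negb_or ab ac bc.
    have [|_ ->] := @uniq_min_size _ _ (enum 'I_d) u (fun j _ => mem_enum _ j).
      by rewrite -cardE card_ord /= [leqLHS]d3.
    by rewrite mem_enum.
  apply: (@ad_stable_rot _ b a) => //.
  rewrite -[rotm b a](scalerK Xac) -skew_word2_dim3// memvZ//.
  by do 2!apply: (stab).
have [e he] : exists e, e \notin [:: a; b; c] by apply: ex_notin; exact: ltnW d5.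
have [f hf] : exists f, f \notin [:: a; b; c; e] by apply: ex_notin.
have u : uniq [:: a; b; c; e; f].
  rewrite -[uniq _]/(uniq (rcons [:: a; b; c; e] f)) rcons_uniq hf.
  by rewrite -[uniq _]/(uniq (rcons [:: a; b; c] e)) rcons_uniq he /= !inE negb_or ab ac bc.
have fe : f != e by move: hf; rewrite !inE !negb_or => /and4P[].
apply: (@ad_stable_rot _ f e) => //.
rewrite -[rotm f e](scalerK Xac) -(skew_word4 ab ac bc)// memvZ//.
by do 4!apply: (stab).
Qed.

Lemma lie_skewv_neq0 : (3 <= d)%N -> lie_span skewv skewv <> 0%VS.
Proof.
move=> d3 /lie_span0 h.
pose a := Ordinal (ltnW (ltnW d3)); pose b := Ordinal (ltnW d3); pose c := Ordinal d3.
have := lie_rot (isT : a != b) (isT : b != c) (isT : a != c).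
rewrite h ?rot_skew// => /matrixP/(_ a c).
rewrite rotE !eqxx mxE !mulr1n /= mulr0 subr0 mulr1 => /eqP.
by rewrite eq_sym oner_eq0.
Qed.

(** For distinct a, b, c, applying [rotm a b] and then [rotm c a] sends [x] to x_b e_c. A nonzero
    coordinate thus yields one basis vector, and rotations yield the others. *)
Lemma vector_irreducible (U : {vspace 'cV[K]_d}) : (3 <= d)%N ->
  {in skewv & U, forall x v, x *m v \in U} -> U = 0%VS \/ U = fullv.
Proof.
move=> d3 hU; have [->|U0] := eqVneq U 0%VS; [by left|right].
pose x := vpick U.
have xU : x \in U by rewrite memv_pick.
have [b xb] : exists b, x b 0 != 0.
  apply: contrapT => h; case/eqP: U0; apply/eqP; rewrite -vpick0 -/x; apply/eqP/matrixP => i j.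
  by apply/eqP; rewrite mxE ord1; apply: contrapT => /negP hij; apply: h; exists i.
have [a] : exists a, a \notin [:: b] by apply: ex_notin => /=; lia.
rewrite inE => ab.
have [c] : exists c, c \notin [:: a; b] by apply: ex_notin.
rewrite !inE negb_or => /andP[ca cb].
have rotM i j (v : 'cV[K]_d) :
    rotm i j *m v = v j 0 *: delta_mx i 0 - v i 0 *: delta_mx j 0.
  apply/matrixP => p q; rewrite /rotm mulmxBl ord1 !mxE -!mulnb !natrM.
  have h i' j' : \sum_k delta_mx i' j' p k * v k 0 = (p == i')%:R * v j' 0.
    by rewrite -mul_deltaE mxE.
  by rewrite !h eqxx !mulr1 ![_%:R * _]mulrC.
have stab i j y : y \in U -> rotm i j *m y \in U by move=> yU; rewrite hU ?rot_skew.
have ec : delta_mx c 0 \in U.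
  rewrite -[delta_mx c 0](scalerK xb) memvZ//.
  suff -> : x b 0 *: delta_mx c 0 = rotm c a *m (rotm a b *m x) by do 2!apply: (stab).
  rewrite !rotM !mxE (negbTE ca) (negbTE cb) (negbTE ab) !eqxx /=.
  by rewrite !mulr1 !mulr0 !subr0 scale0r subr0.
have ek k : delta_mx k 0 \in U.
  have [->//|kc] := eqVneq k c.
  have -> : delta_mx k 0 = rotm k c *m delta_mx c (0 : 'I_1).
    by rewrite rotM !mxE !eqxx (negbTE kc) scale1r scale0r subr0.
  exact: stab.
apply/eqP; rewrite eqEsubv subvf; apply/subvP => v _.
rewrite (matrix_sum_delta v) memv_suml// => i _; rewrite big_ord1 memvZ ?ek//.
Qed.

Definition spr (a b : 'I_d) : M := delta_mx a b + delta_mx b a.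

Lemma sprE a b p q :
  spr a b p q = (p == a)%:R * (q == b)%:R + (p == b)%:R * (q == a)%:R.
Proof. by rewrite !mxE -!natrM !mulnb. Qed.

Lemma sprC a b : spr a b = spr b a. Proof. by rewrite /spr addrC. Qed.

Lemma lie_rot_spr a b c : a != b -> b != c -> a != c -> lie (rotm a b) (spr b c) = spr a c.
Proof.
move=> ab bc ac; apply/matrixP => p q; rewrite lie_rotE !sprE !eqxx.
rewrite (negbTE ab) (negbTE bc) (negbTE ac) /=; ring.
Qed.

Lemma lie_rot_spr_diag a b : a != b -> lie (rotm a b) (spr a b) = spr a a - spr b b.
Proof.
move=> ab; apply/matrixP => p q.
have subE (A B : M) i j : (A - B) i j = A i j - B i j by rewrite !mxE.
rewrite lie_rotE subE !sprE !eqxx.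
rewrite (negbTE ab) (eq_sym b a) (negbTE ab) /=; ring.
Qed.

Lemma spr_combE al ga a b p q : (al *: (spr a a - spr b b) + ga *: spr a b) p q =
  2 * al * ((p == a)%:R * (q == a)%:R - (p == b)%:R * (q == b)%:R)
  + ga * ((p == a)%:R * (q == b)%:R + (p == b)%:R * (q == a)%:R).
Proof.
have addE (A B : M) i j : (A + B) i j = A i j + B i j by rewrite mxE.
have subE (A B : M) i j : (A - B) i j = A i j - B i j by rewrite !mxE.
have scaleE k (A : M) i j : (k *: A) i j = k * A i j by rewrite mxE.
by rewrite addE 2!scaleE subE !sprE; ring.
Qed.

(** On symmetric matrices ad [rotm a b] has the eigenvalues 0, i, -i, 2i, -2i of a plane rotation.
    The polynomial T^3 + T kills the first three and equals -3 T on the last two, so only the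
    traceless part of the block at [a], [b] contributes. *)
Lemma sym_word3 X a b : X \in symv -> a != b ->
  lie (rotm a b) (lie (rotm a b) (lie (rotm a b) X)) + lie (rotm a b) X =
  - 3 *: (X a b *: (spr a a - spr b b) + (X b b - X a a) *: spr a b).
Proof.
move=> /symvP/matrixP hX ab; have ba : (b == a) = false by rewrite eq_sym (negbTE ab).
have Xs i j : X i j = X j i by rewrite -hX mxE.
have addE (A B : M) i j : (A + B) i j = A i j + B i j by rewrite mxE.
have scaleE k (A : M) i j : (k *: A) i j = k * A i j by rewrite mxE.
apply/matrixP => p q; rewrite [LHS]addE [RHS]scaleE spr_combE !lie_rotE.
rewrite !eqxx (negbTE ab) ba (Xs p a) (Xs p b) (Xs b a) /=; ring.
Qed.

(** Since [rotm c a] is minus [rotm a c], this is minus the word of [sym_word3] for the plane of [a]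
    and [c]. The entries of [Y] that enter are 0 at (a, c) and (c, c) and 2 al at (a, a), whence the
    constant. *)
Lemma sym_word_separate a b c al ga (Y := al *: (spr a a - spr b b) + ga *: spr a b) :
  a != b -> a != c -> b != c ->
  lie (rotm a c) (lie (rotm a c) (lie (rotm c a) Y)) - lie (rotm a c) Y = (- 6 * al) *: spr a c.
Proof.
move=> ab ac bc.
have ba : (b == a) = false by rewrite eq_sym (negbTE ab).
have ca : (c == a) = false by rewrite eq_sym (negbTE ac).
have cb : (c == b) = false by rewrite eq_sym (negbTE bc).
have subE (A B : M) i j : (A - B) i j = A i j - B i j by rewrite !mxE.
have scaleE k (A : M) i j : (k *: A) i j = k * A i j by rewrite mxE.
have YE := spr_combE al ga a b; rewrite -/Y in YE; clearbody Y.
apply/matrixP => p q; rewrite [RHS]scaleE sprE [LHS]subE !lie_rotE.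
rewrite !YE !eqxx.
rewrite !(negbTE ab, negbTE ac, negbTE bc, ba, ca, cb) /=; ring.
Qed.

Lemma sym0_sub U : (forall a b, a != b -> spr a b \in U) ->
  (forall a b, spr a a - spr b b \in U) -> (symv :&: tracelessv <= U)%VS.
Proof.
move=> h h'; apply/subvP => X /memv_capP[/symvP hX /tracelessvP tX].
have [d0|d0] := posnP d.
  suff -> : X = 0 by rewrite mem0v.
  by apply/matrixP => i; have := ltn_ord i; rewrite {2}d0.
pose o := Ordinal d0.
(* The multiples of [spr o o] add up to [\tr X *: spr o o], which is zero; they turn each diagonal
   term into a difference lying in [U]. *)
have -> : X = 2^-1 *: (\sum_i \sum_j X i j *: (spr i j - (i == j)%:R *: spr o o)).
  have E : \sum_i \sum_j X i j *: (spr i j - (i == j)%:R *: spr o o) = X + X^T.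
    transitivity (\sum_i \sum_j X i j *: spr i j - \tr X *: spr o o).
      rewrite /mxtrace scaler_suml -sumrB; apply: eq_bigr => i _.
      under eq_bigr do rewrite scalerBr.
      rewrite sumrB; congr (_ - _); rewrite (bigD1 i)//= eqxx scale1r big1 ?addr0//.
      by move=> j ji; rewrite eq_sym (negbTE ji) scale0r scaler0.
    rewrite tX scale0r subr0 {2 3}(matrix_sum_delta X) linear_sum -big_split /=.
    apply: eq_bigr => i _; rewrite linear_sum -big_split /=.
    by apply: eq_bigr => j _; rewrite linearZ /= trmx_delta -scalerDr.
  by rewrite E hX -mulr2n -scaler_nat scalerA mulVf ?scale1r// pnatr_eq0.
rewrite memvZ// memv_suml// => i _; rewrite memv_suml// => j _; rewrite memvZ//.
by have [->|ij] := eqVneq i j; rewrite ?scale1r// scale0r subr0 h.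
Qed.

Lemma sym0_irreducible U : (3 <= d)%N -> (U <= symv :&: tracelessv)%VS -> ad_stable U ->
  U = 0%VS \/ U = (symv :&: tracelessv)%VS.
Proof.
move=> d3 /subvP US hU; have [->|U0] := eqVneq U 0%VS; [by left|right].
pose X := vpick U.
have XU : X \in U by rewrite memv_pick.
have [XS XT] := memv_capP (US _ XU).
have stab i j Y : Y \in U -> lie (rotm i j) Y \in U by move=> YU; rewrite hU ?rot_skew.
(* Without such a pair [X] would be a scalar matrix, and a traceless scalar matrix is zero. *)
have [a [b [ab hab]]] : exists a b, a != b /\ (X a b != 0 \/ X b b - X a a != 0).
  apply: contrapT => h.
  have h0 i j : i != j -> X i j = 0 /\ X j j = X i i.
    move=> ij; split; apply/eqP; apply: contrapT => /negP hij; apply: h; exists i, j; split=> //.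
      by left.
    by right; rewrite subr_eq0.
  have XE i : X = (X i i)%:M.
    apply/matrixP => p q; rewrite mxE; have [<-|pq] := eqVneq p q; last by rewrite (h0 _ _ pq).1.
    by have [->//|ip] := eqVneq i p; rewrite (h0 _ _ ip).2.
  pose o := Ordinal (ltnW (ltnW d3)).
  have := tracelessvP _ XT; rewrite (XE o) mxtrace_scalar => /eqP.
  rewrite mulrn_eq0 => /orP[/eqP d0|/eqP X0]; first by move: (d3); rewrite d0.
  by case/eqP: U0; apply/eqP; rewrite -vpick0 -/X (XE o) X0 raddf0.
pose al := X a b; pose ga := X b b - X a a.
pose Y := al *: (spr a a - spr b b) + ga *: spr a b.
have YU : Y \in U.
  have n3 : (-3 : K) != 0 by rewrite oppr_eq0 pnatr_eq0.
  rewrite -[Y](scalerK n3) memvZ//.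
  suff -> : -3 *: Y = lie (rotm a b) (lie (rotm a b) (lie (rotm a b) X)) + lie (rotm a b) X.
    by rewrite memvD ?stab// ?stab// ?stab.
  by rewrite sym_word3.
have [c] : exists c, c \notin [:: a; b] by apply: ex_notin.
rewrite !inE negb_or => /andP[ca cb].
(* For al = 0 the element [Y] is a multiple of [spr a b]; otherwise a third index extracts the
   coefficient al. *)
have [i [j [ij ijU]]] : exists i j, i != j /\ spr i j \in U.
  have [al0|al0] := eqVneq al 0.
    case: hab => [/eqP//|ga0]; exists a, b; split=> //.
    by rewrite -[spr a b](scalerK ga0) memvZ//; move: YU; rewrite /Y al0 scale0r add0r.
  exists a, c; split; first by rewrite eq_sym.
  have n6 : -6 * al != 0 by rewrite mulf_neq0// oppr_eq0 pnatr_eq0.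
  rewrite -[spr a c](scalerK n6) memvZ// -(@sym_word_separate a b c al ga)//; try by rewrite eq_sym.
  by rewrite -/Y memvB ?stab// ?stab// stab.
have hs := pair_connected (P := fun i j => spr i j \in U) _ _ ij ijU.
have {}hs p q : p != q -> spr p q \in U.
  apply: hs => [i' j'|i' j' k i'j' kj' ki']; first by rewrite sprC.
  by move=> h; rewrite -(lie_rot_spr ki' i'j' kj') stab.
apply/eqP; rewrite eqEsubv; apply/andP; split; first exact/subvP.
apply: sym0_sub => // p q; have [->|pq] := eqVneq p q; first by rewrite subrr mem0v.
by rewrite -lie_rot_spr_diag// stab// hs.
Qed.

(** The dimension is the trace of the projection X -> (X + X^T)/2 - (tr X / d) 1, evaluated on
    matrix units in characteristic 0. The doubled equation avoids halving d (d+1). *)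
Lemma dim_sym0 : (0 < d)%N -> ((\dim (symv :&: tracelessv)).*2 + 2 = d * d.+1)%N.
Proof.
move=> d0; have dn0 : (d%:R : K) != 0 by rewrite pnatr_eq0 -lt0n.
pose p (X : M) : M := 2^-1 *: (X + X^T) - (d%:R^-1 * \tr X) *: 1%:M.
have p_lin : linear p.
  move=> k X Y; rewrite /p; have -> : (k *: X + Y)^T = k *: X^T + Y^T by rewrite linearP.
  have -> : \tr (k *: X + Y) = k * \tr X + \tr Y by rewrite linearP.
  rewrite addrACA -scalerDr (scalerDr 2^-1) scalerA [2^-1 * k]mulrC -[(k / 2) *: _]scalerA.
  rewrite mulrDr mulrCA scalerDl -[(k * _) *: _]scalerA opprD addrACA -scalerBr //.
pose P : {linear M -> M} := HB.pack p (GRing.isLinear.Build K M M _ p p_lin).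
have half2 (Z : M) : 2^-1 *: (Z + Z) = Z.
  by rewrite -mulr2n -scaler_nat scalerA mulVf ?scale1r// pnatr_eq0.
have pU X : P X \in (symv :&: tracelessv)%VS.
  apply/memv_capP; split.
    apply/symvP; rewrite /= /p.
    by rewrite linearB /= !linearZ /= linearD /= trmxK trmx1 [X^T + X]addrC.
  apply/tracelessvP; rewrite /= /p linearB /= !linearZ /= linearD /= mxtrace_tr mxtrace1.
  by rewrite mulrAC mulVf// mul1r; field.
have pid : {in (symv :&: tracelessv)%VS, forall X, P X = X}.
  move=> X /memv_capP[/symvP hX /tracelessvP tX].
  by rewrite /= /p hX tX mulr0 scale0r subr0 half2.
have E := dim_trace pU pid; apply/eqP; rewrite -(eqr_nat K) natrD -muln2 natrM E natrM mulrSr; apply/eqP.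
transitivity ((\sum_(i < d) \sum_(j < d) (2^-1 * (1 + (i == j)%:R) - d%:R^-1 * (i == j)%:R : K)) * 2 + 2).
  congr (_ * _ + _); apply: eq_bigr => i _; apply: eq_bigr => j _.
  rewrite /= /p !mxE !eqxx /=.
  have -> : \tr (delta_mx i j : M) = (i == j)%:R.
    rewrite /mxtrace (bigD1 i)//= big1 => [|k ki]; rewrite !mxE ?eqxx ?addr0//=.
    by rewrite (negbTE ki).
  by rewrite [j == i]eq_sym; case: (i == j); rewrite /= ?mulr1 ?mulr0.
have S i : \sum_(j < d) (i == j)%:R = 1 :> K.
  by rewrite (bigD1 i)//= eqxx big1 ?addr0// => j ji; rewrite eq_sym (negbTE ji).
have T (i : 'I_d) : \sum_(j < d) (2^-1 * (1 + (i == j)%:R) - d%:R^-1 * (i == j)%:R) =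
    2^-1 * (d%:R + 1) - d%:R^-1 :> K.
  by rewrite sumrB -!mulr_sumr big_split /= S sumr_const card_ord mulr1.
rewrite (eq_bigr _ (fun i _ => T i)) sumr_const card_ord -[_ *+ d]mulr_natr.
by field; rewrite dn0.
Qed.

End SkewModel.

(** * Cartan subalgebras of the orthogonal algebra *)

Section Commuting.
Variable V : zmodType.
Implicit Types f g : {additive V -> V}.

Lemma iter_additive0 (f : {additive V -> V}) k : iter k f 0 = 0.
Proof. by elim: k => //= k ->; rewrite raddf0. Qed.

Lemma iter_additiveD (f : {additive V -> V}) k x y : iter k f (x + y) = iter k f x + iter k f y.
Proof. by elim: k => //= k ->; rewrite raddfD. Qed.

(** In the binomial expansion of (f - g)^(k+l) every term contains f^k or g^l. The induction on k +
    l reaches this without expanding: applying [f] to y lowers k, applying [g] lowers l. *)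
Lemma iter_sub_commuting f g (h : {additive V -> V}) k l y :
  (forall z, h z = f z - g z) -> (forall z, f (g z) = g (f z)) ->
  iter k f y = 0 -> iter l g y = 0 -> iter (k + l) h y = 0.
Proof.
move=> hE fg; have gf n z : iter n g (f z) = f (iter n g z).
  by elim: n => //= n ->; rewrite fg.
have fgn n z : iter n f (g z) = g (iter n f z).
  by elim: n => //= n ->; rewrite fg.
have [n] := ubnP (k + l); elim: n k l y => // n IH k l y.
case: k => [|k] kln fy gy.
  by rewrite (fy : y = 0) iter_additive0.
case: l => [|l] in kln gy *; first by rewrite /= in gy; rewrite gy iter_additive0.
rewrite addSn iterSr hE iter_additiveD.
have -> : iter (k + l.+1) h (f y) = 0.
  apply: IH; first by rewrite -ltnS -addSn.
    by rewrite -iterSr.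
  by rewrite gf gy raddf0.
have -> : iter (k + l.+1) h (- g y) = - iter (k + l.+1) h (g y).
  by elim: (k + l.+1)%N => //= m ->; rewrite raddfN.
rewrite addnS -addSn IH ?oppr0 ?addr0//.
- by move: kln; rewrite addSn addnS.
- by rewrite fgn fy raddf0.
- by rewrite -iterSr.
Qed.

End Commuting.

(** * Interpolation and the semisimple part of a matrix *)

Section PolyCRT.
Variable K : fieldType.

(** The Chinese remainder theorem for the powers of the X - a, one root being added at a time
    through a Bezout relation. For [m] large, such a [p] evaluated at a matrix with spectrum in [rs]
    acts on the generalized eigenspace of a as the scalar a. *)
Lemma poly_crt (rs : seq K) m : uniq rs ->
  exists p : {poly K}, {in rs, forall a, ('X - a%:P) ^+ m %| p - a%:P}%R.
Proof.
elim: rs => [|b rs IH] /=; first by exists 0.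
case/andP => brs /IH[p hp].
pose q := \prod_(a <- rs) ('X - a%:P) ^+ m.
have cop : coprimep q (('X - b%:P) ^+ m).
  rewrite coprimep_sym /q big_seq; elim/big_ind: _ => [|u v hu hv|a ars].
  - exact: coprimep1.
  - by rewrite coprimepMr hu.
  apply: coprimep_expl; apply: coprimep_expr; rewrite coprimep_XsubC root_XsubC.
  by apply: contraNneq brs => <-.
have [[u v] /= uv] := Bezout_eq1_coprimepP _ _ cop.
exists (p + (b%:P - p) * (u * q)) => a; rewrite inE => /predU1P[->|ars].
  have -> : p + (b%:P - p) * (u * q) - b%:P = (p - b%:P) * (v * ('X - b%:P) ^+ m).
    have -> : u * q = 1 - v * ('X - b%:P) ^+ m by rewrite -uv addrK.
    ring.
  by rewrite mulrA dvdp_mull.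
have -> : p + (b%:P - p) * (u * q) - a%:P = (p - a%:P) + (b%:P - p) * (u * q) by ring.
rewrite dvdp_add ?hp// dvdp_mull// dvdp_mull// /q (big_rem a)//=.
exact: dvdp_mulr.
Qed.

End PolyCRT.

Section JordanOdd.
Variables (K : numClosedFieldType) (n : nat).
Local Notation M := 'M[K]_n.+1.
Implicit Types x y : M.

Lemma trmx_horner x (p : {poly K}) : (horner_mx x p)^T = horner_mx x^T p.
Proof.
elim/poly_ind: p => [|p c IH]; first by rewrite !rmorph0 trmx0.
rewrite !rmorphD !rmorphM /= !horner_mx_X !horner_mx_C linearD /= tr_scalar_mx.
rewrite -mulmxE trmx_mul IH; congr (_ + _).
exact: comm_mx_horner.
Qed.

Lemma horner_mx_opp x (p : {poly K}) : horner_mx (- x) p = horner_mx x (p \Po - 'X).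
Proof.
elim/poly_ind: p => [|p c IH]; first by rewrite comp_poly0 !rmorph0.
rewrite comp_poly_MXaddC !rmorphD !rmorphM rmorphN /= IH !horner_mx_X !horner_mx_C.
by [].
Qed.

(** A solution [p] of [poly_crt] is antisymmetrized to (p(X) - p(-X))/2. The congruence of [p] at
    -a, after X -> -X, says that p(-X) is -a modulo (X - a)^m; this is where the symmetry of [rs]
    enters. *)
Lemma odd_crt (rs : seq K) m : uniq rs -> {in rs, forall a, - a \in rs} ->
  exists q : {poly K}, q \Po - 'X = - q /\ {in rs, forall a, ('X - a%:P) ^+ m %| q - a%:P}%R.
Proof.
move=> urs sym; have [p hp] := poly_crt m urs.
exists (2^-1 *: (p - (p \Po - 'X))).
have XX : - 'X \Po - 'X = 'X :> {poly K} by rewrite -[- 'X in X in X \Po _]scaleN1r comp_polyZ comp_polyX scaleN1r opprK.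
split; first by rewrite comp_polyZ comp_polyB -comp_polyA XX comp_polyXr -scalerN opprB.
move=> a ars; have -> : 2^-1 *: (p - (p \Po - 'X)) - a%:P =
    2^-1 *: ((p - a%:P) - ((p - (- a)%:P) \Po - 'X)).
  rewrite comp_polyB comp_polyC polyCN opprK.
  have aE : a%:P = 2^-1 *: (a%:P + a%:P).
    by rewrite -mulr2n -scaler_nat scalerA mulVf ?scale1r// pnatr_eq0.
  by rewrite {1}aE -scalerBr; congr (_ *: _); ring.
rewrite dvdpZr ?invr_eq0 ?pnatr_eq0// dvdp_sub ?hp//.
have := dvdp_comp_poly (- 'X) (hp _ (sym _ ars)); rewrite rmorphXn /= comp_polyB comp_polyX comp_polyC.
have -> : - 'X - (- a)%:P = - ('X - a%:P) by rewrite polyCN opprK opprB addrC.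
by rewrite exprNn -signr_odd mulr_sign; case: ifP => _; rewrite ?dvdpNl.
Qed.

(* The semisimple part of x, as an odd polynomial in x. *)
Lemma jordan_odd x : exists q : {poly K},
  [/\ q \Po - 'X = - q, diagonalizable (horner_mx x q) & (x - horner_mx x q) ^+ n.+1 = 0].
Proof.
have [r hr] := closed_field_poly_normal (char_poly x).
(* The spectrum of [x] closed under negation, so that an odd polynomial can interpolate on it. Added
   points are harmless: the power of [f] below only has to be a multiple of the minimal
   polynomial. *)
pose rs := undup (r ++ map -%R r).
have urs : uniq rs by rewrite undup_uniq.
have sym : {in rs, forall a, - a \in rs}.
  move=> a; rewrite !mem_undup !mem_cat => /orP[ar|/mapP[b br ->]].
    by rewrite map_f ?orbT.
  by rewrite opprK br.
have szr : size r = n.+1.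
  apply/eqP; rewrite -eqSS -(size_char_poly x) hr.
  by rewrite (monicP (char_poly_monic x)) scale1r size_prod_XsubC.
have [q [qodd hq]] := odd_crt n.+1 urs sym.
pose f := \prod_(a <- rs) ('X - a%:P).
have xf : horner_mx x (f ^+ n.+1) = 0.
  apply/mxminpoly_minP; apply: (dvdp_trans (mxminpoly_dvd_char x)).
  rewrite hr (monicP (char_poly_monic x)) scale1r -szr.
  have : {in r, forall a, 'X - a%:P %| f}.
    move=> a ar; rewrite /f (big_rem a) /= ?dvdp_mulr//.
    by rewrite mem_undup mem_cat ar.
  elim: (r) => [|a r' IH] h; first by rewrite big_nil.
  rewrite big_cons /= exprS dvdp_mul ?h ?mem_head// IH// => b br'.
  by apply: h; rewrite inE br' orbT.
exists q; split=> //.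
- apply/diagonalizableP; exists rs => //; apply/mxminpoly_minP.
  have -> : horner_mx (horner_mx x q) f = horner_mx x (\prod_(a <- rs) (q - a%:P)).
    rewrite /f !rmorph_prod; apply: eq_bigr => a _.
    by rewrite !rmorphB /= horner_mx_X !horner_mx_C.
  have /dvdpP[g ->] : f ^+ n.+1 %| \prod_(a <- rs) (q - a%:P).
    rewrite /f -prodrXl !big_seq.
    elim/big_ind2: _ => // u1 u2 v1 v2; exact: dvdp_mul.
  by rewrite rmorphM /= xf mulr0.
(* [q] takes the value a at every a in [rs], so [f] divides X - q, which makes x - q(x)
   nilpotent. *)
have fX : f %| 'X - q.
  apply: uniq_roots_dvdp; last by rewrite uniq_rootsE.
  apply/allP => a ars; rewrite /root !hornerE.
  have : 'X - a%:P %| q - a%:P by apply: dvdp_trans (hq _ ars); rewrite exprS dvdp_mulr.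
  by rewrite dvdp_XsubCl /root !hornerE subr_eq0 => /eqP->; rewrite subrr.
have -> : x - horner_mx x q = horner_mx x ('X - q) by rewrite rmorphB /= horner_mx_X.
rewrite -rmorphXn; have /dvdpP[g ->] : f ^+ n.+1 %| ('X - q) ^+ n.+1 by apply: dvdp_exp2r.
by rewrite rmorphM /= xf mulr0.
Qed.

(** Left and right multiplication by [x] are commuting nilpotent operators whose difference is ad
    x. *)
Lemma ad_nilpotent x : x ^+ n.+1 = 0 -> forall y, iter (n.+1 + n.+1) (lie x) y = 0.
Proof.
move=> xn y; pose L : {additive M -> M} := mulmx x; pose R : {additive M -> M} := mulmxr x.
have itL k : iter k L y = x ^+ k * y.
  by elim: k => [|k /= ->]; rewrite ?mul1r// exprS -mulrA.
have itR k : iter k R y = y * x ^+ k.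
  by elim: k => [|k /= ->]; rewrite ?mulr1// exprSr mulrA.
apply: (@iter_sub_commuting _ L R) => //.
- by move=> z /=; rewrite mulmxA.
- by rewrite itL xn mul0r.
- by rewrite itR xn mulr0.
Qed.

Lemma lie_diagE (x y : M) i j : (forall i j, i != j -> x i j = 0) ->
  lie x y i j = (x i i - x j j) * y i j.
Proof.
move=> hx; rewrite /lie !mxE (bigD1 i)//= big1 ?addr0 => [|k ki]; last first.
  by rewrite hx 1?eq_sym// mul0r.
rewrite (bigD1 j)//= big1 ?addr0 => [|k kj]; last by rewrite hx// mulr0.
by rewrite mulrBl [y i j * _]mulrC.
Qed.

(** In a basis diagonalizing [x], ad x multiplies each matrix entry by a scalar, and a scalar with a
    vanishing power is zero. *)
Lemma diagonalizable_ad_nil (x y : M) k :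
  diagonalizable x -> iter k (lie x) y = 0 -> lie x y = 0.
Proof.
move=> [P Pu] /(diagonalizable_forP _ Pu) hD it0.
set D := P *m x *m invmx P in hD; set y' := P *m y *m invmx P.
have itE m : P *m iter m (lie x) y *m invmx P = iter m (lie D) y'.
  by elim: m => //= m <-; rewrite conj_lie.
have itD m i j : iter m (lie D) y' i j = (D i i - D j j) ^+ m * y' i j.
  by elim: m => [|m IH] /=; rewrite ?mul1r// lie_diagE// IH exprS mulrA.
have D0 : lie D y' = 0.
  apply/matrixP => i j; rewrite lie_diagE// [RHS]mxE.
  have /matrixP/(_ i j)/eqP := itE k; rewrite it0 mulmx0 mul0mx itD mxE eq_sym.
  rewrite mulf_eq0 expf_eq0 => /orP[/andP[_ /eqP h]|/eqP->]; last by rewrite mulr0.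
  by rewrite h mul0r.
have := conj_lie x y Pu; rewrite -/D -/y' D0 => /(congr1 (fun z => invmx P *m z *m P)).
by rewrite !mulmxA mulVmx// mul1mx mulmxKV// mulmx0 mul0mx.
Qed.

End JordanOdd.

(** * Engel's theorem relative to a self-normalizing subalgebra *)

Section Engel.
Variables (K : fieldType) (N : nat).
Local Notation M := 'M[K]_N.
Implicit Types (h L : {vspace M}) (x y : M).

Lemma iter_lie_mem h x y k : x \in h -> y \in h -> iter k (lie x) y \in iter k (lie_span h) h.
Proof. by move=> xh yh; elim: k => //= k IH; rewrite mem_lie_span. Qed.

Lemma nilpotent_ad h : lie_nilpotent h -> exists k, {in h &, forall x y, iter k (lie x) y = 0}.
Proof.
move=> [k hk]; exists k => x y xh yh; apply/eqP; rewrite -memv0 -hk.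
exact: iter_lie_mem.
Qed.

Lemma lcs_sub h k : lie_subalgebra h -> (iter k.+1 (lie_span h) h <= iter k (lie_span h) h)%VS.
Proof.
move=> sub; elim: k => //= k IH.
apply/lie_spanP => x y xh yk; rewrite mem_lie_span//; exact: (subvP IH).
Qed.

Lemma lcs_sub0 h k : lie_subalgebra h -> (iter k (lie_span h) h <= h)%VS.
Proof.
move=> sub; elim: k => [|k IH]; first exact: subvv.
exact: subv_trans (lcs_sub k sub) IH.
Qed.

(* Engel's theorem for the action of a nilpotent algebra h on L / h, by
   descending along the lower central series: modulo the next term, the
   operators of each term commute on the vectors killed by that next term. *)
Lemma engel_normalizer h L :
  lie_subalgebra h -> lie_nilpotent h -> {in h & L, forall x y, lie x y \in L} ->
  (forall x y, x \in h -> y \in L -> exists k, iter k (lie x) y \in h) ->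
  (forall v, v \in L -> {in h, forall x, lie x v \in h} -> v \in h) ->
  (L <= h)%VS.
Proof.
move=> sub [n hn] hL nil norm; apply/subvP => v0 v0L; apply: contrapT => /negP v0h.
pose C k := iter k (lie_span h) h.
have Ch k x : x \in C k -> x \in h by move/(subvP (lcs_sub0 k sub)).
(* The case k = 0 contradicts the normalizer condition. The claim itself goes by descending
   induction on k, starting where [C k] vanishes. *)
suff step k : exists v, [/\ v \in L, v \notin h & {in C k, forall x, lie x v \in h}].
  by have [v [vL /negP vh /(norm _ vL)]] := step 0.
have [m] := ubnP (n - k); elim: m k => // m IH k.
have [nk _|kn kmn] := leqP n k.
  exists v0; split=> // x; suff -> : C k = 0%VS.
    by rewrite memv0 => /eqP->; rewrite lie0l mem0v.
  by apply/eqP; rewrite -subv0 -hn -(subnKC nk); elim: (k - n)%N => [|j IHj];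
     rewrite ?addn0 ?subvv// addnS; apply: subv_trans (lcs_sub _ sub) IHj.
have [v [vL vh hv]] : exists v, [/\ v \in L, v \notin h & {in C k.+1, forall x, lie x v \in h}].
  by apply: IH; rewrite -ltnS (leq_trans _ kmn)// ltnS ltn_sub2l.
suff [w [wL wh _ hw]] : exists w, [/\ w \in L, w \notin h,
    {in C k.+1, forall x, lie x w \in h} & {in (vbasis (C k) : seq M), forall x, lie x w \in h}].
  exists w; split=> // x xk; rewrite (coord_vbasis xk) lie_suml memv_suml// => i _.
  by rewrite lieZl memvZ// hw// mem_nth ?size_tuple.
have : {subset (vbasis (C k) : seq M) <= C k} by move=> x; apply: vbasis_mem.
elim: (tval (vbasis (C k))) => [|x s IHs] sC.
  by exists v; split=> // z; rewrite in_nil.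
have [|u [uL uh uC us]] := IHs; first by move=> y ys; apply: sC; rewrite inE ys orbT.
have xC : x \in C k by apply: sC; rewrite mem_head.
have xh := Ch _ _ xC.
pose inv w := [/\ w \in L, {in C k.+1, forall z, lie z w \in h} & {in s, forall z, lie z w \in h}].
(* By Jacobi [z, [x, w]] = [[z, x], w] + [x, [z, w]]. For x and z in [C k] the bracket [z, x] falls
   into [C k.+1], whose elements send w into [h]. *)
have inv_step w : inv w -> inv (lie x w).
  move=> [wL wC ws]; split; first exact: hL.
    move=> z zC; rewrite jacobi memvD//.
      apply: wC; rewrite -[_ \in _]/(_ \in lie_span h (C k)) lieN memvN mem_lie_span//.
      exact: (subvP (lcs_sub k sub)).
    by apply: (lie_spanP h h h).1 => //; apply: wC.
  move=> z zs; have zC : z \in C k by apply: sC; rewrite inE zs orbT.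
  rewrite jacobi memvD//.
    by apply: wC; rewrite -[_ \in _]/(_ \in lie_span h (C k)) mem_lie_span// (Ch k).
  by apply: (lie_spanP h h h).1 => //; apply: ws.
have inv_iter j : inv (iter j (lie x) u) by elim: j => //= j; apply: inv_step.
have exj : exists j, iter j (lie x) u \in h by apply: nil.
(* The last iterate of ad x on [u] that is still outside [h] is the vector sought. *)
case: (ex_minnP exj) => [[|j]] jh jmin; first by rewrite /= in jh; rewrite jh in uh.
exists (iter j (lie x) u); have [wL wC ws] := inv_iter j; split=> //.
  by apply/negP => /jmin; rewrite ltnn.
move=> z; rewrite inE => /predU1P[->|]; [exact: jh|exact: ws].
Qed.

End Engel.

Section DiagonalMul.
Variables (K : fieldType) (d : nat).
Implicit Types A D : 'M[K]_d.

Lemma mulmx_diagr A D i j : (forall k l, k != l -> D k l = 0) -> (A *m D) i j = A i j * D j j.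
Proof.
move=> hD; rewrite mxE (bigD1 j)//= big1 ?addr0// => k kj.
by rewrite hD// mulr0.
Qed.

Lemma mulmx_diagl A D i j : (forall k l, k != l -> D k l = 0) -> (D *m A) i j = D i i * A i j.
Proof.
move=> hD; rewrite mxE (bigD1 i)//= big1 ?addr0// => k ki.
by rewrite hD ?mul0r// eq_sym.
Qed.

(* P x P^T holds the coordinates of x in the tensor square, on which t acts by
   the sums of its diagonal values. *)
Lemma lie_bicoord (P t x : 'M[K]_d) : P \in unitmx -> t^T = - t ->
  P *m lie t x *m P^T = (P *m t *m invmx P) *m (P *m x *m P^T)
                      + (P *m x *m P^T) *m (P *m t *m invmx P)^T.
Proof.
move=> Pu ts; set c := P *m t *m invmx P; have cK : P *m t = c *m P by rewrite /c mulmxKV.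
have h' : P^T *m c^T = - (t *m P^T) by rewrite -trmx_mul -cK trmx_mul ts mulNmx.
by rewrite -[X in _ = _ + X]mulmxA h' mulmxN /lie mulmxBr mulmxBl !mulmxA cK.
Qed.

Lemma diag_bicoord D A i j : (forall k l, k != l -> D k l = 0) ->
  (D *m A + A *m D^T) i j = (D i i + D j j) * A i j.
Proof.
move=> hD; have hDt k l : k != l -> D^T k l = 0 by move=> kl; rewrite mxE hD// eq_sym.
by rewrite mxE mulmx_diagl// mulmx_diagr// [D^T j j]mxE mulrDl [A i j * _]mulrC.
Qed.

End DiagonalMul.

(** * A basis adapted to a Cartan subalgebra of so(d) *)

Section CartanSkew.
Variables (K : numClosedFieldType) (n : nat).
Local Notation d := n.+1.
Local Notation M := 'M[K]_d.
Local Notation skewv := (skewv K d).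
Variable h : {vspace M}.
Hypothesis hC : cartan_subalgebra skewv h.

Let h_skew x : x \in h -> x^T = - x.
Proof. by have [/subvP hs _ _ _] := hC => /hs /skewvP. Qed.

Let h_norm x : x^T = - x -> (forall y, y \in h -> lie x y \in h) -> x \in h.
Proof. by have [_ _ _ nrm] := hC => /skewvP; exact: nrm. Qed.

Let h_ad x y : x \in h -> y \in h -> exists k, iter k (lie x) y = 0.
Proof. by have [_ _ /nilpotent_ad[k hk] _] := hC => xh yh; exists k; exact: hk. Qed.

Let h_diag_central t y : t \in h -> diagonalizable t -> y \in h -> lie t y = 0.
Proof. by move=> th td yh; have [k] := h_ad th yh; apply: diagonalizable_ad_nil. Qed.

(** On [h], ad q(x) is ad x minus the ad of a nilpotent matrix commuting with [x], hence nilpotent;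
    q(x) being diagonalizable, it acts by zero. So q(x) centralizes [h], and self-normalization puts
    it in [h]. *)
Let h_jordan x : x \in h ->
  exists t, [/\ t \in h, diagonalizable t & (x - t) ^+ n.+1 = 0].
Proof.
move=> xh; have [q [qodd qd qn]] := jordan_odd x; exists (horner_mx x q); split=> //.
have qskew : (horner_mx x q)^T = - horner_mx x q.
  by rewrite trmx_horner (h_skew xh) horner_mx_opp qodd rmorphN.
apply: h_norm => // y yh; suff -> : lie (horner_mx x q) y = 0 by rewrite mem0v.
have [k xk] := h_ad xh yh.
apply: (@diagonalizable_ad_nil _ _ _ _ (k + (n.+1 + n.+1))) => //.
apply: (@iter_sub_commuting _ (lie x) (lie (x - horner_mx x q))) => //.
- by move=> z /=; rewrite lieDl lieNl subKr.
- move=> z /=; rewrite jacobi; suff -> : lie x (x - horner_mx x q) = 0 by rewrite lie0l add0r.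
  rewrite linearB /= /lie subrr sub0r; apply/eqP; rewrite oppr_eq0 subr_eq0; apply/eqP.
  exact: comm_mx_horner.
- exact: ad_nilpotent.
Qed.

(** If every finite list of diagonalizable elements of [h] left one outside its span, the spans
    would grow beyond the dimension of the matrix space. *)
Let ex_torus : exists As : seq M, {in As, forall t, t \in h /\ diagonalizable t} /\
  forall t, t \in h -> diagonalizable t -> t \in <<As>>%VS.
Proof.
apply: contrapT => hno.
have step k : exists As : seq M, {in As, forall t, t \in h /\ diagonalizable t} /\
    (k <= \dim <<As>>)%N.
  elim: k => [|k [As [hA kA]]]; first by exists [::].
  have [t [th [td tA]]] : exists t, t \in h /\ diagonalizable t /\ t \notin <<As>>%VS.
    apply: contrapT => h'; apply: hno; exists As; split=> // t th td.
    by apply: contrapT => /negP tA; apply: h'; exists t.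
  exists (t :: As); split; first by move=> u; rewrite inE => /predU1P[->//|]; exact: hA.
  apply: leq_ltn_trans kA _.
  have s : (<<As>> <= <<t :: As>>)%VS by rewrite span_cons addvSr.
  rewrite ltn_neqAle dimvS// andbT; apply: contraNneq tA => /eqP.
  by rewrite (dimv_leqif_eq s) => /eqP->; rewrite memv_span ?mem_head.
have [As [_]] := step (\dim (fullv : {vspace M})).+1.
by rewrite leqNgt ltnS dimvS ?subvf.
Qed.

(** [P *m P^T] is the Gram matrix of the rows of [P] for the standard symmetric form. It has one
    nonzero entry in each row, pairing coordinate i with [tau i], and at most one coordinate is
    paired with itself. *)
Definition witt_matrix (P : M) (tau : 'I_d -> 'I_d) :=
  [/\ P \in unitmx, involutive tau,
      forall i j, ((P *m P^T) i j != 0) = (j == tau i) &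
      forall i j, tau i = i -> tau j = j -> i = j].

Section Torus.
Variables (As : seq M) (P : M).
Hypotheses (As_h : {in As, forall t, t \in h /\ diagonalizable t})
  (As_span : forall t, t \in h -> diagonalizable t -> t \in <<As>>%VS)
  (Pu : P \in unitmx)
  (As_diag : {in As, forall t i j, i != j -> (P *m t *m invmx P) i j = 0}).

Let c t := P *m t *m invmx P.
Let w i t := c t i i.

Let c_linear : linear c.
Proof. by move=> k x y; rewrite /c linearP /= mulmxDl -scalemxAl. Qed.
HB.instance Definition _ := GRing.isLinear.Build K M M _ c c_linear.

Let span_diag t i j : t \in <<As>>%VS -> i != j -> c t i j = 0.
Proof.
move=> /(coord_span (X := in_tuple As)) -> ij; rewrite linear_sum summxE big1// => k _.
by rewrite linearZ mxE /= [c _ _ _]As_diag ?mulr0// mem_nth.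
Qed.

Let same i j := forall t, t \in As -> w i t = w j t.

Let span_same t i j : same i j -> t \in <<As>>%VS -> c t i i = c t j j.
Proof.
move=> ij /(coord_span (X := in_tuple As)) ->; rewrite linear_sum !summxE.
apply: eq_bigr => k _; rewrite linearZ /= [LHS]mxE [RHS]mxE; congr (_ * _).
by apply: ij; rewrite mem_nth.
Qed.

Let cK t : P *m t = c t *m P. Proof. by rewrite /c mulmxKV. Qed.

(** [B] is the Gram matrix of the rows of [P], and [G] that of the columns of its inverse, in which
    the coordinates of vectors are taken below. *)
Let B := P *m P^T.
Let G := invmx B.

Let Bu : B \in unitmx. Proof. by rewrite unitmx_mul Pu unitmx_tr. Qed.
Let Bsym : B^T = B. Proof. by rewrite /B trmx_mul trmxK. Qed.
Let Gu : G \in unitmx. Proof. by rewrite unitmx_inv Bu. Qed.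
Let Gsym : G^T = G. Proof. by rewrite /G trmx_inv Bsym. Qed.

Let As_skew t : t \in As -> t^T = - t. Proof. by move=> /As_h[/h_skew]. Qed.

Let tr_diag t i j : t \in As -> i != j -> (c t)^T i j = 0.
Proof. by move=> tA ij; rewrite mxE As_diag// eq_sym. Qed.

Let lie_coord t x : t^T = - t -> P *m lie t x *m P^T = c t *m (P *m x *m P^T) + (P *m x *m P^T) *m (c t)^T.
Proof. exact: lie_bicoord. Qed.

Let diag_act t (y : M) i j : t \in As -> (c t *m y + y *m (c t)^T) i j = (w i t + w j t) * y i j.
Proof. by move=> tA; apply: diag_bicoord => k l; apply: As_diag. Qed.

(** The identity matrix commutes with [t]; in the coordinates P x P^T it becomes [B], whose entries
    get multiplied by w_i + w_j. *)
Let B_weight i j t : t \in As -> B i j != 0 -> w i t + w j t = 0.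
Proof.
move=> tA Bij; have := lie_coord 1%:M (As_skew tA); rewrite mulmx1.
rewrite /lie mulmx1 mul1mx subrr mulmx0 mul0mx => /matrixP/(_ i j)/esym/eqP.
by rewrite diag_act// [X in _ == X]mxE mulf_eq0 (negbTE Bij) orbF => /eqP.
Qed.

Let G_weight i j t : t \in As -> G i j != 0 -> w i t + w j t = 0.
Proof.
move=> tA; set D := c t.
have DB : D *m B = - (B *m D^T).
  have := lie_coord 1%:M (As_skew tA); rewrite mulmx1.
  by rewrite /lie mulmx1 mul1mx subrr mulmx0 mul0mx => /esym/eqP; rewrite addr_eq0 => /eqP.
have GD : G *m D = - (D^T *m G).
  apply: (can_inj (mulmxK Bu)); rewrite -mulmxA DB mulmxN mulKmx// mulNmx.
  by rewrite mulmxKV.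
have /eqP : (G *m D + D^T *m G) i j = 0 by rewrite GD addNr mxE.
have hl k l : k != l -> D k l = 0 := @As_diag t tA k l.
have hr k l : k != l -> D^T k l = 0 := @tr_diag t k l tA.
rewrite mxE (mulmx_diagl _ _ _ hr) (mulmx_diagr _ _ _ hl).
rewrite [D^T i i]mxE [G i j * _]mulrC -mulrDl mulf_eq0 => /orP[/eqP E _|/eqP->]; last by rewrite eqxx.
by rewrite addrC.
Qed.

(* By Engel's theorem h is the centralizer of its diagonalizable elements. *)
Let centralizer_h x : x^T = - x -> {in As, forall t, lie t x = 0} -> x \in h.
Proof.
pose L := (skewv :&: \bigcap_(i < size As) lker (linfun (lie As`_i)))%VS.
have LP y : reflect (y^T = - y /\ {in As, forall t, lie t y = 0}) (y \in L).
  apply: (iffP memv_capP) => -[/skewvP ys hy]; split=> //; try exact/skewvP.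
    move=> t tA; have it : (index t As < size As)%N by rewrite index_mem.
    have : y \in lker (linfun (lie As`_(Ordinal it))).
      by apply: subvP hy; apply: bigcapv_inf (subvv _).
    by rewrite memv_ker lfunE /= nth_index// => /eqP.
  rewrite memvE; apply/subv_bigcapP => i _; rewrite -memvE memv_ker lfunE /=.
  by rewrite hy ?mem_nth.
have span0 y t : y \in L -> t \in <<As>>%VS -> lie t y = 0.
  move=> /LP[_ hy] /(coord_span (X := in_tuple As)) ->.
  by rewrite lie_suml big1// => i _; rewrite lieZl hy ?scaler0// mem_nth.
have hL : (h <= L)%VS.
  apply/subvP => y yh; apply/LP; split; first exact: h_skew.
  by move=> t /As_h[th td]; apply: h_diag_central.
suff /subvP LL : (L <= h)%VS by move=> xs xA; apply: LL; apply/LP.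
have [_ hsub hnil _] := hC.
apply: engel_normalizer => //.
- move=> y z yh zL; apply/LP; have [zs zA] := LP _ zL; split.
    by apply/skewvP; apply: skewv_lie; apply/skewvP => //; apply: h_skew.
  move=> t tA; rewrite jacobi; have [th td] := As_h tA.
  by rewrite (h_diag_central th td yh) lie0l add0r zA// linear0.
(* The semisimple part [t] of [y] is in the span of [As] and kills z. Since ad y = ad t - ad (t - y)
   with t - y nilpotent, some power of ad y kills z. *)
- move=> y z yh zL; have [t [th td tn]] := h_jordan yh.
  exists (1 + (n.+1 + n.+1))%N.
  suff -> : iter (1 + (n.+1 + n.+1)) (lie y) z = 0 by rewrite mem0v.
  apply: (@iter_sub_commuting _ (lie t) (lie (t - y))).
  + by move=> u /=; rewrite lieDl lieNl subKr.
  + move=> u /=; rewrite jacobi linearB /= (h_diag_central th td yh).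
    by rewrite /lie subrr subr0 mul0mx mulmx0 subrr add0r.
  + by rewrite /= span0// As_span.
  + by apply: ad_nilpotent; rewrite -opprB exprNn tn mulr0.
- move=> v vL vh; apply: h_norm; first by have [] := LP _ vL.
  by move=> y yh; rewrite lieN memvN vh.
Qed.

(* If the weights of u and v are opposite, the skew matrix with coordinates
   y = u v^T - v u^T centralizes As and satisfies X^3 = delta X, so that it is
   diagonalizable and lies in the span of As. This forces the weight spaces to
   be one-dimensional. *)
Section Wedge.
Variables u v : 'cV[K]_d.
Let y := u *m v^T - v *m u^T.
Let a := (u^T *m G *m v) 0 0.
Let b := (u^T *m G *m u) 0 0.
Let e := (v^T *m G *m v) 0 0.
Let delta := a ^+ 2 - b * e.

Hypotheses (y_weight : {in As, forall t i j, y i j != 0 -> w i t + w j t = 0})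
  (delta0 : delta != 0).

Let form_mul (u1 u2 v1 v2 : 'cV[K]_d) : (u1 *m v1^T) *m G *m (u2 *m v2^T) =
  (v1^T *m G *m u2) 0 0 *: (u1 *m v2^T).
Proof.
have -> : (u1 *m v1^T) *m G *m (u2 *m v2^T) = u1 *m (v1^T *m G *m u2) *m v2^T by rewrite !mulmxA.
by rewrite {1}[v1^T *m G *m u2]mx11_scalar mul_mx_scalar scalemxAl.
Qed.

Let form_sym (u1 u2 : 'cV[K]_d) : (u1^T *m G *m u2) 0 0 = (u2^T *m G *m u1) 0 0.
Proof.
rewrite -[in RHS](trmxK u1) -[in RHS]Gsym -trmx_mul -mulmxA -trmx_mul [RHS]mxE.
by rewrite mulmxA.
Qed.

Let y_cube : y *m G *m y *m G *m y = delta *: y.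
Proof.
have -> : y *m G *m y = a *: (u *m v^T) - e *: (u *m u^T) - b *: (v *m v^T) + a *: (v *m u^T).
  rewrite /y !mulmxBl !mulmxBr !form_mul (form_sym v u) -/a -/b -/e.
  move: (u *m v^T) (u *m u^T) (v *m v^T) (v *m u^T) => uv uu vv vu.
  by apply/matrixP => i j; rewrite !mxE; ring.
rewrite /y !mulmxDl !mulNmx -!scalemxAl !mulmxBr !form_mul.
rewrite (form_sym v u) -/a -/b -/e /delta !scalerBr !scalerA.
move: (u *m v^T) (u *m u^T) (v *m v^T) (v *m u^T) => uv uu vv vu.
by apply/matrixP => i j; rewrite !mxE; ring.
Qed.

Let x := invmx P *m y *m (invmx P)^T.

Let xE : P *m x *m P^T = y.
Proof.
by rewrite /x !mulmxA mulmxV// mul1mx -mulmxA -trmx_mul mulmxV// trmx1 mulmx1.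
Qed.

Let cx : c x = y *m G.
Proof.
rewrite /c /G /B; apply: (can_inj (mulmxK Bu)); rewrite mulmxKV// -xE /B.
by rewrite !mulmxA mulmxKV.
Qed.

Lemma wedge_torus : x \in <<As>>%VS.
Proof.
have xs : x^T = - x.
  have ys : y^T = - y by rewrite /y linearB /= !trmx_mul !trmxK opprB.
  by rewrite /x !trmx_mul trmxK ys mulNmx mulmxN mulmxA.
have PTu : P^T \in unitmx by rewrite unitmx_tr.
have Pinj : injective (fun z : M => P *m z *m P^T).
  move=> z z' /= E; apply: (can_inj (mulKmx Pu)); apply: (can_inj (mulmxK PTu)) E.
have xh : x \in h.
  apply: centralizer_h => // t tA; apply: Pinj; rewrite /= (lie_coord _ (As_skew tA)) xE mulmx0 mul0mx.
  apply/matrixP => i j; rewrite diag_act// [RHS]mxE.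
  have [->|/(y_weight tA)->] := eqVneq (y i j) 0; by rewrite ?mulr0 ?mul0r.
apply: As_span => //.
have [s s2] : exists s, s ^+ 2 = delta by exists (sqrtC delta); rewrite sqrtCK.
have s0 : s != 0 by apply: contraNneq delta0 => s0; rewrite -s2 s0 expr0n.
apply/diagonalizableP; exists [:: 0; s; - s].
  rewrite /= !inE !negb_or eq_sym s0 eq_sym oppr_eq0 s0 !andbT /=.
  by rewrite -addr_eq0 -mulr2n mulrn_eq0.
apply/mxminpoly_minP.
rewrite !big_cons big_nil mulr1 polyC0 subr0 polyCN opprK.
have -> : 'X * (('X - s%:P) * ('X + s%:P)) = 'X ^+ 3 - delta%:P * 'X.
  by rewrite -s2 rmorphXn /=; ring.
rewrite rmorphB rmorphXn rmorphM /= !horner_mx_X horner_mx_C.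
apply: (can_inj (mulKmx Pu)); apply: (can_inj (mulmxK (etrans (unitmx_inv P) Pu))).
rewrite mulmx0 mul0mx.
have cM z z' : c (z *m z') = c z *m c z' by rewrite /c !mulmxA mulmxKV.
have cX := cx; move: (x) cX => X cX.
have cB z z' : c (z - z') = c z - c z' by rewrite /c mulmxBr mulmxBl.
rewrite -[LHS]/(c _) cB !exprS expr0 mulr1 -!mulmxE !cM cX.
rewrite !mulmxA y_cube -scalemxAl.
have -> : c delta%:M = delta%:M by rewrite /c scalar_mxC mulmxK.
by rewrite mul_scalar_mx -scalemxAl subrr.
Qed.

Lemma wedge_diag i j : i != j -> (y *m G) i j = 0.
Proof. by move=> ij; rewrite -cx span_diag// wedge_torus. Qed.

Lemma wedge_same i j : same i j -> (y *m G) i i = (y *m G) j j.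
Proof. by move=> ij; rewrite -cx; apply: span_same => //; exact: wedge_torus. Qed.

Lemma wedge_zero i : {in As, forall t, w i t = 0} -> (y *m G) i i = 0.
Proof.
move=> wi; rewrite -cx (coord_span (X := in_tuple As) wedge_torus).
rewrite linear_sum summxE big1// => k _; rewrite linearZ mxE /= [X in _ * X]wi ?mulr0//.
by rewrite mem_nth.
Qed.

(** If [u] and [v] live on weight zero, the diagonal matrix y G has only zero entries, so y = 0. But
    u^T G y G v equals b e - a^2, which is minus the nonzero [delta]. *)
Lemma wedge_support : {in As, forall t i, u i 0 != 0 -> w i t = 0} ->
  {in As, forall t i, v i 0 != 0 -> w i t = 0} -> False.
Proof.
move=> hu hv; have yE i j : y i j = u i 0 * v j 0 - v i 0 * u j 0.
  by rewrite /y !mxE !big_ord1 !mxE.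
have yG0 : y *m G = 0.
  apply/matrixP => i j; rewrite [RHS]mxE; have [<-|ij] := eqVneq i j; last exact: wedge_diag.
  have [u0|u0] := eqVneq (u i 0) 0; last by apply: wedge_zero => t tA; apply: hu u0.
  have [v0|v0] := eqVneq (v i 0) 0; last by apply: wedge_zero => t tA; apply: hv v0.
  by rewrite mxE big1// => k _; rewrite yE u0 v0 !mul0r subr0 mul0r.
have y0 : y = 0 by rewrite -[y](mulmxK Gu) yG0 mul0mx.
have := congr1 (fun z => (u^T *m G *m z *m G *m v) 0 0) y0.
rewrite /= mulmx0 !mul0mx [RHS]mxE /y mulmxBr !mulmxBl.
have -> : u^T *m G *m (u *m v^T) *m G *m v = (u^T *m G *m u) *m (v^T *m G *m v).
  by rewrite !mulmxA.
have -> : u^T *m G *m (v *m u^T) *m G *m v = (u^T *m G *m v) *m (u^T *m G *m v).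
  by rewrite !mulmxA.
rewrite mxE [X in _ + X]mxE !mxE !big_ord1 -/a -/b -/e => E.
by case/eqP: delta0; rewrite /delta expr2 -opprB E oppr0.
Qed.

End Wedge.

Let q (u v : 'cV[K]_d) := (u^T *m G *m v) 0 0.

Let q_delta i j : q (delta_mx i 0) (delta_mx j 0) = G i j.
Proof.
rewrite /q trmx_delta -rowE mxE (bigD1 j)//= big1 ?addr0 => [|k kj]; rewrite !mxE ?eqxx ?mulr1//.
by rewrite (negbTE kj) mulr0.
Qed.

Let qDl u u' v : q (u + u') v = q u v + q u' v.
Proof. by rewrite /q linearD /= !mulmxDl mxE. Qed.
Let qDr u v v' : q u (v + v') = q u v + q u v'.
Proof. by rewrite /q mulmxDr mxE. Qed.

Let G_row i : exists b, G i b != 0.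
Proof.
apply: contrapT => hno; have /matrixP/(_ i i) := mulVmx Bu.
rewrite !mxE eqxx big1 => [/eqP|k _]; first by rewrite eq_sym oner_eq0.
rewrite -/G (_ : G i k = 0) ?mul0r//; apply/eqP; apply: contrapT => /negP hk.
by apply: hno; exists k.
Qed.

Let G_sym i j : G i j = G j i. Proof. by rewrite -[in LHS]Gsym mxE. Qed.

Let dbl0 (x : K) : x + x = 0 -> x = 0.
Proof. by move=> /eqP; rewrite -mulr2n mulrn_eq0 => /eqP. Qed.

(** For a nonzero weight, take b with G_ib nonzero: the wedge of e_i and e_b gives a diagonal matrix
    with entry G_ib at i and 0 at j, whereas elements of the torus have equal entries there. For
    weight zero, [wedge_support] forces the form to have rank at most one on the zero weight space,
    and then rows i and j of the invertible [G] are proportional. *)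
Lemma same_eq i j : same i j -> i = j.
Proof.
move=> ij; apply: contrapT => /eqP nij.
have [b Gib] := G_row i.
have [wi|wi] := pselect {in As, forall t, w i t = 0}; last first.
  have [t tA wit] : exists2 t, t \in As & w i t != 0.
    apply: contrapT => hno; apply: wi => t tA; apply/eqP; apply: contrapT => /negP ht.
    by apply: hno; exists t.
  have Gii : G i i = 0.
    apply/eqP; apply: contrapT => /negP /(G_weight tA)/dbl0 h0.
    by rewrite h0 eqxx in wit.
  have ib : i != b by apply: contraNneq Gib => <-; rewrite Gii.
  have jb : j != b.
    apply/eqP => jb; have := G_weight tA Gib; rewrite -jb -(ij _ tA) => /dbl0 h0.
    by rewrite h0 eqxx in wit.
  pose u : 'cV[K]_d := delta_mx i 0; pose v : 'cV[K]_d := delta_mx b 0.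
  have yE k l : (u *m v^T - v *m u^T) k l = ((k == i) && (l == b))%:R - ((k == b) && (l == i))%:R.
    by rewrite /u /v !trmx_delta !mul_delta_mx !mxE.
  have yw : {in As, forall s k l, (u *m v^T - v *m u^T) k l != 0 -> w k s + w l s = 0}.
    move=> s sA k l; rewrite yE.
    have [/andP[/eqP-> /eqP->] _|_] := boolP ((k == i) && (l == b)); first exact: G_weight.
    have [/andP[/eqP-> /eqP->] _|_] := boolP ((k == b) && (l == i)); last by rewrite subrr eqxx.
    by rewrite addrC; apply: G_weight.
  have := wedge_same yw _ ij; rewrite -![_ 0 0]/(q _ _) !q_delta Gii mul0r subr0 expf_eq0 Gib.
  move=> /(_ isT) /eqP; apply/negP.
  have mE k (a a' : 'I_d) : (delta_mx a (0 : 'I_1) *m (delta_mx a' (0 : 'I_1))^T *m G) k k =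
      (k == a)%:R * G a' k by rewrite trmx_delta mul_delta_mx mul_deltaE.
  have subE (A A' : M) k : (A - A') k k = A k k - A' k k by rewrite !mxE.
  rewrite mulmxBl !subE !mE eqxx (negbTE ib) (negbTE jb) (eq_sym j i) (negbTE nij).
  by rewrite !mul0r mul1r !subr0 G_sym.
have Zi k : G i k != 0 -> {in As, forall t, w k t = 0}.
  by move=> Gik t tA; have := G_weight tA Gik; rewrite wi// add0r.
have wj : {in As, forall t, w j t = 0} by move=> t tA; rewrite -ij// wi.
have supp k : {in As, forall t, w k t = 0} ->
    {in As, forall t l, (delta_mx k 0 : 'cV[K]_d) l 0 != 0 -> w l t = 0}.
  move=> wk t tA l; rewrite mxE eqxx andbT; have [->|_] := eqVneq l k; last by rewrite eqxx.
  by rewrite wk.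
(* By [wedge_support] two vectors supported on weight zero never span a nondegenerate plane, so
   their Gram determinant vanishes. *)
have q0 (u v : 'cV[K]_d) : {in As, forall t l, u l 0 != 0 -> w l t = 0} ->
    {in As, forall t l, v l 0 != 0 -> w l t = 0} -> q u v ^+ 2 = q u u * q v v.
  move=> hu hv; apply/eqP; rewrite -subr_eq0; apply: contrapT => /negP h0.
  apply: (@wedge_support u v) => // t tA k l.
  rewrite !mxE !big_ord1 !mxE => ne0.
  have /andP[k0 l0] : (w k t == 0) && (w l t == 0).
    have [u0|/(hu _ tA) ->] := eqVneq (u k 0) 0.
      move: ne0; rewrite u0 mul0r sub0r oppr_eq0 mulf_eq0 negb_or => /andP[/(hv _ tA)-> /(hu _ tA)->].
      by rewrite eqxx.
    have [v0|/(hv _ tA) ->] := eqVneq (v l 0) 0; last by rewrite eqxx.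
    move: ne0; rewrite v0 mulr0 sub0r oppr_eq0 mulf_eq0 negb_or => /andP[_ /(hu _ tA)->].
    by rewrite eqxx.
  by rewrite (eqP k0) (eqP l0) addr0.
have Gii : G i i != 0.
  apply/eqP => Gii; have := q0 _ _ (supp _ wi) (supp _ (Zi _ Gib)).
  by rewrite !q_delta Gii mul0r => /eqP; rewrite expf_eq0 (negbTE Gib).
(* Polarization: the instances of [q0] for e_j, e_k and e_j + e_k against e_i combine to twice this
   identity. *)
have row_prop k : G i i * G j k = G i j * G i k.
  have [wk|wk] := pselect {in As, forall t, w k t = 0}; last first.
    have -> : G i k = 0 by apply/eqP; apply: contrapT => /negP /Zi.
    have -> : G j k = 0.
      apply/eqP; apply: contrapT => /negP Gjk; apply: wk => t tA.
      by have := G_weight tA Gjk; rewrite wj// add0r.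
    by rewrite !mulr0.
  have s2 := supp _ wk; have si := supp _ wi; have sj := supp _ wj.
  have sjk : {in As, forall t l, (delta_mx j 0 + delta_mx k 0 : 'cV[K]_d) l 0 != 0 -> w l t = 0}.
    move=> t tA l.
    have -> : (delta_mx j 0 + delta_mx k 0 : 'cV[K]_d) l 0 = (delta_mx j 0 : 'cV[K]_d) l 0 + (delta_mx k 0 : 'cV[K]_d) l 0.
      by rewrite mxE.
    have [->|/(sj _ tA)//] := eqVneq ((delta_mx j 0 : 'cV[K]_d) l 0) 0.
    by rewrite add0r; apply: s2.
  have := q0 _ _ si sjk; have := q0 _ _ si sj; have := q0 _ _ si s2.
  rewrite !(qDl, qDr) !q_delta (G_sym k j) => Ek Ej E.
  have /dbl0 : (G i i * G j k - G i j * G i k) + (G i i * G j k - G i j * G i k) = 0.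
    have -> : (G i i * G j k - G i j * G i k) + (G i i * G j k - G i j * G i k) =
      (G i i * (G j j + G j k + (G j k + G k k)) - (G i j + G i k) ^+ 2)
      + (G i j ^+ 2 - G i i * G j j) + (G i k ^+ 2 - G i i * G k k) by ring.
    by rewrite E Ej Ek !subrr !addr0.
  by move/eqP; rewrite subr_eq0 => /eqP.
have : row j G = (G i j / G i i) *: row i G.
  apply/matrixP => z k; rewrite !mxE; apply: (mulfI Gii); rewrite row_prop.
  by field.
move=> /(congr1 (fun r => (r *m B) 0 j)); rewrite -row_mul -scalemxAl -row_mul mulVmx// !mxE.
rewrite eqxx (negbTE nij) mulr0 => /eqP; by rewrite oner_eq0.
Qed.

Let B_neq0 i : exists j, B i j != 0.
Proof.
apply: contrapT => hno; have /matrixP/(_ i i) := mulmxV Bu.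
rewrite !mxE eqxx big1 => [/eqP|k _]; first by rewrite eq_sym oner_eq0.
rewrite (_ : (P *m P^T) i k = 0) ?mul0r//; apply/eqP; apply: contrapT => /negP hk.
by apply: hno; exists k.
Qed.

(** Row i of the Gram matrix is supported on coordinates of weight opposite to w_i, and [same_eq]
    leaves only one; self-paired coordinates have weight zero, so they coincide. Since distinct
    coordinates have distinct weights, commuting with [As] means being diagonal. *)
Lemma torus_witt : exists tau, witt_matrix P tau /\
  forall x, x \in skewv -> (x \in h <-> forall i j, i != j -> (P *m x *m invmx P) i j = 0).
Proof.
have B_uniq i j k : B i j != 0 -> B i k != 0 -> j = k.
  move=> Bij Bik; apply: same_eq => t tA.
  by apply: (addrI (w i t)); rewrite !(B_weight tA).
have [tau htau] : exists tau : 'I_d -> 'I_d, forall i, B i (tau i) != 0.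
  exists (fun i => xchoose (B_neq0 i)) => i; exact: (xchooseP (B_neq0 i)).
have B_sym i j : B i j = B j i by rewrite -[in LHS]Bsym mxE.
exists tau; split; first split=> //.
- by move=> i; apply: (B_uniq (tau i)); rewrite // B_sym.
- move=> i j; apply/idP/eqP => [hij|->]; last exact: htau.
  exact: B_uniq hij (htau i).
- move=> i j ti tj; apply: same_eq => t tA.
  have z k : tau k = k -> w k t = 0.
    by move=> tk; have := B_weight tA (htau k); rewrite tk => /dbl0.
  by rewrite !z.
move=> x xs; split=> [xh i j ij|hx].
  have [t tA tij] : exists2 t, t \in As & w i t != w j t.
    apply: contrapT => hno; case/eqP: ij; apply: same_eq => t tA.
    by apply/eqP; apply: contrapT => /negP ht; apply: hno; exists t.
  have [th td] := As_h tA; have := h_diag_central th td xh.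
  move=> /(congr1 (fun z => (P *m z *m invmx P) i j)).
  rewrite /= conj_lie// mulmx0 mul0mx lie_diagE; last exact: As_diag.
  by rewrite [RHS]mxE => /eqP; rewrite mulf_eq0 subr_eq0 (negbTE tij) => /eqP.
apply: centralizer_h; first exact/skewvP.
move=> t tA; apply: (can_inj (mulKmx Pu)); apply: (can_inj (mulmxK (etrans (unitmx_inv P) Pu))).
rewrite conj_lie// mulmx0 mul0mx; apply/matrixP => i j; rewrite lie_diagE; last exact: As_diag.
rewrite [RHS]mxE; have [->|/hx->] := eqVneq i j; by rewrite ?subrr ?mul0r ?mulr0.
Qed.

End Torus.

Theorem cartan_skew_witt : exists P tau, witt_matrix P tau /\
  forall x, x \in skewv -> (x \in h <-> forall i j, i != j -> (P *m x *m invmx P) i j = 0).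
Proof.
have [As [As_h As_span]] := ex_torus.
have /codiagonalizableP[P Pu /allP hP] : {in As &, forall A B, comm_mx A B} /\ {in As, forall A, diagonalizable A}.
  split=> [A B /As_h[Ah Ad] /As_h[Bh _]|A /As_h[]//].
  by apply/eqP; rewrite -subr_eq0; apply/eqP; exact: h_diag_central.
exists P; apply: (torus_witt As_h As_span Pu) => t tA i j ij.
have := elimT (diagonalizable_forP _ Pu) (hP _ tA); exact.
Qed.

End CartanSkew.

(** * Weights of a Cartan subalgebra *)

Section LieTransport.
Variables (K : fieldType) (m N : nat).
Variables (phi : 'Hom('M[K]_m, 'M[K]_N)) (g : {vspace 'M[K]_m}).
Hypotheses (phi_inj : lker phi == 0%VS)
  (phi_lie : {in g &, forall x y, phi (lie x y) = lie (phi x) (phi y)}).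

Let phi_injP : injective phi. Proof. exact/lker0P. Qed.

Lemma memv_limg U x : (phi x \in (phi @: U)%VS) = (x \in U).
Proof.
apply/idP/idP => [/memv_imgP[y yU]|]; last exact: memv_img.
by move/phi_injP => ->.
Qed.

Lemma limg_eq0 U : (phi @: U)%VS = 0%VS <-> U = 0%VS.
Proof.
split=> [h|->]; last exact: limg0.
by apply/eqP; rewrite -(eq_limg_ker0 _ _ phi_inj) limg0 h.
Qed.

Lemma limg_lie_span U V : (U <= g)%VS -> (V <= g)%VS ->
  lie_span (phi @: U) (phi @: V) = (phi @: lie_span U V)%VS.
Proof.
move=> /subvP Ug /subvP Vg; apply/eqP; rewrite eqEsubv; apply/andP; split.
  apply/lie_spanP => _ _ /memv_imgP[x xU ->] /memv_imgP[y yV ->].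
  by rewrite -(phi_lie (Ug _ xU) (Vg _ yV)) memv_img// mem_lie_span.
have /subvP h : (lie_span U V <= phi @^-1: lie_span (phi @: U) (phi @: V))%VS.
  apply/lie_spanP => x y xU yV; rewrite -memv_preim (phi_lie (Ug _ xU) (Vg _ yV)).
  by rewrite mem_lie_span// memv_img.
by apply/subvP => _ /memv_imgP[x /h + ->]; rewrite -memv_preim.
Qed.

Lemma limg_subalgebra h : (h <= g)%VS -> lie_subalgebra (phi @: h) <-> lie_subalgebra h.
Proof. by move=> hg; rewrite /lie_subalgebra limg_lie_span// limg_ker0. Qed.

Lemma limg_nilpotent h : (h <= g)%VS -> lie_subalgebra h ->
  lie_nilpotent (phi @: h) <-> lie_nilpotent h.
Proof.
move=> hg hs; have E k : iter k (lie_span (phi @: h)) (phi @: h)%VS = (phi @: iter k (lie_span h) h)%VS.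
  by elim: k => //= k ->; rewrite limg_lie_span// (subv_trans (lcs_sub0 k hs)).
by split=> -[k]; rewrite ?E => hk; exists k; rewrite ?E; apply/limg_eq0.
Qed.

Lemma limg_cartan h : (h <= g)%VS ->
  cartan_subalgebra (phi @: g) (phi @: h) <-> cartan_subalgebra g h.
Proof.
move=> hg; have hg' := subvP hg; split=> -[_ sub nil nrm]; split=> //.
- exact/(limg_subalgebra hg).
- by apply/(limg_nilpotent hg) => //; apply/(limg_subalgebra hg).
- move=> x xg xh; rewrite -memv_limg; apply: nrm; first exact: memv_img.
  move=> _ /memv_imgP[y yh ->]; rewrite -(phi_lie xg (hg' _ yh)).
  by apply: memv_img; apply: xh.
- exact: limgS.
- exact/(limg_subalgebra hg).
- exact/(limg_nilpotent hg).
- move=> _ /memv_imgP[x xg ->] xh; apply: memv_img; apply: nrm => // y yh.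
  by rewrite -memv_limg (phi_lie xg (hg' _ yh)); apply: xh; apply: memv_img.
Qed.

Lemma cartan_preim h' : cartan_subalgebra (phi @: g) h' ->
  exists h, [/\ cartan_subalgebra g h & h' = (phi @: h)%VS].
Proof.
move=> hC; have [h'g _ _ _] := hC; pose h := (phi @^-1: h')%VS.
have hE : (phi @: h)%VS = h'.
  by apply: lpreimK; apply: subv_trans h'g _; apply: limgS; exact: subvf.
exists h; split=> //; apply/(limg_cartan (h := h)); last by rewrite hE.
by rewrite -(limg_ker0 _ _ phi_inj) hE.
Qed.

(** The action [rho] is left abstract so that one statement serves the bracket on skew or symmetric
    matrices and the multiplication on column vectors. *)
Lemma limg_irreducible (V : vectType K) (f : 'Hom(V, 'M[K]_N)) (rho : 'M[K]_m -> V -> V)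
    (W : {vspace V}) :
  lker f == 0%VS -> {in g & W, forall x v, lie (phi x) (f v) = f (rho x v)} ->
  W <> 0%VS -> {in g & W, forall x v, rho x v \in W} ->
  (forall U, (U <= W)%VS -> {in g & U, forall x v, rho x v \in U} -> U = 0%VS \/ U = W) ->
  lie_irreducible (phi @: g) (f @: W).
Proof.
move=> f_inj f_lie W0 W_sub irr; split.
- apply/lie_submoduleP => _ _ /memv_imgP[x xg ->] /memv_imgP[v vW ->].
  by rewrite f_lie// memv_img// W_sub.
- move=> h; apply: W0; apply/eqP; rewrite -(eq_limg_ker0 _ _ f_inj) limg0 h.
  exact: eqxx.
move=> U UW /lie_submoduleP Usub.
pose U0 := (f @^-1: U)%VS.
have UE : (f @: U0)%VS = U.
  by apply: lpreimK; apply: subv_trans UW _; apply: limgS; exact: subvf.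
have U0W : (U0 <= W)%VS by rewrite -(limg_ker0 _ _ f_inj) UE.
case: (irr U0 U0W) => [x v xg|E|E]; [|left|right]; rewrite -?UE ?E ?limg0//.
rewrite -!memv_preim => vU; rewrite -f_lie//; last first.
  by apply: (subvP U0W); rewrite -memv_preim.
by apply: Usub => //; apply: memv_img.
Qed.

End LieTransport.

(** * Representatives of pairs of opposite coordinates *)

Section HalfSystem.
Variables (d : nat) (tau : 'I_d -> 'I_d).

(** One representative from each two-element orbit of [tau]: the choice of e_k against -e_k. *)
Definition half_system m (r : 'I_m -> 'I_d) :=
  [/\ injective r, forall k k', tau (r k) != r k' &
      forall i, tau i != i -> exists k, i = r k \/ i = tau (r k)].

(** The smaller index of each pair is taken; the identity counts pairs and fixed points. *)
Lemma ex_half_system : involutive tau ->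
  exists m (r : 'I_m -> 'I_d), half_system r /\ (m * 2 + #|[pred i | tau i == i]| = d)%N.
Proof.
move=> tauK; pose A := [pred i : 'I_d | (i < tau i)%N].
have mA x : (x \in A) = (x < tau x)%N by rewrite inE.
exists #|A|, enum_val; split; first split.
- exact: enum_val_inj.
- move=> k k'; apply/eqP => E; have := enum_valP k'; rewrite mA -E tauK ltnNge ltnW//.
  by rewrite -mA enum_valP.
- move=> i; rewrite neq_ltn => /orP[ti|it].
    have iA : tau i \in A by rewrite inE tauK.
    by exists (enum_rank_in iA (tau i)); right; rewrite enum_rankK_in// tauK.
  have iA : i \in A by rewrite inE.
  by exists (enum_rank_in iA i); left; rewrite enum_rankK_in.
transitivity (\sum_(i : 'I_d) 1)%N; last by rewrite sum1_card card_ord.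
rewrite [RHS](bigID (fun i => tau i == i)) /= [RHS]addnC; congr (_ + _)%N; last first.
  by rewrite -sum1_card; apply: eq_bigl => i; rewrite inE.
rewrite (bigID (fun i : 'I_d => (i < tau i)%N)) /= muln2 -addnn; congr (_ + _)%N.
  rewrite -sum1_card; apply: eq_bigl => i; rewrite inE.
  by apply/idP/andP => [it|[]//]; split=> //; rewrite neq_ltn it orbT.
rewrite -sum1_card (reindex_inj (inv_inj tauK)) /=; apply: eq_bigl => i; rewrite inE tauK.
apply/idP/andP => [ti|[it]].
  split; first by rewrite neq_ltn ti.
  by rewrite -leqNgt ltnW.
by rewrite -leqNgt leq_eqVlt => /orP[/eqP/val_inj ti|//]; rewrite ti eqxx in it.
Qed.

End HalfSystem.

(** Unlike in [lie_roots], the weight 0 is allowed and [W] is any subspace, such as a graded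
    piece. *)
Definition has_weight (K : fieldType) N (h W : {vspace 'M[K]_N}) (al : dual h) : Prop :=
  exists x, [/\ x \in W, x <> 0 & forall s : subvs_of h, lie (vsval s) x = al s *: x].

(* In [lie_roots] the coercion of al to a function is inserted in al <> 0. *)
Lemma lie_rootsP (K : fieldType) N (g h : {vspace 'M[K]_N}) (al : dual h) :
  lie_roots g h al <-> al <> 0 /\ has_weight g al.
Proof.
split=> -[al0 w]; split=> // E; apply: al0; last by apply/lfunP => s; rewrite zero_lfunE E.
by apply: funext => s; rewrite E zero_lfunE.
Qed.

Definition diag_val (K : fieldType) (d N : nat) (P : 'M[K]_d) (phi : 'Hom('M[K]_d, 'M[K]_N))
  (h : {vspace 'M[K]_N}) (i : 'I_d) (s : subvs_of h) : K^o :=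
  (P *m (phi^-1)%VF (vsval s) *m invmx P) i i.

Lemma diag_val_linear K d N P phi h i : linear (@diag_val K d N P phi h i).
Proof.
move=> k s t; have vE : vsval (k *: s + t) = k *: vsval s + vsval t by [].
rewrite /diag_val vE linearP /= mulmxDr mulmxDl -scalemxAr -scalemxAl.
by rewrite mxE [X in X + _]mxE.
Qed.
HB.instance Definition _ (K : fieldType) d N (P : 'M[K]_d) (phi : 'Hom('M[K]_d, 'M[K]_N)) h i :=
  GRing.isLinear.Build K (subvs_of h) K^o _ (@diag_val K d N P phi h i)
    (@diag_val_linear K d N P phi h i).

(** * Weights on column vectors, skew and symmetric matrices *)

Section Weights.
Variables (K : numFieldType) (d N : nat).
Local Notation M := 'M[K]_d.
Local Notation skewv := (skewv K d).
Local Notation symv := (symv K d).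
Variables (phi : 'Hom(M, 'M[K]_N)) (P : M) (tau : 'I_d -> 'I_d).
Hypotheses (phi_inj : lker phi == 0%VS) (Pu : P \in unitmx) (tauK : involutive tau)
  (Btau : forall i j, ((P *m P^T) i j != 0) = (j == tau i)).
Variable h : {vspace 'M[K]_N}.
Hypothesis hh : forall X, X \in h <->
  exists x, [/\ x \in skewv, forall i j, i != j -> (P *m x *m invmx P) i j = 0 & X = phi x].

Definition eps_weight (i : 'I_d) : dual h := linfun (diag_val P phi i).
Local Notation eps := eps_weight.
Let pr (s : subvs_of h) : M := (phi^-1)%VF (vsval s).

Lemma eps_weightE i s : eps i s = (P *m pr s *m invmx P) i i.
Proof. by rewrite lfunE. Qed.

Lemma subvs_torusP (s : subvs_of h) : [/\ pr s \in skewv,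
  forall i j, i != j -> (P *m pr s *m invmx P) i j = 0 & vsval s = phi (pr s)].
Proof.
have [x [xs xd xE]] := (hh (vsval s)).1 (subvsP s).
by rewrite /pr xE lker0_lfunK.
Qed.

Lemma bicoord_inj : injective (fun x : M => P *m x *m P^T).
Proof.
have PTu : P^T \in unitmx by rewrite unitmx_tr.
by move=> x y E; apply: (can_inj (mulKmx Pu)); apply: (can_inj (mulmxK PTu)) E.
Qed.

Lemma bicoord_lie (s : subvs_of h) x i j :
  (P *m lie (pr s) x *m P^T) i j = (eps i s + eps j s) * (P *m x *m P^T) i j.
Proof.
have [/skewvP xs xd _] := subvs_torusP s.
by rewrite lie_bicoord// diag_bicoord// !eps_weightE.
Qed.

(** The identity matrix has weight 0, and its coordinates P P^T have a nonzero entry at (i, tau i),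
    where the torus acts by the sum of the two weights. *)
Lemma eps_tau i : eps (tau i) = - eps i.
Proof.
apply/lfunP => s; rewrite opp_lfunE; apply/eqP; rewrite -addr_eq0 addrC.
have := bicoord_lie s 1%:M i (tau i); rewrite /lie mulmx1 mul1mx subrr mulmx0 mul0mx mxE.
rewrite mulmx1 => /esym/eqP; rewrite mulf_eq0 => /orP[//|].
by have := Btau i (tau i); rewrite eqxx => /negbTE->.
Qed.

Lemma eps_fix i : tau i = i -> eps i = 0.
Proof.
move=> ti; have /eqP := eps_tau i; rewrite ti -addr_eq0 -mulr2n -scaler_nat scaler_eq0.
by rewrite pnatr_eq0 => /eqP.
Qed.

(** The diagonal matrix with entries [D], brought back to the standard basis, is skew because the
    Gram matrix pairs i with [tau i] only, where [D] changes sign. *)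
Lemma eps_realize (D : 'I_d -> K) : (forall i, D (tau i) = - D i) ->
  exists s, forall i, eps i s = D i.
Proof.
move=> hD; pose x := invmx P *m diag_mx (\row_i D i) *m P.
have cx : P *m x *m invmx P = diag_mx (\row_i D i) by rewrite /x !mulmxA mulmxV// mul1mx mulmxK.
clearbody x.
have xd i j : i != j -> (P *m x *m invmx P) i j = 0 by move=> ij; rewrite cx !mxE (negbTE ij).
have xs : x \in skewv.
  apply/skewvP; apply: bicoord_inj => /=.
  have xE : P *m x *m P^T = diag_mx (\row_i D i) *m (P *m P^T) by rewrite -cx !mulmxA mulmxKV.
  have -> : P *m x^T *m P^T = (P *m x *m P^T)^T by rewrite !trmx_mul trmxK mulmxA.
  rewrite mulmxN mulNmx xE; apply/matrixP => i j.
  rewrite mxE [RHS]mxE !mul_diag_mx !mxE.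
  have [E|] := eqVneq ((P *m P^T) i j) 0.
    have : (P *m P^T) j i = 0 by rewrite -E -[in LHS](trmxK P) -trmx_mul mxE trmxK.
    by move: E; rewrite !mxE => -> ->; rewrite !mulr0 oppr0.
  move=> E; have := E; rewrite Btau => /eqP ji.
  have -> : \sum_k P j k * P^T k i = \sum_k P i k * P^T k j.
    by apply: eq_bigr => k _; rewrite !mxE mulrC.
  by rewrite ji hD mulNr.
have xh : phi x \in h by apply/hh; exists x; split.
exists (vsproj h (phi x)) => i.
by rewrite eps_weightE /pr vsprojK// lker0_lfunK// cx !mxE eqxx mulr1n.
Qed.

Section Bimodule.
Variables (f : 'Hom(M, 'M[K]_N)) (W : {vspace M}).
Hypotheses (f_inj : lker f == 0%VS)
  (f_lie : {in skewv & W, forall x y, lie (phi x) (f y) = f (lie x y)}).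

Let f_injP : injective f. Proof. exact/lker0P. Qed.
Let lie_f s y : y \in W -> lie (vsval s) (f y) = f (lie (pr s) y).
Proof. by move=> yW; have [ps _ ->] := subvs_torusP s; rewrite f_lie. Qed.

(** The torus multiplies entry (i, j) of P y P^T by eps i + eps j, so any nonzero entry of a weight
    vector reveals its weight. *)
Lemma weight_bicoord al : has_weight (f @: W) al ->
  exists y i j, [/\ y \in W, (P *m y *m P^T) i j != 0 & al = eps i + eps j].
Proof.
move=> [_ [/memv_imgP[y yW ->] fy0 hy]].
have y0 : P *m y *m P^T != 0.
  apply/eqP => y0; apply: fy0; suff -> : y = 0 by rewrite linear0.
  by apply: bicoord_inj; rewrite /= y0 mulmx0 mul0mx.
have [i [j yij]] : exists i j, (P *m y *m P^T) i j != 0.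
  apply: contrapT => hno; case/eqP: y0; apply/matrixP => i j; rewrite [RHS]mxE; apply/eqP.
  by apply: contrapT => /negP hij; apply: hno; exists i, j.
exists y, i, j; split=> //; apply/lfunP => s; rewrite add_lfunE.
apply: (mulIf yij); rewrite -bicoord_lie.
have -> : lie (pr s) y = al s *: y.
  by apply: f_injP; rewrite -lie_f// hy linearZ.
by rewrite -scalemxAr -scalemxAl [RHS]mxE.
Qed.

Lemma bicoord_weight i j (z : M) : z != 0 -> invmx P *m z *m (invmx P)^T \in W ->
  (forall k l, z k l != 0 -> eps k + eps l = eps i + eps j) ->
  has_weight (f @: W) (eps i + eps j).
Proof.
move=> z0 yW hz; set y := invmx P *m z *m (invmx P)^T in yW.
have yE : P *m y *m P^T = z.
  by rewrite /y !mulmxA mulmxV// mul1mx -mulmxA -trmx_mul mulmxV// trmx1 mulmx1.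
exists (f y); split; first exact: memv_img.
  move=> fy0; have y0 : y = 0 by apply: f_injP; rewrite linear0.
  by case/eqP: z0; rewrite -yE y0 mulmx0 mul0mx.
move=> s; rewrite lie_f// -linearZ; congr (f _); apply: bicoord_inj => /=.
apply/matrixP => k l; rewrite bicoord_lie -scalemxAr -scalemxAl [RHS]mxE yE.
have [->|/hz E] := eqVneq (z k l) 0; first by rewrite !mulr0.
by rewrite -!add_lfunE E.
Qed.

End Bimodule.

Lemma weight_skew f al : lker f == 0%VS ->
  {in skewv & skewv, forall x y, lie (phi x) (f y) = f (lie x y)} ->
  has_weight (f @: skewv) al <-> exists i j, i != j /\ al = eps i + eps j.
Proof.
move=> f_inj f_lie; split=> [/(weight_bicoord f_inj f_lie)[y [i [j [/skewvP ys yij ->]]]]|].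
  exists i, j; split=> //; apply: contraNneq yij => <-.
  have E : (P *m y *m P^T)^T = - (P *m y *m P^T) by rewrite !trmx_mul trmxK ys mulNmx mulmxN mulmxA.
  have /matrixP/(_ i i) := E; rewrite mxE [RHS]mxE => /eqP.
  by rewrite -addr_eq0 -mulr2n mulrn_eq0.
move=> [i [j [ij ->]]]. apply: (@bicoord_weight f skewv f_inj f_lie i j (rotm K i j)).
- apply/eqP => /matrixP/(_ i j); rewrite rotE !eqxx (negbTE ij) mul0r subr0 mul1r mxE => /eqP.
  by rewrite oner_eq0.
- apply/skewvP; have /skewvP rs := rot_skew K i j.
  by rewrite !trmx_mul trmxK rs mulNmx mulmxN mulmxA.
- move=> k l; rewrite rotE -!natrM !mulnb.
  have [/andP[/eqP-> /eqP->]//|_] := boolP ((k == i) && (l == j)).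
  have [/andP[/eqP-> /eqP->]|_] := boolP ((k == j) && (l == i)); first by move=> _; rewrite addrC.
  by rewrite subrr eqxx.
Qed.

Lemma weight_sym f al : lker f == 0%VS ->
  {in skewv & symv, forall x y, lie (phi x) (f y) = f (lie x y)} ->
  has_weight (f @: symv) al <-> exists i j, al = eps i + eps j.
Proof.
move=> f_inj f_lie; split=> [/(weight_bicoord f_inj f_lie)[y [i [j [_ _ ->]]]]|]; first by exists i, j.
move=> [i [j ->]]; apply: (@bicoord_weight f symv f_inj f_lie i j (spr K i j)).
- apply/eqP => /matrixP/(_ i j); rewrite sprE !eqxx mul1r mxE => /eqP.
  have [ij|ij] := eqVneq i j; last by rewrite mul0r addr0 oner_eq0.
  by rewrite mulr1 -natrD pnatr_eq0.
- apply/symvP; have rs : (spr K i j)^T = spr K i j by rewrite /spr linearD /= !trmx_delta addrC.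
  by rewrite !trmx_mul trmxK rs mulmxA.
- move=> k l; rewrite sprE -!natrM !mulnb -natrD pnatr_eq0 addn_eq0 negb_and !eqb0 !negbK.
  by case/orP=> /andP[/eqP-> /eqP->]//; rewrite addrC.
Qed.

Lemma weight_vector (f : 'Hom('cV[K]_d, 'M[K]_N)) al : lker f == 0%VS ->
  {in skewv, forall x v, lie (phi x) (f v) = f (x *m v)} ->
  has_weight (f @: fullv) al <-> exists i, al = eps i.
Proof.
move=> /lker0P f_inj f_lie.
have coord s v i : (P *m (pr s *m v)) i 0 = eps i s * (P *m v) i 0.
  have [_ xd _] := subvs_torusP s.
  have -> : P *m (pr s *m v) = (P *m pr s *m invmx P) *m (P *m v) by rewrite !mulmxA mulmxKV.
  rewrite mxE (bigD1 i)//= big1 ?addr0 ?eps_weightE// => k ki.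
  by rewrite xd 1?eq_sym// mul0r.
split=> [[_ [/memv_imgP[v _ ->] fv0 hv]]|[i ->]].
  have v0 : P *m v != 0.
    apply/eqP => v0; apply: fv0; suff -> : v = 0 by rewrite linear0.
    by apply: (can_inj (mulKmx Pu)); rewrite v0 mulmx0.
  have [i vi] : exists i, (P *m v) i 0 != 0.
    apply: contrapT => hno; case/eqP: v0; apply/matrixP => i j; rewrite [RHS]mxE ord1; apply/eqP.
    by apply: contrapT => /negP hij; apply: hno; exists i.
  exists i; apply/lfunP => s; apply: (mulIf vi); rewrite -coord.
  have [ps _ sE] := subvs_torusP s.
  have -> : pr s *m v = al s *: v.
    by apply: f_inj; rewrite -f_lie// -sE hv linearZ.
  by rewrite -scalemxAr [RHS]mxE.
pose v : 'cV[K]_d := invmx P *m delta_mx i 0.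
have vE : P *m v = delta_mx i 0 by rewrite /v mulKVmx.
exists (f v); split; first by rewrite memv_img ?memvf.
  move=> fv0; have v0 : v = 0 by apply: f_inj; rewrite linear0.
  have := vE; rewrite v0 mulmx0 => /matrixP/(_ i 0); rewrite !mxE !eqxx => /esym/eqP.
  by rewrite oner_eq0.
move=> s; have [ps _ sE] := subvs_torusP s; rewrite sE f_lie// -linearZ; congr (f _).
apply: (can_inj (mulKmx Pu)); apply/matrixP => k j; rewrite ord1 coord -scalemxAr [RHS]mxE vE.
by rewrite mxE eqxx andbT; have [->//|_] := eqVneq k i; rewrite !mulr0.
Qed.

Section Halves.
Variables (m : nat) (r : 'I_m -> 'I_d).
Hypotheses (hr : half_system tau r)
  (tau_fix : forall i j, tau i = i -> tau j = j -> i = j).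

(** The two coordinates of the k-th pair, the bit being the sign of the weight relative to e_k. *)
Let pt (k : 'I_m) (b : bool) : 'I_d := if b then tau (r k) else r k.
Let e (k : 'I_m) : dual h := eps (r k).

Lemma eps_pt k b : eps (pt k b) = (-1) ^+ b *: e k.
Proof. by case: b; rewrite /pt /= ?eps_tau ?expr1 ?scaleN1r ?expr0 ?scale1r. Qed.

Lemma pt_inj k b k' b' : pt k b = pt k' b' -> k = k' /\ b = b'.
Proof.
have [rI rtau _] := hr.
case: b; case: b'; rewrite /pt.
- by move/(inv_inj tauK)/rI.
- by move=> E; have := rtau k k'; rewrite E eqxx.
- by move=> E; have := rtau k' k; rewrite E eqxx.
- by move/rI.
Qed.

Lemma eps_cases i : (tau i = i /\ eps i = 0) \/ exists k b, i = pt k b.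
Proof.
have [ti|ti] := eqVneq (tau i) i; first by left; rewrite eps_fix.
have [_ _ /(_ i ti)[k [->|->]]] := hr; right; first by exists k, false.
by exists k, true.
Qed.

Lemma half_realize (a : 'I_m -> K) : exists s, forall k, e k s = a k.
Proof.
have [rI rtau _] := hr.
pose D i := \sum_k (a k * ((i == r k)%:R - (i == tau (r k))%:R)).
have [|s hs] := @eps_realize D.
  move=> i; rewrite /D -sumrN; apply: eq_bigr => k _; rewrite -mulrN opprB.
  by rewrite (inj_eq (inv_inj tauK)) -{1}(tauK (r k)) (inj_eq (inv_inj tauK)).
exists s => k; rewrite hs /D (bigD1 k)//= eqxx [r k == _]eq_sym (negbTE (rtau _ _)) subr0 mulr1.
rewrite big1 ?addr0// => j jk; rewrite (inj_eq rI) [r k == _]eq_sym (negbTE (rtau _ _)).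
by rewrite eq_sym (negbTE jk) subrr mulr0.
Qed.

Let ex_sd : exists sd : 'I_m -> subvs_of h, forall k l, e l (sd k) = (l == k)%:R.
Proof.
have /choice[sd hsd] : forall k, exists s, forall l, e l s = (l == k)%:R.
  by move=> k; apply: half_realize.
by exists sd.
Qed.

Lemma eps_separate s t : (forall k, e k s = e k t) -> s = t.
Proof.
move=> st; apply: subvs_inj.
have [_ ds ->] := subvs_torusP s; have [_ dt ->] := subvs_torusP t; congr (phi _).
apply: (can_inj (mulKmx Pu)); apply: (can_inj (mulmxK (etrans (unitmx_inv P) Pu))).
apply/matrixP => i j; have [<-|ij] := eqVneq i j; last by rewrite ds// dt.
rewrite -!eps_weightE; have [[_ ->]|[k [b ->]]] := eps_cases i; first by rewrite !zero_lfunE.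
by rewrite eps_pt !scale_lfunE !st.
Qed.

Definition half_tuple : m.-tuple (dual h) := [tuple e k | k < m].

Lemma half_tupleE k : tnth half_tuple k = eps (r k).
Proof. by rewrite tnth_mktuple. Qed.

Lemma dual_expand (sd : 'I_m -> subvs_of h) (al : dual h) : (forall k l, e l (sd k) = (l == k)%:R) ->
  al = \sum_k al (sd k) *: e k.
Proof.
move=> hsd; apply/lfunP => s; rewrite sum_lfunE.
have {1}-> : s = \sum_k e k s *: sd k.
  apply: eps_separate => l; rewrite linear_sum (bigD1 l)//= big1 ?addr0 => [|k kl].
    by rewrite linearZ /= hsd eqxx [RHS]mulr1.
  by rewrite linearZ /= hsd eq_sym (negbTE kl) [LHS]mulr0.
rewrite linear_sum; apply: eq_bigr => k _; rewrite linearZ scale_lfunE /=.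
exact: mulrC.
Qed.

Lemma half_basis : basis_of fullv half_tuple.
Proof.
have [sd hsd] := ex_sd.
rewrite basisEfree; apply/and3P; split.
- apply/freeP => c c0 k.
  have {}c0 : \sum_l c l *: e l = 0.
    by rewrite -[RHS]c0; apply: eq_bigr => l _; rewrite -tnth_nth half_tupleE.
  have := congr1 (fun al : dual h => al (sd k)) c0.
  rewrite sum_lfunE zero_lfunE (bigD1 k)//= big1 ?addr0 => [|l lk].
    by rewrite scale_lfunE hsd eqxx => <-; rewrite [RHS]mulr1.
  by rewrite scale_lfunE hsd (negbTE lk) [LHS]mulr0.
- exact: subvf.
- rewrite size_tuple.
  have : (fullv <= <<half_tuple>>)%VS.
    apply/subvP => al _; rewrite (dual_expand al hsd) memv_suml// => k _.
    by rewrite memvZ// memv_span// -[e k]half_tupleE mem_tnth.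
  by move/dimvS/leq_trans; apply; rewrite -[X in (_ <= X)%N](size_tuple half_tuple) dim_span.
Qed.

Lemma half_dual_basis : exists sd : 'I_m -> subvs_of h, forall k l, e l (sd k) = (l == k)%:R.
Proof. exact: ex_sd. Qed.

Let sgE (b : bool) (al : dual h) s : ((-1) ^+ b *: al) s = (-1) ^+ b * al s :> K.
Proof. by rewrite scale_lfunE. Qed.

Let sg0 (b : bool) : (-1) ^+ b != 0 :> K. Proof. by rewrite signr_eq0. Qed.

Lemma eps_pt_neq0 k b : eps (pt k b) <> 0.
Proof.
have [sd hsd] := ex_sd; move=> /(congr1 (fun al : dual h => al (sd k) : K)).
by rewrite eps_pt sgE hsd eqxx mulr1 zero_lfunE => /eqP; rewrite (negbTE (sg0 b)).
Qed.

Lemma eps_pt2_neq0 k b k' b' : k != k' -> eps (pt k b) + eps (pt k' b') <> 0.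
Proof.
have [sd hsd] := ex_sd; move=> kk' /(congr1 (fun al : dual h => al (sd k) : K)).
rewrite add_lfunE !eps_pt !sgE !hsd eqxx mulr1 eq_sym (negbTE kk') mulr0 addr0 zero_lfunE => /eqP.
by rewrite (negbTE (sg0 b)).
Qed.

(** Two distinct coordinates of one pair have opposite weights and sum 0. What is left is a
    self-paired coordinate with another one, giving a short root, or coordinates of two different
    pairs, giving a long one. *)
Lemma sum_eps_cases i j : i != j -> eps i + eps j <> 0 ->
  ((tau i = i \/ tau j = j) /\ exists k b, eps i + eps j = eps (pt k b)) \/
  exists k b k' b', [/\ k != k', i = pt k b & j = pt k' b'].
Proof.
move=> ij; have [[ti ->]|[k [b iE]]] := eps_cases i; have [[tj ->]|[k' [b' jE]]] := eps_cases j.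
- by rewrite addr0.
- by rewrite add0r => _; left; split; [left|exists k', b'; rewrite jE].
- by rewrite addr0 => _; left; split; [right|exists k, b; rewrite iE].
move=> s0; right; exists k, b, k', b'; split=> //.
apply/eqP => kk'; apply: s0; rewrite iE jE kk' !eps_pt.
have bb' : b != b' by apply: contraNneq ij => bb'; rewrite iE jE kk' bb'.
by move: bb'; case: (b); case: (b') => // _; rewrite expr0 expr1 scaleN1r scale1r ?subrr ?addNr.
Qed.

Section RootSystems.
Hypothesis phi_lie : {in skewv &, forall x y, lie (phi x) (phi y) = phi (lie x y)}.

Lemma lie_roots_skew : lie_roots (phi @: skewv) h =
  [set al : dual h | al <> 0 /\ exists i j, i != j /\ al = eps i + eps j].
Proof.
apply/seteqP; split=> al.
  by case/lie_rootsP=> al0 w; split=> //; exact: (weight_skew al phi_inj phi_lie).1.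
by case=> al0 w; apply/lie_rootsP; split=> //; exact: (weight_skew al phi_inj phi_lie).2.
Qed.

(** The self-paired coordinate [o] has weight 0; together with [pt k b] it produces the short roots.
    This is the only difference from [lie_roots_D], where no coordinate is self-paired. *)
Lemma lie_roots_B o : tau o = o ->
  lie_roots (phi @: skewv) h =
   [set al : dual h | exists (k : 'I_m) (b : bool), al = (-1) ^+ b *: e k] `|`
   [set al : dual h | exists (k l : 'I_m) (b c : bool), k != l /\
          al = (-1) ^+ b *: e k + (-1) ^+ c *: e l].
Proof.
move=> to; rewrite lie_roots_skew; apply/seteqP; split=> [al [al0 [i [j [ij alE]]]]|].
  have := sum_eps_cases ij; rewrite -alE => /(_ al0).
  case=> [[_ [k [b ->]]]|[k [b [l [c [kl iE jE]]]]]].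
    by left; exists k, b; rewrite eps_pt.
  by right; exists k, l, b, c; rewrite alE iE jE !eps_pt.
have pto k b : pt k b != o.
  apply/eqP => E; have := pt_inj (k := k) (b := ~~ b) (k' := k) (b' := b).
  have -> : pt k (~~ b) = tau (pt k b) by case: b {E}; rewrite /pt /= ?tauK.
  by rewrite E to => /(_ erefl)[_]; case: b {E}.
move=> al [[k [b ->]]|[k [l [b [c [kl ->]]]]]].
  rewrite -eps_pt; split; first exact: eps_pt_neq0.
  by exists (pt k b), o; rewrite (eps_fix to) addr0.
rewrite -!eps_pt; split; first exact: eps_pt2_neq0.
exists (pt k b), (pt l c); split=> //.
by apply: contraNneq kl => /pt_inj[->].
Qed.

Lemma root_system_skew o : tau o = o -> root_system_B m (lie_roots (phi @: skewv) h).
Proof.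
move=> to; exists half_tuple; split; first exact: half_basis.
rewrite (lie_roots_B to); congr (_ `|` _); apply/seteqP; split=> al.
- by move=> [k [b ->]]; exists k, b; rewrite half_tupleE.
- by move=> [k [b ->]]; exists k, b; rewrite half_tupleE.
- by move=> [i [j [b [c [ij ->]]]]]; exists i, j, b, c; rewrite !half_tupleE.
- by move=> [i [j [b [c [ij ->]]]]]; exists i, j, b, c; rewrite !half_tupleE.
Qed.

Lemma lie_roots_D : (forall i, tau i != i) ->
  lie_roots (phi @: skewv) h =
   [set al : dual h | exists (k l : 'I_m) (b c : bool), k != l /\
          al = (-1) ^+ b *: e k + (-1) ^+ c *: e l].
Proof.
move=> hfix; rewrite lie_roots_skew; apply/seteqP; split=> [al [al0 [i [j [ij alE]]]]|].
  have := sum_eps_cases ij; rewrite -alE => /(_ al0).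
  case=> [[[] /eqP]|[k [b [l [c [kl iE jE]]]]]]; rewrite ?(negbTE (hfix _))//.
  by exists k, l, b, c; rewrite alE iE jE !eps_pt.
move=> al [k [l [b [c [kl ->]]]]].
rewrite -!eps_pt; split; first exact: eps_pt2_neq0.
exists (pt k b), (pt l c); split=> //.
by apply: contraNneq kl => /pt_inj[->].
Qed.

End RootSystems.

Section DualForm.
Variables (g : {vspace 'M[K]_N}) (kappa : K).
Hypotheses (kappa_gt0 : 0 < kappa)
  (killing_g : {in skewv &, forall x y, killing g (phi x) (phi y) = kappa * \tr (x *m y)}).

(** The trace form sums over all coordinates; each pair contributes twice, with the weights e_k and
    -e_k, whence the factor 2. *)
Lemma killing_torus (s t : subvs_of h) :
  killing g (vsval s) (vsval t) = kappa *+ 2 * \sum_k e k s * e k t.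
Proof.
have [ss sd ->] := subvs_torusP s; have [ts td ->] := subvs_torusP t.
rewrite killing_g// mulrnAl -mulrnAr; congr (_ * _).
have -> : \tr (pr s *m pr t) = \sum_i eps i s * eps i t.
  have -> : \tr (pr s *m pr t) = \tr ((P *m pr s *m invmx P) *m (P *m pr t *m invmx P)).
    have -> : (P *m pr s *m invmx P) *m (P *m pr t *m invmx P) = P *m (pr s *m pr t *m invmx P).
      by rewrite !mulmxA mulmxKV.
    by rewrite [RHS]mxtrace_mulC mulmxKV.
  apply: eq_bigr => i _; rewrite mulmx_diagl// !eps_weightE.
  by [].
pose I := [set pt p.1 p.2 | p : 'I_m * bool]%SET.
transitivity (\sum_(i in I) eps i s * eps i t).
  rewrite [RHS]big_mkcond /=; apply: eq_bigr => i _; case: ifPn => // iI.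
  have [[_ ->]|[k [b iE]]] := eps_cases i; first by rewrite zero_lfunE mul0r.
  by case/imsetP: iI; exists (k, b).
rewrite big_imset /=; last by move=> [k b] [l c] _ _ /pt_inj[/= -> ->].
rewrite -(pair_bigA _ (fun k b => eps (pt k b) s * eps (pt k b) t)) /= -sumrMnl.
apply: eq_bigr => k _; rewrite big_bool !eps_pt !sgE expr0 expr1 !mul1r !mulN1r.
by rewrite mulrNN mulr2n.
Qed.

Variable sd : 'I_m -> subvs_of h.
Hypothesis hsd : forall k l, e l (sd k) = (l == k)%:R.

Let kappa2 : kappa *+ 2 != 0. Proof. by rewrite mulrn_eq0 /= gt_eqF. Qed.

Lemma dual_vecE al k : e k (dual_vec g al) = al (sd k) / (kappa *+ 2).
Proof.
(* [dual_vec] is a choice with default 0. Exhibiting one representing element guarantees that the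
   chosen one represents [al] too. *)
have [t0 ht0] := half_realize (fun k => (al (sd k) : K) / (kappa *+ 2)).
have ex0 : forall s, killing g (vsval t0) (vsval s) = al s.
  move=> s; rewrite killing_torus [in RHS](dual_expand al hsd) sum_lfunE mulr_sumr.
  apply: eq_bigr => l _; rewrite ht0 scale_lfunE mulrA; congr (_ * _).
  by rewrite mulrC divfK.
have h' : [set t | forall s, killing g (vsval t) (vsval s) = al s] (dual_vec g al).
  by apply: xgetPex; exists t0.
apply: (mulfI kappa2); rewrite mulrC [RHS]mulrC divfK// -(h' (sd k)) killing_torus mulrC.
congr (_ * _); rewrite (bigD1 k)//= big1 ?addr0 => [|l lk]; rewrite hsd ?eqxx ?mulr1//.
by rewrite (negbTE lk) mulr0.
Qed.

Lemma dual_formE al be :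
  dual_form g al be = (kappa *+ 2)^-1 * \sum_k (al (sd k) : K) * be (sd k).
Proof.
rewrite /dual_form killing_torus !mulr_sumr; apply: eq_bigr => k _.
rewrite !dual_vecE; field.
by rewrite gt_eqF.
Qed.

End DualForm.

End Halves.

End Weights.

(** * Types of the orthogonal algebras *)

(** Parity: 2m plus the number of fixed points is 2l+1, and there is at most one fixed point. *)
Lemma half_system_odd (d l : nat) (tau : 'I_d -> 'I_d) : d = (2 * l).+1 -> involutive tau ->
  (forall i j, tau i = i -> tau j = j -> i = j) ->
  exists r : 'I_l -> 'I_d, half_system tau r /\ exists o, tau o = o.
Proof.
move=> dE tauK fix1; have [m [r [hr mE]]] := ex_half_system tauK.
have F1 : (#|[pred i | tau i == i]| <= 1)%N.
  by apply/card_le1_eqP => i j; rewrite !inE => /eqP ti /eqP tj; apply: fix1.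
have [ml F] : m = l /\ #|[pred i | tau i == i]| = 1%N.
  by move: mE F1; rewrite [X in _ = X -> _]dE; move: #|_| => f; lia.
subst m; exists r; split=> //.
have /card_gt0P[o] : (0 < #|[pred i | tau i == i]|)%N by rewrite F.
by rewrite inE => /eqP; exists o.
Qed.

Lemma half_system_even (d l : nat) (tau : 'I_d -> 'I_d) : d = (2 * l)%N -> involutive tau ->
  (forall i, tau i != i) -> exists r : 'I_l -> 'I_d, half_system tau r.
Proof.
move=> dE tauK fix0; have [m [r [hr mE]]] := ex_half_system tauK.
have ml : m = l.
  have F : #|[pred i | tau i == i]| = 0%N.
    by apply: eq_card0 => i; rewrite inE; apply: negbTE.
  by move: mE; rewrite F addn0 [X in _ = X -> _]dE; lia.
by subst m; exists r.
Qed.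

(** * The diagonal torus as a Cartan subalgebra *)

Section TorusCartan.
Variables (K : numFieldType) (d : nat).
Local Notation M := 'M[K]_d.
Local Notation skewv := (skewv K d).
Variables (P : M) (tau : 'I_d -> 'I_d).
Hypotheses (Pu : P \in unitmx) (tauK : involutive tau)
  (Btau : forall i j, ((P *m P^T) i j != 0) = (j == tau i))
  (tau_fix : forall i j, tau i = i -> tau j = j -> i = j).

Definition off_diag (x : M) : M := \matrix_(i, j) if i == j then 0 else (P *m x *m invmx P) i j.

Lemma off_diag_linear : linear off_diag.
Proof.
move=> k x y; apply/matrixP => i j.
rewrite mxE mulmxDr mulmxDl -scalemxAr -scalemxAl [RHS]mxE [X in _ = X + _]mxE.
rewrite [off_diag x i j]mxE [off_diag y i j]mxE.
by case: eqP => _; rewrite ?mulr0 ?addr0// mxE [X in X + _ = _]mxE.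
Qed.
HB.instance Definition _ := GRing.isLinear.Build K M M _ off_diag off_diag_linear.

Definition torus : {vspace M} := (skewv :&: lker (linfun off_diag))%VS.

Lemma torusP x : x \in torus <-> x \in skewv /\ forall i j, i != j -> (P *m x *m invmx P) i j = 0.
Proof.
rewrite /torus; split=> [/memv_capP[xs]|[xs hx]].
  rewrite memv_ker lfunE /= => /eqP/matrixP hx; split=> // i j ij.
  by have E := hx i j; rewrite [LHS]mxE (negbTE ij) [RHS]mxE in E.
apply/memv_capP; split=> //; rewrite memv_ker lfunE /=; apply/eqP/matrixP => i j.
by rewrite [RHS]mxE [LHS]mxE; case: (eqVneq i j) => // /hx.
Qed.

Lemma torus_abelian : {in torus &, forall x y, lie x y = 0}.
Proof.
move=> x y /torusP[xs xd] /torusP[ys yd].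
apply: (can_inj (mulKmx Pu)); apply: (can_inj (mulmxK (etrans (unitmx_inv P) Pu))).
rewrite mulmx0 mul0mx; apply/matrixP => i j.
rewrite conj_lie//.
have subE (A A' : M) : (A - A') i j = A i j - A' i j by rewrite !mxE.
rewrite [RHS]mxE /lie subE (mulmx_diagl _ _ _ xd) (mulmx_diagr _ _ _ xd).
by have [->|/yd->] := eqVneq i j; [rewrite mulrC subrr|rewrite mulr0 mul0r subrr].
Qed.

Let id_inj : lker (\1%VF : 'End(M)) == 0%VS.
Proof. by apply/lker0P => x y; rewrite !id_lfunE. Qed.

Let torus_id X : X \in torus <->
  exists x, [/\ x \in skewv, forall i j, i != j -> (P *m x *m invmx P) i j = 0 & X = (\1%VF : 'End(M)) x].
Proof.
split=> [/torusP[xs xd]|[x [xs xd ->]]]; first by exists X; rewrite id_lfunE.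
by rewrite id_lfunE; apply/torusP.
Qed.

(** If [x] normalizes the torus, the entry of P x P^T at (i, j) with j different from [tau i] is
    zero, since eps i + eps j does not vanish identically for i and j distinct and the diagonal is
    zero by skewness. So P x P^T has the support of the Gram matrix P P^T, and the quotient P x P^-1
    is diagonal. *)
Lemma torus_cartan : cartan_subalgebra skewv torus.
Proof.
split; first exact: capvSl.
- by apply/lie_spanP => x y xt yt; rewrite torus_abelian// mem0v.
- by exists 1%N; apply/lie_span0; exact: torus_abelian.
move=> x xs norm; apply/torusP; split=> //.
have [m [r [hr _]]] := ex_half_system tauK.
pose eps := eps_weight (\1%VF : 'End(M)) P torus.
have pr_id (s : subvs_of torus) : ((\1%VF : 'End(M))^-1)%VF (vsval s) = vsval s.
  by apply: (canLR (lker0_lfunK id_inj)); rewrite id_lfunE.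
have eps_neq0 i j : i != j -> j != tau i -> eps i + eps j <> 0.
  move=> ij jt; have c := eps_cases id_inj Pu Btau torus_id hr.
  have [[ti ei]|[k [b iE]]] := c i; have [[tj ej]|[k' [b' jE]]] := c j.
  - by move: ij; rewrite (tau_fix ti tj) eqxx.
  - rewrite /eps ei add0r jE; exact: (eps_pt_neq0 id_inj Pu tauK Btau torus_id hr).
  - rewrite /eps ej addr0 iE; exact: (eps_pt_neq0 id_inj Pu tauK Btau torus_id hr).
  rewrite /eps iE jE; apply: (eps_pt2_neq0 id_inj Pu tauK Btau torus_id hr).
  apply/eqP => kk; move: ij jt; rewrite iE jE kk.
  by case: (b); case: (b'); rewrite ?eqxx// tauK eqxx.
pose y := P *m x *m P^T.
have yskew : y^T = - y by move/skewvP: xs => xs; rewrite /y !trmx_mul trmxK xs mulNmx mulmxN mulmxA.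
have y0 i j : j != tau i -> y i j = 0.
  move=> jt; have [<-|ij] := eqVneq i j.
    have /matrixP/(_ i i) := yskew; rewrite mxE [RHS]mxE => /eqP.
    by rewrite -addr_eq0 -mulr2n mulrn_eq0 => /eqP.
  apply/eqP; apply: contrapT => /negP yij; apply: (eps_neq0 _ _ ij jt).
  apply/lfunP => s; rewrite add_lfunE zero_lfunE; apply/eqP.
  have := bicoord_lie id_inj Pu torus_id s x i j; rewrite pr_id -/y => E.
  suff /eqP : (P *m lie (vsval s) x *m P^T) i j = 0.
    by rewrite E mulf_eq0 (negbTE yij) orbF.
  have /torusP[_ hd] : lie (vsval s) x \in torus by rewrite lieN memvN norm ?subvsP.
  have -> : P *m lie (vsval s) x *m P^T = (P *m lie (vsval s) x *m invmx P) *m (P *m P^T).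
    by rewrite !mulmxA mulmxKV.
  rewrite (mulmx_diagl _ _ _ hd); have := Btau i j; rewrite (negbTE jt) => /negbFE/eqP->.
  by rewrite mulr0.
pose D : M := diag_mx (\row_i (y i (tau i) / (P *m P^T) i (tau i))).
have yD : y = D *m (P *m P^T).
  apply/matrixP => i j; rewrite mul_diag_mx [RHS]mxE [(\row_i0 _) 0 i]mxE.
  have [->|jt] := eqVneq j (tau i); first by rewrite divfK// Btau.
  by rewrite y0//; have := Btau i j; rewrite (negbTE jt) => /negbFE/eqP->; rewrite mulr0.
have -> : P *m x *m invmx P = D.
  have Bu : P *m P^T \in unitmx by rewrite unitmx_mul Pu unitmx_tr.
  by apply: (can_inj (mulmxK Bu)); rewrite -yD /y !mulmxA mulmxKV.
by move=> i j ij; rewrite !mxE (negbTE ij).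
Qed.

End TorusCartan.

(** * Square roots of symmetric involutions *)

Section InvolutionSqrt.
Variables (K : fieldType) (im : K) (d : nat) (J : 'M[K]_d).
Hypotheses (im2 : im * im = -1) (two0 : 2 != 0 :> K) (Jsym : J^T = J) (J2 : J *m J = 1%:M).

(** On the eigenvalues 1 and -1 of [J] this takes the values 1 and -im, square roots of 1 and -1.
    Being symmetric, it turns the form with matrix [J] into the standard one. *)
Definition invol_sqrt : 'M[K]_d := ((1 - im) / 2) *: (1%:M + im *: J).

Lemma invol_sqrt_sym : invol_sqrt^T = invol_sqrt.
Proof. by rewrite /invol_sqrt linearZ linearD linearZ /= Jsym trmx1. Qed.

Lemma invol_sqrtK : invol_sqrt *m invol_sqrt = J.
Proof.
rewrite /invol_sqrt -scalemxAl -scalemxAr scalerA mulmxDl !mulmxDr mulmx1 mul1mx mulmx1.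
rewrite -scalemxAl -scalemxAr scalerA J2 im2 scaleN1r.
apply/matrixP => i j; rewrite !mxE.
have -> : (1 - im) / 2 * ((1 - im) / 2) = - im / 2.
  have -> : (1 - im) / 2 * ((1 - im) / 2) = (1 - im - im + im * im) / 2 / 2 by field.
  by rewrite im2; field.
have -> : (i == j)%:R + im * J i j + (im * J i j - (i == j)%:R) = 2 * im * J i j by ring.
have -> : - im / 2 * (2 * im * J i j) = - (im * im) * J i j by field.
by rewrite im2 opprK mul1r.
Qed.

Lemma invol_sqrt_unit : invol_sqrt \in unitmx.
Proof.
have : invol_sqrt *m (invol_sqrt *m J) = 1%:M by rewrite mulmxA invol_sqrtK J2.
by case/mulmx1_unit.
Qed.

End InvolutionSqrt.

Section SimpleTypes.
Variables (K : numFieldType) (d N : nat) (phi : 'Hom('M[K]_d, 'M[K]_N)).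
Local Notation M := 'M[K]_d.
Local Notation skewv := (skewv K d).
Hypotheses (phi_inj : lker phi == 0%VS)
  (phi_lie : {in skewv &, forall x y, lie (phi x) (phi y) = phi (lie x y)}).
Variables (P : M) (tau : 'I_d -> 'I_d).
Hypothesis Pu : P \in unitmx.
Hypothesis tauK : involutive tau.
Hypothesis Btau : forall i j, ((P *m P^T) i j != 0) = (j == tau i).

Lemma lie_simple_skew : d = 3 \/ (5 <= d)%N -> lie_simple (phi @: skewv).
Proof.
move=> hd; have d3 : (3 <= d)%N by lia.
have phi_lie' : {in skewv &, forall x y, phi (lie x y) = lie (phi x) (phi y)}.
  by move=> x y xs ys; rewrite phi_lie.
apply: irreducible_adjoint_simple.
  rewrite (limg_lie_span phi_lie') ?subvv// => /(limg_eq0 phi_inj).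
  exact: lie_skewv_neq0.
apply: (@limg_irreducible _ _ _ phi skewv _ phi (@lie K d)) => //.
- move=> s0; apply: (lie_skewv_neq0 (K := K) d3); rewrite s0; apply/lie_span0 => x y.
  by rewrite memv0 => /eqP->; rewrite lie0l.
- by move=> x y xs ys; apply: skewv_lie.
- by move=> U; apply: skewv_irreducible.
Qed.

Lemma torus_imgP X : X \in (phi @: torus P)%VS <->
  exists x, [/\ x \in skewv, forall i j, i != j -> (P *m x *m invmx P) i j = 0 & X = phi x].
Proof.
split=> [/memv_imgP[x /(torusP P)[xs xd] ->]|[x [xs xd ->]]]; first by exists x.
by apply: memv_img; apply/torusP.
Qed.

Lemma torus_img_cartan : (forall i j, tau i = i -> tau j = j -> i = j) ->
  cartan_subalgebra (phi @: skewv) (phi @: torus P).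
Proof.
move=> tau_fix; apply/(limg_cartan phi_inj).
- by move=> x y xs ys; rewrite phi_lie.
- exact: capvSl.
- exact: torus_cartan tauK Btau tau_fix.
Qed.

Lemma simple_type_B l : (1 <= l)%N -> d = (2 * l).+1 ->
  (forall i j, tau i = i -> tau j = j -> i = j) -> simple_of_type_B (phi @: skewv) l.
Proof.
move=> l1 dE tau_fix; split; first by apply: lie_simple_skew; lia.
exists (phi @: torus P)%VS; split; first exact: torus_img_cartan.
have [r [hr [o to]]] := half_system_odd dE tauK tau_fix.
exact: (root_system_skew phi_inj Pu tauK Btau torus_imgP hr phi_lie to).
Qed.

Lemma simple_type_D l : (3 <= l)%N -> d = (2 * l)%N ->
  (forall i, tau i != i) -> simple_of_type_D (phi @: skewv) l.
Proof.
move=> l1 dE tau_fix; split; first by apply: lie_simple_skew; lia.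
exists (phi @: torus P)%VS; split.
  by apply: torus_img_cartan => i j /eqP; rewrite (negbTE (tau_fix i)).
have [r hr] := half_system_even dE tauK tau_fix.
exists (half_tuple phi P (phi @: torus P)%VS r); split.
  exact: (half_basis phi_inj Pu tauK Btau torus_imgP hr).
rewrite (lie_roots_D phi_inj Pu tauK Btau torus_imgP hr phi_lie tau_fix).
apply/seteqP; split=> al.
- by move=> [i [j [b [c [ij ->]]]]]; exists i, j, b, c; rewrite !half_tupleE.
- by move=> [i [j [b [c [ij ->]]]]]; exists i, j, b, c; rewrite !half_tupleE.
Qed.

End SimpleTypes.

(** * Graded pieces in block coordinates *)

Section Blocks.
Variables (K : numFieldType) (d : nat) (im : K).
Hypothesis im2 : im * im = -1.
Local Notation M := 'M[K]_d.
Local Notation n4 := ((d + d) + (1 + 1))%N.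

Definition blk (a11 a12 a21 a22 : M) (a13 a14 a23 a24 : 'cV[K]_d)
    (a31 a32 a41 a42 : 'rV[K]_d) (a33 a34 a43 a44 : 'M[K]_1) : 'M[K]_n4 :=
  block_mx (block_mx a11 a12 a21 a22) (block_mx a13 a14 a23 a24)
           (block_mx a31 a32 a41 a42) (block_mx a33 a34 a43 a44).

(** Normal forms of the two matrices and of the form, with blocks of sizes d, d, 1, 1. [BJ] is
    hyperbolic on the first two; the entries 2 and -2 come from the basis s3 + s4, s3 - s4 of the
    last two. *)
Definition B0 : 'M[K]_n4 := blk 0 (- 1%:M) 1%:M 0 0 0 0 0 0 0 0 0 0 (- 1%:M) 1%:M 0.
Definition B1 : 'M[K]_n4 :=
  blk 1%:M 0 0 (- 1%:M) 0 0 0 0 0 0 0 0 im%:M 0 0 (- im%:M).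
Definition BJ : 'M[K]_n4 := blk 0 1%:M 1%:M 0 0 0 0 0 0 0 0 0 2%:M 0 0 (- 2%:M).

Let simp := (mulmx0, mul0mx, addr0, add0r, mulmx1, mul1mx, mulNmx, mulmxN, oppr0, scaler0,
             mul_scalar_mx, mul_mx_scalar).

Lemma blkP (Y : 'M[K]_n4) : exists a11 a12 a21 a22 a13 a14 a23 a24 a31 a32 a41 a42 a33 a34 a43 a44,
  Y = blk a11 a12 a21 a22 a13 a14 a23 a24 a31 a32 a41 a42 a33 a34 a43 a44.
Proof.
rewrite -[Y]submxK -[ulsubmx Y]submxK -[ursubmx Y]submxK -[dlsubmx Y]submxK -[drsubmx Y]submxK.
by do 16!eexists.
Qed.

Lemma eq_blk a11 a12 a21 a22 a13 a14 a23 a24 a31 a32 a41 a42 a33 a34 a43 a44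
             b11 b12 b21 b22 b13 b14 b23 b24 b31 b32 b41 b42 b33 b34 b43 b44 :
  blk a11 a12 a21 a22 a13 a14 a23 a24 a31 a32 a41 a42 a33 a34 a43 a44 =
  blk b11 b12 b21 b22 b13 b14 b23 b24 b31 b32 b41 b42 b33 b34 b43 b44 ->
  [/\ [/\ a11 = b11, a12 = b12, a21 = b21 & a22 = b22],
      [/\ a13 = b13, a14 = b14, a23 = b23 & a24 = b24],
      [/\ a31 = b31, a32 = b32, a41 = b41 & a42 = b42] &
      [/\ a33 = b33, a34 = b34, a43 = b43 & a44 = b44]].
Proof.
by move=> /eq_block_mx[/eq_block_mx[-> -> -> ->] /eq_block_mx[-> -> -> ->]
  /eq_block_mx[-> -> -> ->] /eq_block_mx[-> -> -> ->]].
Qed.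

(* The three conditions that cut out a graded piece, in block coordinates. *)
Definition skewJ (Y : 'M[K]_n4) := Y^T *m BJ = - (BJ *m Y).
Definition eig (B : 'M[K]_n4) (e : K) (Y : 'M[K]_n4) := B *m Y = e *: (Y *m B).

(** General solutions of the block conditions, the name giving the power of [im] by which sigma_1
    acts and [e] the sign of sigma_0. [Y_triv] spans the invariant line, and the factors 1/2
    compensate for the 2 in [BJ]. *)
Definition Y_even (a : M) : 'M[K]_n4 := blk a 0 0 (- a^T) 0 0 0 0 0 0 0 0 0 0 0 0.
Definition Y_two (e : K) (b : M) : 'M[K]_n4 := blk 0 b (- e *: b) 0 0 0 0 0 0 0 0 0 0 0 0 0.
Definition Y_triv : 'M[K]_n4 := blk 0 0 0 0 0 0 0 0 0 0 0 0 0 1%:M 1%:M 0.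
Definition Y_one (e : K) (v : 'cV[K]_d) : 'M[K]_n4 :=
  blk 0 0 0 0 0 v (- e *: v) 0 ((e / 2) *: v^T) 0 0 (2^-1 *: v^T) 0 0 0 0.
Definition Y_three (e : K) (v : 'cV[K]_d) : 'M[K]_n4 :=
  blk 0 0 0 0 v 0 0 (e *: v) 0 (- 2^-1 *: v^T) ((e / 2) *: v^T) 0 0 0 0 0.

Lemma Y_even_linear : linear Y_even.
Proof.
move=> k a b; rewrite /Y_even /blk !scale_block_mx !add_block_mx !simp.
by rewrite linearP /= opprD scalerN.
Qed.
HB.instance Definition _ := GRing.isLinear.Build K M 'M[K]_n4 _ Y_even Y_even_linear.

Lemma Y_two_linear e : linear (Y_two e).
Proof.
move=> k a b; rewrite /Y_two /blk !scale_block_mx !add_block_mx !simp.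
by rewrite scalerDr !scalerA mulrC.
Qed.
HB.instance Definition _ e := GRing.isLinear.Build K M 'M[K]_n4 _ (Y_two e) (Y_two_linear e).

Lemma Y_one_linear e : linear (Y_one e).
Proof.
move=> k a b; have trE : (k *: a + b)^T = k *: a^T + b^T by rewrite linearP.
rewrite /Y_one /blk !scale_block_mx !add_block_mx !simp.
by rewrite trE !scalerDr !scalerA ![_ * k]mulrC.
Qed.
HB.instance Definition _ e := GRing.isLinear.Build K 'cV[K]_d 'M[K]_n4 _ (Y_one e) (Y_one_linear e).

Lemma Y_three_linear e : linear (Y_three e).
Proof.
move=> k a b; have trE : (k *: a + b)^T = k *: a^T + b^T by rewrite linearP.
rewrite /Y_three /blk !scale_block_mx !add_block_mx !simp.
by rewrite trE !scalerDr !scalerA ![_ * k]mulrC.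
Qed.
HB.instance Definition _ e := GRing.isLinear.Build K 'cV[K]_d 'M[K]_n4 _ (Y_three e) (Y_three_linear e).

Lemma Y_even_inj : injective Y_even.
Proof. by move=> a b /eq_blk[[->]]. Qed.
Lemma Y_two_inj e : injective (Y_two e).
Proof. by move=> a b /eq_blk[[_ ->]]. Qed.
Lemma Y_one_inj e : injective (Y_one e).
Proof. by move=> a b /eq_blk[_ [_ ->]]. Qed.
Lemma Y_three_inj e : injective (Y_three e).
Proof. by move=> a b /eq_blk[_ [->]]. Qed.

Lemma lie_Y_even a b : lie (Y_even a) (Y_even b) = Y_even (lie a b).
Proof.
rewrite /lie /Y_even /blk !mulmx_block !add_block_mx !simp !opp_block_mx !add_block_mx !simp.
by rewrite !opprK linearB /= !trmx_mul opprB addrC.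
Qed.

Lemma lie_Y_two e a b : a^T = - a -> lie (Y_even a) (Y_two e b) = Y_two e (lie a b).
Proof.
move=> as_; rewrite /lie /Y_even /Y_two /blk as_ opprK.
rewrite !mulmx_block !add_block_mx !simp !opp_block_mx !add_block_mx !simp.
by rewrite -!scalemxAr -!scalemxAl scalerBr.
Qed.

Lemma lie_Y_triv a : lie (Y_even a) Y_triv = 0.
Proof.
rewrite /lie /Y_even /Y_triv /blk !mulmx_block !add_block_mx !simp.
by rewrite subrr.
Qed.

Lemma lie_Y_one e a v : a^T = - a -> lie (Y_even a) (Y_one e v) = Y_one e (a *m v).
Proof.
move=> as_; rewrite /lie /Y_even /Y_one /blk as_ opprK.
rewrite !mulmx_block !add_block_mx !simp !opp_block_mx !add_block_mx !simp.
by rewrite -!scalemxAr -!scalemxAl trmx_mul as_ mulmxN !scalerN.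
Qed.

Lemma lie_Y_three e a v : a^T = - a -> lie (Y_even a) (Y_three e v) = Y_three e (a *m v).
Proof.
move=> as_; rewrite /lie /Y_even /Y_three /blk as_ opprK.
rewrite !mulmx_block !add_block_mx !simp !opp_block_mx !add_block_mx !simp.
by rewrite -!scalemxAr -!scalemxAl trmx_mul as_ mulmxN !scalerN.
Qed.

Let im0 : im != 0.
Proof. by apply/eqP => i0; move/eqP: im2; rewrite i0 mul0r eq_sym oppr_eq0 oner_eq0. Qed.
Let n11 : 1 != -1 :> K.
Proof. by rewrite -subr_eq0 opprK -(natrD _ 1 1) pnatr_eq0. Qed.
Let i1 : im != 1.
Proof. by apply: contraNneq n11 => i1; rewrite -im2 i1 mulr1. Qed.
Let iN1 : im != -1.
Proof. by apply: contraNneq n11 => E; rewrite -im2 E mulrNN mulr1. Qed.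
Let iNi : im != - im.
Proof. by rewrite -addr_eq0 -mulr2n mulrn_eq0. Qed.

Let scale_neq (V : lmodType K) (x y : K) (v : V) : x *: v = y *: v -> x != y -> v = 0.
Proof.
move=> /eqP; rewrite -subr_eq0 -scalerBl scaler_eq0 subr_eq0 => /orP[/eqP->|/eqP//].
by rewrite eqxx.
Qed.

Let n11' : -1 != 1 :> K. Proof. by rewrite eq_sym. Qed.
Let i1' : 1 != im. Proof. by rewrite eq_sym. Qed.
Let iN1' : -1 != im. Proof. by rewrite eq_sym. Qed.
Let iNi' : - im != im. Proof. by rewrite eq_sym. Qed.
Let Ni1 : - im != 1. Proof. by rewrite eqr_oppLR. Qed.
Let Ni1' : 1 != - im. Proof. by rewrite eq_sym. Qed.
Let NiN1 : - im != -1. Proof. by rewrite eqr_opp. Qed.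
Let NiN1' : -1 != - im. Proof. by rewrite eq_sym. Qed.

(** Each equation compares two multiples of one block: for a given eigenvalue, unequal scalars kill
    the block and equal ones leave it free. *)
Lemma eig_B1P e a11 a12 a21 a22 a13 a14 a23 a24 a31 a32 a41 a42 a33 a34 a43 a44 :
  eig B1 e (blk a11 a12 a21 a22 a13 a14 a23 a24 a31 a32 a41 a42 a33 a34 a43 a44) <->
  [/\ [/\ 1 *: a11 = e *: a11, 1 *: a12 = - e *: a12, -1 *: a21 = e *: a21 & -1 *: a22 = - e *: a22],
      [/\ 1 *: a13 = (e * im) *: a13, 1 *: a14 = - (e * im) *: a14,
         -1 *: a23 = (e * im) *: a23 & -1 *: a24 = - (e * im) *: a24],
      [/\ im *: a31 = e *: a31, im *: a32 = - e *: a32, - im *: a41 = e *: a41 & - im *: a42 = - e *: a42] &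
      [/\ im *: a33 = (e * im) *: a33, im *: a34 = - (e * im) *: a34,
         - im *: a43 = (e * im) *: a43 & - im *: a44 = - (e * im) *: a44]].
Proof.
rewrite /eig /B1 /blk !mulmx_block !add_block_mx !simp !scale_block_mx.
rewrite !scale1r !scaleN1r !scaleNr !scalerN !scalerA.
split=> [/eq_blk//|[[h1 h2 h3 h4] [h5 h6 h7 h8] [h9 h10 h11 h12] [h13 h14 h15 h16]]].
by do 2!congr block_mx.
Qed.

Lemma skewJP a11 a12 a21 a22 a13 a14 a23 a24 a31 a32 a41 a42 a33 a34 a43 a44 :
  skewJ (blk a11 a12 a21 a22 a13 a14 a23 a24 a31 a32 a41 a42 a33 a34 a43 a44) <->
  [/\ [/\ a21^T = - a21, a11^T = - a22, a22^T = - a11 & a12^T = - a12],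
      [/\ 2 *: a31^T = - a23, - (2 *: a41^T) = - a24, 2 *: a32^T = - a13 & - (2 *: a42^T) = - a14],
      [/\ a23^T = - (2 *: a31), a13^T = - (2 *: a32), a24^T = 2 *: a41 & a14^T = 2 *: a42] &
      [/\ 2 *: a33^T = - (2 *: a33), - (2 *: a43^T) = - (2 *: a34), 2 *: a34^T = 2 *: a43 &
          - (2 *: a44^T) = 2 *: a44]].
Proof.
rewrite /skewJ /BJ /blk !tr_block_mx !mulmx_block !add_block_mx !simp !opp_block_mx.
rewrite !opprK.
split=> [/eq_blk//|[[h1 h2 h3 h4] [h5 h6 h7 h8] [h9 h10 h11 h12] [h13 h14 h15 h16]]].
by do 2!congr block_mx.
Qed.

Let two0 : 2 != 0 :> K. Proof. by rewrite pnatr_eq0. Qed.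

Let self_dbl (V : lmodType K) (v : V) : 2 *: v = - (2 *: v) -> v = 0.
Proof.
move=> E; apply: (@scale_neq V 2 (- 2)); first by rewrite scaleNr.
by rewrite -subr_eq0 opprK -natrD pnatr_eq0.
Qed.

Let tr11 (x : 'M[K]_1) : x^T = x.
Proof. by apply/matrixP => i j; rewrite mxE !ord1. Qed.

Lemma eig1P Y : skewJ Y -> eig B1 1 Y -> exists a, Y = Y_even a.
Proof.
have [a11 [a12 [a21 [a22 [a13 [a14 [a23 [a24 [a31 [a32 [a41 [a42 [a33 [a34 [a43 [a44 ->]]]]]]]]]]]]]]]] := blkP Y.
move=> /skewJP[[_ _ h22 _] _ _ [h33 _ _ h44]] /eig_B1P; rewrite !mul1r.
move=> [[_ /scale_neq-> // /scale_neq-> // _]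
  [/scale_neq-> // /scale_neq-> // /scale_neq-> // /scale_neq-> //]
  [/scale_neq-> // /scale_neq-> // /scale_neq-> // /scale_neq-> //]
  [_ /scale_neq-> // /scale_neq-> // _]].
have -> : a33 = 0 by apply: self_dbl; rewrite -[in LHS](tr11 a33).
have -> : a44 = 0 by apply: self_dbl; rewrite -[X in _ = - X]h44 opprK tr11.
exists a11; rewrite /Y_even; congr blk.
by rewrite -[LHS]trmxK h22 linearN.
Qed.

Lemma eigN1P Y : skewJ Y -> eig B1 (-1) Y ->
  exists b c t, [/\ b^T = - b, c^T = - c & Y = blk 0 b c 0 0 0 0 0 0 0 0 0 0 t t 0].
Proof.
have [a11 [a12 [a21 [a22 [a13 [a14 [a23 [a24 [a31 [a32 [a41 [a42 [a33 [a34 [a43 [a44 ->]]]]]]]]]]]]]]]] := blkP Y.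
move=> /skewJP[[h21 _ _ h12] _ _ [_ _ h34 _]] /eig_B1P; rewrite !(mulN1r, opprK).
move=> [[/scale_neq-> // _ _ /scale_neq-> //]
  [/scale_neq-> // /scale_neq-> // /scale_neq-> // /scale_neq-> //]
  [/scale_neq-> // /scale_neq-> // /scale_neq-> // /scale_neq-> //]
  [/scale_neq-> // _ _ /scale_neq-> //]].
exists a12, a21, a34; split=> //; congr blk.
by apply: (scalerI two0); rewrite -h34 tr11.
Qed.

Lemma eigimP Y : skewJ Y -> eig B1 im Y ->
  exists v w, Y = blk 0 0 0 0 0 v w 0 (- 2^-1 *: w^T) 0 0 (2^-1 *: v^T) 0 0 0 0.
Proof.
have [a11 [a12 [a21 [a22 [a13 [a14 [a23 [a24 [a31 [a32 [a41 [a42 [a33 [a34 [a43 [a44 ->]]]]]]]]]]]]]]]] := blkP Y.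
move=> /skewJP[_ _ [h23 _ _ h14] _] /eig_B1P; rewrite !im2 !opprK.
move=> [[/scale_neq-> // /scale_neq-> // /scale_neq-> // /scale_neq-> //]
  [/scale_neq-> // _ _ /scale_neq-> //]
  [_ /scale_neq-> // /scale_neq-> // _]
  [/scale_neq-> // /scale_neq-> // /scale_neq-> // /scale_neq-> //]].
exists a14, a23; congr blk.
  by rewrite h23 scalerN scaleNr opprK scalerA mulVf// scale1r.
by rewrite h14 scalerA mulVf// scale1r.
Qed.

Lemma eigNimP Y : skewJ Y -> eig B1 (- im) Y ->
  exists v w, Y = blk 0 0 0 0 v 0 0 w 0 (- 2^-1 *: v^T) (2^-1 *: w^T) 0 0 0 0 0.
Proof.
have [a11 [a12 [a21 [a22 [a13 [a14 [a23 [a24 [a31 [a32 [a41 [a42 [a33 [a34 [a43 [a44 ->]]]]]]]]]]]]]]]] := blkP Y.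
move=> /skewJP[_ _ [_ h13 h24 _] _] /eig_B1P; rewrite !mulNr !im2 !opprK.
move=> [[/scale_neq-> // /scale_neq-> // /scale_neq-> // /scale_neq-> //]
  [_ /scale_neq-> // /scale_neq-> // _]
  [/scale_neq-> // _ _ /scale_neq-> //]
  [/scale_neq-> // /scale_neq-> // /scale_neq-> // /scale_neq-> //]].
exists a13, a24; congr blk.
  by rewrite h13 scalerN scaleNr opprK scalerA mulVf// scale1r.
by rewrite h24 scalerA mulVf// scale1r.
Qed.

Lemma eig_B0P e a11 a12 a21 a22 a13 a14 a23 a24 a31 a32 a41 a42 a33 a34 a43 a44 :
  eig B0 e (blk a11 a12 a21 a22 a13 a14 a23 a24 a31 a32 a41 a42 a33 a34 a43 a44) <->
  [/\ [/\ - a21 = e *: a12, - a22 = e *: - a11, a11 = e *: a22 & a12 = e *: - a21],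
      [/\ - a23 = e *: a14, - a24 = e *: - a13, a13 = e *: a24 & a14 = e *: - a23],
      [/\ - a41 = e *: a32, - a42 = e *: - a31, a31 = e *: a42 & a32 = e *: - a41] &
      [/\ - a43 = e *: a34, - a44 = e *: - a33, a33 = e *: a44 & a34 = e *: - a43]].
Proof.
rewrite /eig /B0 /blk !mulmx_block !add_block_mx !simp !scale_block_mx.
split=> [/eq_blk//|[[h1 h2 h3 h4] [h5 h6 h7 h8] [h9 h10 h11 h12] [h13 h14 h15 h16]]].
by do 2!congr block_mx.
Qed.

Definition block_cond (e e' : K) Y := [/\ skewJ Y, eig B0 e Y & eig B1 e' Y].

Lemma block_cond_even e a : e * e = 1 -> a^T = - e *: a -> block_cond e 1 (Y_even a).
Proof.
move=> e2 ae; rewrite /Y_even ae; split.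
- by apply/skewJP; split; split; rewrite ?trmx0 ?simp ?opprK ?ae ?linearN ?linearZ /= ?ae ?scaleNr ?scalerN ?opprK ?scalerA ?e2 ?scale1r.
- by apply/eig_B0P; split; split; rewrite ?simp ?opprK ?scaleNr ?scalerN ?opprK ?scalerA ?e2 ?scale1r.
- by apply/eig_B1P; split; split; rewrite ?simp ?scaleNr ?scalerN ?opprK ?scale1r.
Qed.

Lemma block_cond_two e b : e * e = 1 -> b^T = - b -> block_cond e (-1) (Y_two e b).
Proof.
move=> e2 be; rewrite /Y_two; split.
- by apply/skewJP; split; split; rewrite ?trmx0 ?simp ?opprK ?linearZ /= ?be ?scalerN.
- by apply/eig_B0P; split; split; rewrite ?simp ?opprK ?scaleNr ?scalerN ?opprK ?scalerA ?e2 ?scale1r.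
- by apply/eig_B1P; split; split; rewrite ?simp ?scaleNr ?scalerN ?opprK ?scale1r.
Qed.

Lemma block_cond_triv : block_cond (-1) (-1) Y_triv.
Proof.
rewrite /Y_triv; split.
- by apply/skewJP; split; split; rewrite ?trmx0 ?trmx1 ?simp.
- by apply/eig_B0P; split; split; rewrite ?simp ?scaleN1r ?opprK.
- by apply/eig_B1P; split; split; rewrite ?simp ?mulN1r ?opprK.
Qed.

Lemma block_cond_one e v : e * e = 1 -> block_cond e im (Y_one e v).
Proof.
move=> e2; rewrite /Y_one; split.
- apply/skewJP; split; split; rewrite ?trmx0 ?simp ?linearZ /= ?trmxK ?scalerA ?scaleNr ?opprK //.
  + by rewrite scalerN opprK divfK.
  + by rewrite mulfV// scale1r.
  + by rewrite scalerN mulrC divfK.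
  + by rewrite mulVf// scale1r.
- apply/eig_B0P; split; split; rewrite ?simp ?scaleNr ?scalerN ?opprK ?scalerA ?e2 ?scale1r//.
  by congr (- (_ *: _)); rewrite mulrA e2 mul1r.
- by apply/eig_B1P; split; split; rewrite ?simp ?im2 ?opprK ?scale1r.
Qed.

Lemma block_cond_three e v : e * e = 1 -> block_cond e (- im) (Y_three e v).
Proof.
move=> e2; rewrite /Y_three; split.
- apply/skewJP; split; split; rewrite ?trmx0 ?simp ?linearZ /= ?trmxK ?scalerA ?scaleNr ?scalerN ?opprK //.
  + by congr (- (_ *: _)); field.
  + by rewrite mulNr mulVf// scaleN1r.
  + by rewrite mulrN mulfV// scaleN1r opprK.
  + by congr (_ *: _); field.
- apply/eig_B0P; split; split; rewrite ?simp ?scaleNr ?scalerN ?opprK ?scalerA ?e2 ?scale1r//.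
  by congr (- (_ *: _)); rewrite mulrA e2 mul1r.
- by apply/eig_B1P; split; split; rewrite ?simp ?mulNr ?im2 ?opprK ?scale1r.
Qed.

Lemma block_evenP e Y : block_cond e 1 Y -> exists a, Y = Y_even a /\ a^T = - e *: a.
Proof.
move=> [hJ h0 h1]; have [a YE] := eig1P hJ h1; exists a; split=> //.
move: h0; rewrite YE => /eig_B0P[[_ + _ _] _ _ _].
by rewrite opprK scalerN scaleNr.
Qed.

(** The last equation says that the component on the invariant line can be nonzero only for e =
    -1. *)
Lemma block_twoP e Y : block_cond e (-1) Y -> exists b t,
  [/\ b^T = - b, Y = Y_two e b + t *: Y_triv & t = - e * t].
Proof.
move=> [hJ h0 h1]; have [b [c [t [bs cs YE]]]] := eigN1P hJ h1; exists b, (t 0 0).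
move: h0; rewrite YE => /eig_B0P[[h21 _ _ _] _ _ [h43 _ _ _]]; split=> //.
  rewrite /Y_two /Y_triv /blk !scale_block_mx !add_block_mx !simp.
  do 2!congr block_mx; rewrite ?scaleNr -?h21 ?opprK//.
    by apply/matrixP => i j; rewrite !mxE !ord1 mulr1.
  by apply/matrixP => i j; rewrite !mxE !ord1 mulr1.
have /matrixP/(_ 0 0) := h43; rewrite !mxE => E.
by rewrite mulNr -E opprK.
Qed.

Lemma block_oneP e Y : block_cond e im Y -> exists v, Y = Y_one e v.
Proof.
move=> [hJ h0 h1]; have [v [w YE]] := eigimP hJ h1; exists v.
move: h0; rewrite YE => /eig_B0P[_ [h23 _ _ _] _ _].
have -> : w = - e *: v by rewrite scaleNr -h23 opprK.
rewrite /Y_one; congr blk; rewrite linearZ /= scalerA; congr (_ *: _).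
by rewrite mulrNN mulrC.
Qed.

Lemma block_threeP e Y : e * e = 1 -> block_cond e (- im) Y -> exists v, Y = Y_three e v.
Proof.
move=> e2 [hJ h0 h1]; have [v [w YE]] := eigNimP hJ h1; exists v.
move: h0; rewrite YE => /eig_B0P[_ [_ h24 _ _] _ _].
have -> : w = e *: v by rewrite -[w]opprK h24 scalerN opprK.
by rewrite /Y_three; congr blk; rewrite linearZ /= scalerA mulrC.
Qed.

End Blocks.

(** For the frame the two sizes (d + d) + (1 + 1) and n + n are equal but not convertible, so its
    matrices are rectangular as far as typing goes. *)
Lemma mulmx1C_rect (K : fieldType) m n (A : 'M[K]_(m, n)) (B : 'M_(n, m)) :
  m = n -> A *m B = 1%:M -> B *m A = 1%:M.
Proof. by move=> E; subst n; apply: mulmx1C. Qed.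

Section AdMul.
Variables (K : fieldType) (N : nat).
Implicit Types A B X : 'M[K]_N.

Lemma AdP A X Y : A \in unitmx -> Ad A X = Y <-> A *m X = Y *m A.
Proof.
move=> Au; rewrite AdE; split=> [<-|->]; first by rewrite mulmxKV.
by rewrite mulmxK.
Qed.

Lemma Ad_mul A B X : A \in unitmx -> B \in unitmx -> Ad A (Ad B X) = Ad (A *m B) X.
Proof.
move=> Au Bu; apply/esym/AdP; first by rewrite unitmx_mul Au.
by rewrite !AdE !mulmxA !mulmxKV.
Qed.

Lemma Ad_scalar c X : c != 0 -> Ad (c%:M) X = X.
Proof.
move=> c0; apply/AdP; last by rewrite scalar_mxC.
by rewrite unitmxE det_scalar unitrX// unitfE.
Qed.

Lemma AdN A X : A \in unitmx -> Ad (- A) X = Ad A X.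
Proof.
move=> Au; apply/AdP; first by rewrite -scaleN1r unitmxZ ?unitrN1.
by rewrite mulmxN mulNmx AdE mulmxKV.
Qed.

Lemma AdK A X : A \in unitmx -> Ad (invmx A) (Ad A X) = X.
Proof. by move=> Au; rewrite Ad_mul ?unitmx_inv// mulVmx// Ad_scalar ?oner_neq0. Qed.

Lemma Ad_invK A X : A \in unitmx -> Ad A (Ad (invmx A) X) = X.
Proof. by move=> Au; rewrite -{1}[A]invmxK AdK ?unitmx_inv. Qed.

Lemma Ad_eigP A X e : A \in unitmx -> Ad A X = e *: X <-> A *m X = e *: (X *m A).
Proof. by move=> Au; rewrite AdP// scalemxAl. Qed.

End AdMul.

Section FormAlgebra.
Variables (K : fieldType) (N : nat) (J A : 'M[K]_N) (g : {vspace 'M[K]_N}).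
Hypotheses (gP : forall X, X \in g <-> X^T *m J = - (J *m X))
  (Au : A \in unitmx) (AJ : A^T *m J *m A = - J).

Let Ad_form (B X : 'M[K]_N) : B \in unitmx -> B^T *m J *m B = - J -> X \in g -> Ad B X \in g.
Proof.
move=> Bu BJ /gP hX; apply/gP; rewrite AdE !trmx_mul.
have BJ1 : B^T *m J = - (J *m invmx B) by rewrite -mulNmx -BJ mulmxK.
have BtU : B^T \in unitmx by rewrite unitmx_tr.
have BJ2 : (invmx B)^T *m J = - (J *m B).
  by apply: (can_inj (mulKmx BtU)); rewrite trmx_inv mulKVmx// mulmxN mulmxA BJ opprK.
rewrite -!mulmxA BJ1 !mulmxN !mulmxA; congr (- _).
by rewrite -(mulmxA (invmx B)^T) hX mulmxN mulNmx mulmxA BJ2 !mulNmx opprK.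
Qed.

(** [A] reverses the sign of the form, which leaves the condition X^T J = - J X unchanged. *)
Lemma Ad_automorphism : lie_automorphism g (Ad A).
Proof.
have Iu : invmx A \in unitmx by rewrite unitmx_inv.
have IJ : (invmx A)^T *m J *m invmx A = - J.
  rewrite -[J in LHS]opprK -AJ mulmxN mulNmx !mulmxA -trmx_mul mulmxV// trmx1 mul1mx.
  by rewrite mulmxK.
split.
- apply/eqP; rewrite eqEsubv; apply/andP; split; apply/subvP => X.
    by move=> /memv_imgP[Y Yg ->]; apply: Ad_form.
  move=> Xg; rewrite -(Ad_invK X Au).
  by apply: memv_img; apply: Ad_form.
- by move=> X Y _ _ E; rewrite -[X](AdK _ Au) E AdK.
- by move=> X Y _ _; rewrite !AdE conj_lie.
Qed.

End FormAlgebra.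

Section BlockRelations.
Variables (K : numFieldType) (d : nat) (im : K).
Hypothesis im2 : im * im = -1.
Let simp := (trmx0, trmx1, mulmx0, mul0mx, addr0, add0r, mulmx1, mul1mx, mulNmx, mulmxN, oppr0).

Let B0E : B0 K d = block_mx (block_mx 0 (- 1%:M) 1%:M 0) 0 0 (block_mx 0 (- 1%:M) 1%:M 0).
Proof. by rewrite /B0 /blk !block_mx0. Qed.
Let B1E : B1 d im = block_mx (block_mx 1%:M 0 0 (- 1%:M)) 0 0 (block_mx im%:M 0 0 (- im%:M)).
Proof. by rewrite /B1 /blk !block_mx0. Qed.
Let BJE : BJ K d = block_mx (block_mx 0 1%:M 1%:M 0) 0 0 (block_mx 2%:M 0 0 (- 2%:M)).
Proof. by rewrite /BJ /blk !block_mx0. Qed.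

Lemma B0_sqr : B0 K d *m B0 K d = - 1%:M.
Proof.
rewrite B0E mulmx_block ?simp ?opprK ?mulmx_block ?simp ?opprK !scalar_mx_block.
by rewrite !opp_block_mx !simp ?opprK.
Qed.

Lemma B1_four : B1 d im *m B1 d im *m (B1 d im *m B1 d im) = 1%:M.
Proof.
have -> : B1 d im *m B1 d im = block_mx 1%:M 0 0 (- 1%:M).
  rewrite B1E mulmx_block ?simp ?opprK ?mulmx_block ?simp ?opprK -scalar_mxM im2 raddfN /= !scalar_mx_block.
  by rewrite !opp_block_mx !simp ?opprK.
by rewrite mulmx_block ?simp ?opprK -scalar_mx_block.
Qed.

(** The matrices only anticommute; the sign disappears under Ad, so that the automorphisms
    commute. *)
Lemma B01_anticomm : B0 K d *m B1 d im = - (B1 d im *m B0 K d).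
Proof.
rewrite B0E B1E 2!mulmx_block ?simp ?opprK 4!mulmx_block ?simp ?opprK.
by rewrite !opp_block_mx ?simp ?opprK.
Qed.

Lemma B0_form : (B0 K d)^T *m BJ K d *m B0 K d = - BJ K d.
Proof.
rewrite B0E BJE tr_block_mx !tr_block_mx !simp ?opprK !(linearN trmx) /= !trmx1.
rewrite mulmx_block ?simp ?opprK mulmx_block ?simp ?opprK 2!mulmx_block ?simp ?opprK 2!mulmx_block ?simp ?opprK.
by rewrite !opp_block_mx !simp ?opprK.
Qed.

Lemma B1_form : (B1 d im)^T *m BJ K d *m B1 d im = - BJ K d.
Proof.
rewrite B1E BJE tr_block_mx !tr_block_mx !simp ?opprK !(linearN trmx) /= !tr_scalar_mx.
rewrite mulmx_block ?simp ?opprK mulmx_block ?simp ?opprK 2!mulmx_block ?simp ?opprK 2!mulmx_block ?simp ?opprK.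
rewrite !opp_block_mx !simp ?opprK -!scalar_mxM.
have -> : im * 2 * im = - 2 by rewrite mulrAC im2 mulN1r.
by rewrite raddfN /= !opprK.
Qed.

End BlockRelations.

(** * Transport of the block forms along a change of basis *)

Section Frame.
Variables (K : numFieldType) (d : nat) (im : K).
Hypothesis im2 : im * im = -1.
Local Notation M := 'M[K]_d.
Local Notation n4 := ((d + d) + (1 + 1))%N.
Variables (N : nat) (F : 'M[K]_(N, n4)) (D : 'M[K]_(n4, N)) (A0 A1 J : 'M[K]_N).
Hypotheses (FD : F *m D = 1%:M) (DF : D *m F = 1%:M)
  (A0F : A0 *m F = F *m B0 K d) (A1F : A1 *m F = F *m B1 d im) (FJF : F^T *m J *m F = BJ K d).

Definition frame_fun (V : vectType K) (f : {linear V -> 'M[K]_n4}) v := F *m f v *m D.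

Lemma frame_fun_linear (V : vectType K) (f : {linear V -> 'M[K]_n4}) : linear (frame_fun f).
Proof.
move=> k u v.
by rewrite /frame_fun linearP mulmxDr mulmxDl -scalemxAr -scalemxAl.
Qed.
HB.instance Definition _ (V : vectType K) f :=
  GRing.isLinear.Build K V 'M[K]_N _ (@frame_fun V f) (@frame_fun_linear V f).

Definition frame_map (V : vectType K) (f : {linear V -> 'M[K]_n4}) : 'Hom(V, 'M[K]_N) :=
  linfun (frame_fun f).

Lemma frame_mapE (V : vectType K) (f : {linear V -> 'M[K]_n4}) v : frame_map f v = F *m f v *m D.
Proof. by rewrite lfunE. Qed.

Lemma frame_inj Y Z : F *m Y *m D = F *m Z *m D -> Y = Z.
Proof.
move=> /(congr1 (fun X => D *m X *m F)); rewrite !mulmxA !DF !mul1mx -!mulmxA !DF.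
by rewrite !mulmx1.
Qed.

Lemma frame_map_inj (V : vectType K) (f : {linear V -> 'M[K]_n4}) : injective f -> lker (frame_map f) == 0%VS.
Proof. by move=> fI; apply/lker0P => u v; rewrite !frame_mapE => /frame_inj/fI. Qed.

Lemma lie_frame Y Z : lie (F *m Y *m D) (F *m Z *m D) = F *m lie Y Z *m D.
Proof.
rewrite /lie mulmxBr mulmxBl; congr (_ - _); rewrite !mulmxA -[_ *m D *m F]mulmxA DF mulmx1//.
Qed.

Lemma frame_cond e e' X :
  [/\ X^T *m J = - (J *m X), A0 *m X = e *: (X *m A0) & A1 *m X = e' *: (X *m A1)] <->
  block_cond im e e' (D *m X *m F).
Proof.
have XF : X *m F = F *m (D *m X *m F) by rewrite !mulmxA FD mul1mx.
have FI (Z Z' : 'M[K]_N) : Z *m F = Z' *m F -> Z = Z'.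
  by move=> E; rewrite -[Z]mulmx1 -[Z']mulmx1 -FD !mulmxA E.
have FtI (Z Z' : 'M[K]_(N, n4)) : F^T *m Z = F^T *m Z' -> Z = Z'.
  move=> E; rewrite -[Z]mul1mx -[Z']mul1mx -(trmx1 _ N) -FD trmx_mul -!mulmxA E.
  by [].
have DI (Z Z' : 'M[K]_n4) : F *m Z = F *m Z' -> Z = Z'.
  by move=> E; rewrite -[Z]mul1mx -[Z']mul1mx -DF -!mulmxA E.
set Y := D *m X *m F in XF *.
have h1 : F^T *m (X^T *m J *m F) = Y^T *m BJ K d.
  by rewrite -FJF !mulmxA -trmx_mul XF trmx_mul.
have h2 : F^T *m (- (J *m X) *m F) = - (BJ K d *m Y).
  by rewrite mulNmx mulmxN -mulmxA XF !mulmxA FJF.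
have h3 (A : 'M[K]_N) B c : A *m F = F *m B -> (A *m X = c *: (X *m A)) <-> eig B c Y.
  move=> AF; have a1 : A *m X *m F = F *m (B *m Y) by rewrite -mulmxA XF !mulmxA AF.
  have a2 : c *: (X *m A) *m F = F *m (c *: (Y *m B)).
    rewrite -scalemxAl -[X *m A *m F]mulmxA AF [X *m (F *m B)]mulmxA XF -scalemxAr.
    by rewrite -[F *m Y *m B]mulmxA.
  split=> [E|E]; first by apply: DI; rewrite -a1 E a2.
  by apply: FI; rewrite a1 E a2.
split=> -[c1 c2 c3]; split; try exact/(h3 _ _ _ A0F); try exact/(h3 _ _ _ A1F).
  by rewrite /skewJ -h1 c1 h2.
by apply: FI; apply: FtI; rewrite h1 h2.
Qed.

Variable G : {vspace 'M[K]_N}.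
(** The eigenvalue equation for Ad A is multiplied out to A X = e X A, which passes through the
    change of basis without inverses. *)
Definition graded_by e e' := forall X, X \in G <->
  [/\ X^T *m J = - (J *m X), A0 *m X = e *: (X *m A0) & A1 *m X = e' *: (X *m A1)].

Let FDF Y : D *m (F *m Y *m D) *m F = Y.
Proof. by rewrite !mulmxA DF mul1mx -mulmxA DF mulmx1. Qed.

Let XE X : X = F *m (D *m X *m F) *m D.
Proof. by rewrite !mulmxA FD mul1mx -mulmxA FD mulmx1. Qed.

Let one1 : 1 * 1 = 1 :> K. Proof. by rewrite mulr1. Qed.
Let N1N1 : (-1) * (-1) = 1 :> K. Proof. by rewrite mulrNN mulr1. Qed.

Local Notation even := (frame_map (@Y_even K d)).
Local Notation two e := (frame_map (@Y_two K d e)).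
Local Notation one e := (frame_map (@Y_one K d e)).
Local Notation three e := (frame_map (@Y_three K d e)).

Lemma graded_even_skew : graded_by 1 1 -> G = (even @: skewv K d)%VS.
Proof.
move=> GP; apply/vspaceP => X; apply/idP/idP.
  move=> /GP/frame_cond/(block_evenP im2)[a [E as_]]; rewrite (XE X) E -frame_mapE memv_img//.
  by apply/skewvP; rewrite as_ scaleN1r.
move=> /memv_imgP[a /skewvP as_ ->]; apply/GP/frame_cond; rewrite frame_mapE FDF.
by apply: block_cond_even => //; rewrite as_ scaleN1r.
Qed.

Lemma graded_even_sym : graded_by (-1) 1 -> G = (even @: symv K d)%VS.
Proof.
move=> GP; apply/vspaceP => X; apply/idP/idP.
  move=> /GP/frame_cond/(block_evenP im2)[a [E as_]]; rewrite (XE X) E -frame_mapE memv_img//.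
  by apply/symvP; rewrite as_ opprK scale1r.
move=> /memv_imgP[a /symvP as_ ->]; apply/GP/frame_cond; rewrite frame_mapE FDF.
by apply: block_cond_even => //; rewrite as_ opprK scale1r.
Qed.

Lemma graded_two : graded_by 1 (-1) -> G = (two 1 @: skewv K d)%VS.
Proof.
move=> GP; apply/vspaceP => X; apply/idP/idP.
  move=> /GP/frame_cond/(block_twoP im2)[b [t [bs E t0]]].
  have {}t0 : t = 0.
    by apply/eqP; move/eqP: t0; rewrite mulN1r -addr_eq0 -mulr2n mulrn_eq0.
  rewrite (XE X) E t0 scale0r addr0 -frame_mapE memv_img//.
  exact/skewvP.
move=> /memv_imgP[a /skewvP as_ ->]; apply/GP/frame_cond; rewrite frame_mapE FDF.
exact: block_cond_two.
Qed.

Definition triv_elt : 'M[K]_N := F *m Y_triv K d *m D.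

Lemma graded_two_triv : graded_by (-1) (-1) ->
  G = (two (-1) @: skewv K d + <[triv_elt]>)%VS.
Proof.
move=> GP; apply/vspaceP => X; apply/idP/idP.
  move=> /GP/frame_cond/(block_twoP im2)[b [t [bs E _]]].
  rewrite (XE X) E mulmxDr mulmxDl -frame_mapE -scalemxAr -scalemxAl.
  by rewrite memv_add ?memvZ ?memv_line// memv_img//; apply/skewvP.
move=> /memv_addP[_ /memv_imgP[a /skewvP as_ ->] [_ /vlineP[t ->] ->]].
rewrite memvD ?memvZ//; apply/GP/frame_cond; rewrite ?frame_mapE FDF.
  exact: block_cond_two.
exact: block_cond_triv.
Qed.

Lemma graded_one e : e * e = 1 -> graded_by e im -> G = (one e @: fullv)%VS.
Proof.
move=> e2 GP; apply/vspaceP => X; apply/idP/idP.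
  by move=> /GP/frame_cond/(block_oneP im2)[v E]; rewrite (XE X) E -frame_mapE memv_img ?memvf.
move=> /memv_imgP[v _ ->]; apply/GP/frame_cond; rewrite frame_mapE FDF.
exact: block_cond_one.
Qed.

Lemma graded_three e : e * e = 1 -> graded_by e (- im) -> G = (three e @: fullv)%VS.
Proof.
move=> e2 GP; apply/vspaceP => X; apply/idP/idP.
  by move=> /GP/frame_cond/(block_threeP im2 e2)[v E]; rewrite (XE X) E -frame_mapE memv_img ?memvf.
move=> /memv_imgP[v _ ->]; apply/GP/frame_cond; rewrite frame_mapE FDF.
exact: block_cond_three.
Qed.

Lemma lie_even a b : lie (even a) (even b) = even (lie a b).
Proof. by rewrite !frame_mapE lie_frame /= lie_Y_even. Qed.

Lemma lie_even_two e a b : a \in skewv K d -> lie (even a) (two e b) = two e (lie a b).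
Proof. by move=> /skewvP as_; rewrite !frame_mapE lie_frame /= lie_Y_two. Qed.

Lemma lie_even_one e a v : a \in skewv K d -> lie (even a) (one e v) = one e (a *m v).
Proof. by move=> /skewvP as_; rewrite !frame_mapE lie_frame /= lie_Y_one. Qed.

Lemma lie_even_three e a v : a \in skewv K d -> lie (even a) (three e v) = three e (a *m v).
Proof. by move=> /skewvP as_; rewrite !frame_mapE lie_frame /= lie_Y_three. Qed.

Lemma lie_even_triv a : lie (even a) triv_elt = 0.
Proof. by rewrite frame_mapE lie_frame lie_Y_triv mulmx0 mul0mx. Qed.

Lemma even_injective : lker even == 0%VS.
Proof. exact/frame_map_inj/Y_even_inj. Qed.
Lemma two_injective e : lker (two e) == 0%VS.
Proof. exact/frame_map_inj/Y_two_inj. Qed.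
Lemma one_injective e : lker (one e) == 0%VS.
Proof. exact/frame_map_inj/Y_one_inj. Qed.
Lemma three_injective e : lker (three e) == 0%VS.
Proof. exact/frame_map_inj/Y_three_inj. Qed.

Lemma triv_elt_notin e : e != 0 -> triv_elt \notin (two e @: skewv K d)%VS.
Proof.
move=> e0; apply/memv_imgP => -[b _]; rewrite frame_mapE => /frame_inj/eq_blk[_ _ _ [_ E _ _]].
by have /matrixP/(_ 0 0)/eqP := E; rewrite !mxE oner_eq0.
Qed.

(** The diagonal blocks a and -a^T contribute equal traces. *)
Lemma trace_even a b : \tr (even a *m even b) = 2 * \tr (a *m b).
Proof.
have -> : even a *m even b = F *m (Y_even a *m Y_even b *m D).
  by rewrite !frame_mapE !mulmxA -[_ *m D *m F]mulmxA DF mulmx1.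
rewrite mxtrace_mulC -[_ *m D *m F]mulmxA DF mulmx1 /Y_even /blk !mulmx_block !mxtrace_block.
rewrite !add_block_mx !(mulmx0, mul0mx, addr0, add0r, mulNmx, mulmxN, opprK).
rewrite !mxtrace_block !mxtrace0 !addr0 -trmx_mul mxtrace_tr [\tr (b *m a)]mxtrace_mulC.
ring.
Qed.

Lemma frame_A0_sqr : A0 *m A0 = - 1%:M.
Proof.
have -> : A0 *m A0 = (A0 *m A0) *m F *m D by rewrite -mulmxA FD mulmx1.
rewrite -(mulmxA A0 A0) A0F mulmxA A0F -(mulmxA F) B0_sqr.
by rewrite mulmxN mulmx1 mulNmx FD.
Qed.

Lemma frame_A1_four : A1 *m A1 *m (A1 *m A1) = 1%:M.
Proof.
have -> : A1 *m A1 *m (A1 *m A1) = A1 *m (A1 *m (A1 *m (A1 *m F))) *m D.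
  by rewrite -[LHS]mulmx1 -FD !mulmxA.
rewrite A1F (mulmxA A1 F) A1F -(mulmxA F) (mulmxA A1 F) A1F -(mulmxA F) (mulmxA A1 F) A1F.
by rewrite -(mulmxA F) [B1 d im *m (_ *m _)]mulmxA (B1_four d im2) mulmx1 FD.
Qed.

Lemma frame_anticomm : A0 *m A1 = - (A1 *m A0).
Proof.
have -> : A0 *m A1 = A0 *m (A1 *m F) *m D by rewrite -!mulmxA FD mulmx1.
have -> : A1 *m A0 = A1 *m (A0 *m F) *m D by rewrite -!mulmxA FD mulmx1.
rewrite A1F A0F !mulmxA A1F A0F -!(mulmxA F) B01_anticomm.
by rewrite mulNmx mulmxN.
Qed.

Let form_conj A B : A *m F = F *m B -> B^T *m BJ K d *m B = - BJ K d -> A^T *m J *m A = - J.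
Proof.
move=> AF BB.
have JE (Z : 'M[K]_N) : Z = D^T *m (F^T *m Z *m F) *m D.
  by rewrite !mulmxA -trmx_mul FD trmx1 mul1mx -mulmxA FD mulmx1.
rewrite [LHS]JE [RHS]JE; congr (_ *m _ *m _).
rewrite mulmxN mulNmx FJF -BB -FJF !mulmxA -!trmx_mul -AF -!mulmxA AF.
by rewrite !mulmxA.
Qed.

Lemma frame_A0_form : A0^T *m J *m A0 = - J.
Proof. exact: (form_conj A0F (B0_form _ _)). Qed.

Lemma frame_A1_form : A1^T *m J *m A1 = - J.
Proof. exact: (form_conj A1F (B1_form d im2)). Qed.

End Frame.

(** * The matrices of the two automorphisms *)

Definition swap_mx (K : fieldType) n : 'M[K]_(n + n) := block_mx 0 1%:M 1%:M 0.

(** The block description of so(2n) becomes invariance under a split symmetric form, the shape in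
    which conjugation is easily followed. *)
Lemma so_even_form (K : fieldType) n (X : 'M[K]_(n + n)) :
  X \in so_even K n <-> X^T *m swap_mx K n = - (swap_mx K n *m X).
Proof.
rewrite -[X]submxK; move: (ulsubmx X) (ursubmx X) (dlsubmx X) (drsubmx X) => a b c e.
have -> : (block_mx a b c e)^T *m swap_mx K n = block_mx c^T a^T e^T b^T.
  by rewrite tr_block_mx mulmx_block !(mulmx0, mulmx1, addr0, add0r).
have -> : - (swap_mx K n *m block_mx a b c e) = block_mx (- c) (- e) (- a) (- b).
  by rewrite mulmx_block !(mul0mx, mul1mx, addr0, add0r) opp_block_mx.
split=> [/so_evenP[a' [b' [c' [/eq_block_mx[-> -> -> ->] hb hc]]]]|/eq_block_mx[hc he ha hb]].
  by rewrite hb hc linearN /= trmxK opprK.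
by apply/so_evenP; exists a, b, c; split=> //; rewrite he opprK.
Qed.

Lemma swap_mxE (K : fieldType) n (r s : 'I_(n + n)) : swap_mx K n r s = ((s == r + n :> nat) || (r == s + n :> nat))%N%:R.
Proof.
case: (split_ordP r) => r' ->; case: (split_ordP s) => s' -> /=;
  rewrite ?block_mxEul ?block_mxEur ?block_mxEdl ?block_mxEdr ?mxE;
  have := ltn_ord r'; have := ltn_ord s' => H1 H2.
- by rewrite [(_ || _)](_ : _ = false)//; lia.
- by congr (nat_of_bool _)%:R; rewrite -val_eqE /=; apply/idP/idP; lia.
- by congr (nat_of_bool _)%:R; rewrite -val_eqE /=; apply/idP/idP; lia.
- by rewrite [(_ || _)](_ : _ = false)//; lia.
Qed.

Section ConcreteFrame.
Variables (K : numFieldType) (im : K) (l : nat).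
Hypothesis im2 : im * im = -1.
Local Notation d := (2 * l).+1.
Local Notation n := (2 * l + 2)%N.
Local Notation N := (n + n)%N.
Local Notation n4 := ((d + d) + (1 + 1))%N.
Local Notation E := (@Defs.E K N).

Definition big_A0 : 'M[K]_N :=
  E (2 * l + 2) (4 * l + 4) - E (4 * l + 4) (2 * l + 2)
  + \sum_(1 <= j < (2 * l + 1).+1)
      ((-1) ^+ j *: E (4 * l + 4 - j) j
       - (-1) ^+ j *: E (2 * l + 2 - j) (2 * l + 2 + j)).

Definition big_A1 : 'M[K]_N :=
  im *: E (2 * l + 2) (4 * l + 4) + im *: E (4 * l + 4) (2 * l + 2)
  + \sum_(1 <= j < (2 * l + 1).+1) (E j j - E (2 * l + 2 + j) (2 * l + 2 + j)).

Local Notation J := (swap_mx K n).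

(** Its columns are the coordinate vectors with 0-based indices a, ..., a+m-1. *)
Definition sh a m : 'M[K]_(N, m) := \matrix_(r, c) ((r : nat) == a + c)%N%:R.

Lemma mul_shE m' (A : 'M[K]_(m', N)) a m r (c : 'I_m) (ac : (a + c < N)%N) :
  (A *m sh a m) r c = A r (Ordinal ac).
Proof.
rewrite mxE (bigD1 (Ordinal ac)) //= mxE eqxx mulr1 big1 ?addr0// => k kN.
rewrite mxE; case: eqP => [E|]; last by rewrite mulr0.
by case/eqP: kN; apply/val_inj.
Qed.

Lemma sh_orth a m b m' : (b + m' <= N)%N ->
  (sh a m)^T *m sh b m' = \matrix_(r, c) (a + r == b + c)%N%:R.
Proof.
move=> bN; apply/matrixP => r c; have ac : (b + c < N)%N by have := ltn_ord c; lia.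
by rewrite mul_shE !mxE /= eq_sym.
Qed.

Lemma sh_orth1 a m : (a + m <= N)%N -> (sh a m)^T *m sh a m = 1%:M.
Proof. by move=> aN; rewrite sh_orth//; apply/matrixP => r c; rewrite !mxE eqn_add2l. Qed.

Lemma sh_orth0 a m b m' : (b + m' <= N)%N -> (a + m <= b)%N || (b + m' <= a)%N ->
  (sh a m)^T *m sh b m' = 0.
Proof.
move=> bN ab; rewrite sh_orth//; apply/matrixP => r c; rewrite !mxE.
by case: eqP => // E; have := ltn_ord r; have := ltn_ord c; lia.
Qed.

Let sum_pick (F : nat -> K) (s : nat) : (forall j, (1 <= j <= d)%N -> j != s -> F j = 0) ->
  \sum_(1 <= j < (2 * l + 1).+1) F j = if (1 <= s <= d)%N then F s else 0.
Proof.
move=> F0; case: ifP => sd; last first.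
  rewrite big_nat_cond big1// => j /andP[jd _]; apply: F0; first by lia.
  by apply: contraFneq sd => <-; lia.
rewrite (big_cat_nat _ (n := s))/=; [|lia|lia].
rewrite big_nat_cond big1 ?add0r; last by move=> j /andP[jd _]; apply: F0; lia.
rewrite big_ltn; last by lia.
rewrite big_nat_cond big1 ?addr0// => j /andP[jd _]; apply: F0; lia.
Qed.

(** The matrix units are 1-based and ordinals 0-based: positions 2l+2 and 4l+4 become 2l+1 and
    4l+3. *)
Lemma big_A1E (r s : 'I_N) : big_A1 r s =
  im * ((r == 2 * l + 1 :> nat) && (s == 4 * l + 3 :> nat))%N%:R +
  im * ((r == 4 * l + 3 :> nat) && (s == 2 * l + 1 :> nat))%N%:R +
  ((r == s) && (r < d)%N)%:R - ((r == s) && (n <= r < n + d)%N)%:R.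
Proof.
rewrite /big_A1 mxE [X in X + _]mxE summxE.
under eq_bigr do rewrite !mxE.
rewrite !mxE -[RHS]addrA; congr (_ + _).
  by congr (_ * _ + _ * _); congr (nat_of_bool _)%:R; apply/idP/idP; lia.
rewrite big_split /= (sum_pick (s := s.+1)); last by move=> j jd js; rewrite [X in _ && X](_ : _ = false) ?andbF//; lia.
rewrite (sum_pick (s := (s.+1 - n)%N)); last first.
  by move=> j jd js; rewrite [X in _ && X](_ : _ = false) ?andbF ?oppr0//; lia.
have rs : (r == s) = (r == s :> nat) by [].
rewrite rs; congr (_ + _).
  case: ifP => sd.
    by congr (nat_of_bool _)%:R; apply/idP/idP; lia.
  by rewrite [RHS](_ : _ = 0)//; case: andP => // -[]; lia.
case: ifP => sd.
  by congr (- (nat_of_bool _)%:R); apply/idP/idP; lia.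
by case: andP => [[]|]; rewrite ?oppr0//; lia.
Qed.

Lemma big_A0E (r s : 'I_N) : big_A0 r s =
  ((r == 2 * l + 1 :> nat) && (s == 4 * l + 3 :> nat))%N%:R -
  ((r == 4 * l + 3 :> nat) && (s == 2 * l + 1 :> nat))%N%:R +
  (-1) ^+ s.+1 * ((r + s == 4 * l + 2)%N && (s < d)%N)%:R -
  (-1) ^+ s.+1 * ((r + s == 4 * l + 2)%N && (n <= s < n + d)%N)%:R.
Proof.
rewrite /big_A0 mxE [X in X + _]mxE summxE.
under eq_bigr do rewrite !mxE.
rewrite !mxE -[RHS]addrA; congr (_ + _).
  by congr (_ - _); congr (nat_of_bool _)%:R; apply/idP/idP; lia.
rewrite big_split /= (sum_pick (s := s.+1)); last first.
  by move=> j jd js; rewrite [X in _ && X](_ : _ = false) ?andbF ?mulr0//; lia.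
rewrite (sum_pick (s := (s.+1 - n)%N)); last first.
  by move=> j jd js; rewrite [X in _ && X](_ : _ = false) ?andbF ?mulr0 ?oppr0//; lia.
congr (_ + _).
  case: ifP => sd.
    by congr (_ * (nat_of_bool _)%:R); apply/idP/idP; lia.
  by rewrite [X in _ = _ * X](_ : _ = 0) ?mulr0//; case: andP => // -[]; lia.
case: ifP => sd.
  (* n = 2l+2 is even, so the shift by n does not affect the sign. *)
  have -> : (-1) ^+ s.+1 = (-1) ^+ (s.+1 - n) :> K.
    rewrite -signr_odd -[RHS]signr_odd; congr (_ ^+ nat_of_bool _); lia.
  by congr (- (_ * (nat_of_bool _)%:R)); apply/idP/idP; lia.
by case: andP => [[]|]; rewrite ?mulr0 ?oppr0//; lia.
Qed.

(** The signed antidiagonal block through which the first matrix exchanges the two groups of d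
    coordinates. It is a symmetric involution because d - 1 is even. *)
Definition Theta : 'M[K]_d := \matrix_(k, c) ((-1) ^+ c.+1 * (k == rev_ord c)%:R).

Lemma sh_Theta a r c : (sh a d *m Theta) r c = (-1) ^+ c.+1 * ((r : nat) + c == a + 2 * l)%N%:R.
Proof.
rewrite mxE (bigD1 (rev_ord c)) //= !mxE eqxx mulr1 mulrC big1 ?addr0 => [|k kc].
  by congr (_ * (nat_of_bool _)%:R); apply/idP/idP => /=; have := ltn_ord c; lia.
by rewrite !mxE (negbTE kc) !mulr0.
Qed.

Lemma Theta_sym : Theta^T = Theta.
Proof.
apply/matrixP => i j; rewrite !mxE; have [E|ij] := eqVneq i (rev_ord j).
  rewrite E rev_ordK eqxx !mulr1 -signr_odd -[RHS]signr_odd; congr (_ ^+ nat_of_bool _) => /=.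
  by have := ltn_ord j; lia.
by rewrite [_ == rev_ord i](_ : _ = false) ?mulr0//; apply: contraNF ij => /eqP->; rewrite rev_ordK.
Qed.

Lemma Theta_sqr : Theta *m Theta = 1%:M.
Proof.
apply/matrixP => i j; rewrite mxE (bigD1 (rev_ord j)) //= !mxE rev_ordK eqxx mulr1 big1 => [|k kj].
  rewrite addr0 mulrAC -exprD -signr_odd.
  rewrite [odd _](_ : _ = false) ?mul1r//=; first by have := ltn_ord j; lia.
by rewrite !mxE (negbTE kj) !mulr0.
Qed.

Local Notation S1 := (sh 0 d).
Local Notation S2 := (sh n d).
Local Notation s3 := (sh n.-1 1).
Local Notation s4 := (sh (n + n).-1 1).

Let bound a m (c : 'I_m) : (a + m <= N)%N -> (a + c < N)%N.
Proof. by have := ltn_ord c; lia. Qed.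

Let b1 : (0 + d <= N)%N. Proof. lia. Qed.
Let b2 : (n + d <= N)%N. Proof. lia. Qed.
Let b3 : (n.-1 + 1 <= N)%N. Proof. lia. Qed.
Let b4 : (N.-1 + 1 <= N)%N. Proof. lia. Qed.

Let nb (b c : bool) : b = c -> b%:R = c%:R :> K. Proof. by move=> ->. Qed.
Let n0 (b : bool) : b = false -> b%:R = 0 :> K. Proof. by move=> ->. Qed.

Lemma J_sh : [/\ J *m S1 = S2, J *m S2 = S1, J *m s3 = s4 & J *m s4 = s3].
Proof.
split; apply/matrixP => r c; have := ltn_ord c; have := ltn_ord r => rN cN;
  rewrite (mul_shE _ _ (bound c _)) ?swap_mxE ?mxE /=; try lia; apply: nb; lia.
Qed.

Lemma A1_sh : [/\ big_A1 *m S1 = S1, big_A1 *m S2 = - S2,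
  big_A1 *m s3 = im *: s4 & big_A1 *m s4 = im *: s3].
Proof.
split; apply/matrixP => r c; have := ltn_ord c; have := ltn_ord r => rN cN;
  rewrite (mul_shE _ _ (bound c _)) ?big_A1E ?mxE -?val_eqE /=; try lia.
- rewrite [in X in X + _ + _ - _]n0; last lia.
  rewrite [in X in _ + X + _ - _]n0; last lia.
  rewrite [X in _ + _ + _ - X]n0; last lia.
  by rewrite !mulr0 !add0r subr0; apply: nb; lia.
- rewrite [in X in X + _ + _ - _]n0; last lia.
  rewrite [in X in _ + X + _ - _]n0; last lia.
  rewrite [X in _ + _ + X - _]n0; last lia.
  by rewrite !mulr0 !add0r; congr (- _); apply: nb; lia.
- rewrite [in X in X + _ + _ - _]n0; last lia.
  rewrite [X in _ + _ + X - _]n0; last lia.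
  rewrite [X in _ + _ + _ - X]n0; last lia.
  by rewrite !mulr0 !add0r subr0 addr0; congr (_ * _); apply: nb; lia.
- rewrite [in X in _ + X + _ - _]n0; last lia.
  rewrite [X in _ + _ + X - _]n0; last lia.
  rewrite [X in _ + _ + _ - X]n0; last lia.
  by rewrite !mulr0 subr0 !addr0; congr (_ * _); apply: nb; lia.
Qed.

Lemma A0_sh : [/\ big_A0 *m S1 = S2 *m Theta, big_A0 *m S2 = - (S1 *m Theta),
  big_A0 *m s3 = - s4 & big_A0 *m s4 = s3].
Proof.
split; apply/matrixP => r c; have := ltn_ord c; have := ltn_ord r => rN cN;
  rewrite (mul_shE _ _ (bound c _)) ?big_A0E ?sh_Theta ?[RHS]mxE ?sh_Theta ?mxE -?val_eqE /=; try lia.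
- rewrite [X in X - _ + _ - _]n0; last lia.
  rewrite [X in _ - X + _ - _]n0; last lia.
  rewrite [in X in _ + _ - X]n0; last lia.
  by rewrite !mulr0 !subr0 !add0r; congr (_ * _); apply: nb; lia.
- rewrite [X in X - _ + _ - _]n0; last lia.
  rewrite [X in _ - X + _ - _]n0; last lia.
  rewrite [in X in _ + X - _]n0; last lia.
  rewrite !mulr0 !subr0 !add0r; congr (- (_ * _)); last by apply: nb; lia.
  rewrite -signr_odd -[RHS]signr_odd; congr (_ ^+ nat_of_bool _); lia.
- rewrite [X in X - _ + _ - _]n0; last lia.
  rewrite [in X in _ + X - _]n0; last lia.
  rewrite [in X in _ + _ - X]n0; last lia.
  by rewrite !mulr0 !subr0 !addr0 !add0r; congr (- _); apply: nb; lia.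
- rewrite [X in _ - X + _ - _]n0; last lia.
  rewrite [in X in _ + X - _]n0; last lia.
  rewrite [in X in _ + _ - X]n0; last lia.
  by rewrite !mulr0 !subr0 !addr0; apply: nb; lia.
Qed.

Local Notation Q := (invol_sqrt im Theta).
Let two0 : 2 != 0 :> K. Proof. by rewrite pnatr_eq0. Qed.
Let QQ : Q *m Q = Theta. Proof. exact: invol_sqrtK im2 two0 Theta_sqr. Qed.
Let Qu : Q \in unitmx. Proof. exact: invol_sqrt_unit im2 two0 Theta_sqr. Qed.
Let Qt : Q^T = Q. Proof. exact: invol_sqrt_sym Theta_sym. Qed.
Let Q't : (invmx Q)^T = invmx Q. Proof. by rewrite trmx_inv Qt. Qed.
Let TQ' : Theta *m invmx Q = Q. Proof. by rewrite -{1}QQ mulmxK. Qed.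
Let TQ : Theta *m Q = invmx Q.
Proof. by apply: (can_inj (mulmxK Qu)); rewrite mulVmx// -mulmxA QQ Theta_sqr. Qed.

(* Columns: a hyperbolic basis of C^(4l+4) in which sigma_0 and sigma_1 take the
   block forms B0 and B1; the square root of Theta makes both halves of the
   first block carry the standard form. *)
Definition frame : 'M[K]_(N, n4) :=
  row_mx (row_mx (S1 *m invmx Q) (S2 *m Q)) (row_mx (s3 + s4) (s3 - s4)).

Lemma A0_frame : big_A0 *m frame = frame *m B0 K d.
Proof.
have [h1 h2 h3 h4] := A0_sh.
rewrite /frame /B0 /blk !mul_mx_row mul_row_block !mul_row_block.
rewrite !mulmx0 !addr0 !row_mx0 !addr0 !add0r !mulmxN !mulmx1.
rewrite !mulmxA h1 h2 -!mulmxA TQ' mulNmx -mulmxA TQ mulmxBr mulmxDr h3 h4.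
by rewrite -opprD [- s4 + s3]addrC [s4 + s3]addrC.
Qed.

Lemma A1_frame : big_A1 *m frame = frame *m B1 d im.
Proof.
have [h1 h2 h3 h4] := A1_sh.
rewrite /frame /B1 /blk !mul_mx_row mul_row_block !mul_row_block.
rewrite !mulmx0 !addr0 !row_mx0 !addr0 !add0r !mulmxN !mulmx1 !mul_mx_scalar.
rewrite !mulmxA h1 h2 mulNmx mulmxBr mulmxDr h3 h4 -scalerDr -scalerBr.
by rewrite [s4 + s3]addrC -scalerN opprB.
Qed.

Lemma form_frame : frame^T *m J *m frame = BJ K d.
Proof.
have [h1 h2 h3 h4] := J_sh.
have JF : J *m frame = row_mx (row_mx (S2 *m invmx Q) (S1 *m Q)) (row_mx (s4 + s3) (s4 - s3)).
  by rewrite /frame !mul_mx_row !mulmxA h1 h2 mulmxBr mulmxDr h3 h4.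
rewrite -mulmxA JF /frame.
rewrite !tr_row_mx !mul_col_row /BJ /blk !trmx_mul Qt Q't.
have -> : (s3 + s4)^T = s3^T + s4^T by apply: linearD.
have -> : (s3 - s4)^T = s3^T - s4^T by apply: linearB.
rewrite !(mulmxDl, mulmxDr, mulmxBl, mulmxBr, mulmxN, mulNmx) !mulmxA.
rewrite -![_ *m (sh _ _)^T *m _]mulmxA !sh_orth1 ?sh_orth0; try lia.
rewrite !(mulmx0, mul0mx, mulmx1, addr0, add0r, subr0, sub0r, oppr0, opprK) mulmxV// mulVmx//.
have -> : 2%:M = 1%:M + 1%:M :> 'M[K]_1 by rewrite -raddfD.
by rewrite addNr subrr opprD.
Qed.

(** From F^T J F = BJ the inverse of the frame is BJ^-1 F^T J; the first factor is BJ^-1. *)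
Definition coframe : 'M[K]_(n4, N) :=
  blk 0 1%:M 1%:M 0 0 0 0 0 0 0 0 0 (2^-1)%:M 0 0 (- (2^-1)%:M) *m frame^T *m J.

Lemma coframeK : coframe *m frame = 1%:M.
Proof.
rewrite /coframe -!mulmxA [frame^T *m _]mulmxA form_frame /BJ /blk !block_mx0.
rewrite mulmx_block !(mulmx0, mul0mx, addr0, add0r) !mulmx_block.
rewrite !(mulmx0, mul0mx, addr0, add0r, mulmx1, mulNmx, mulmxN) opprK -!scalar_mxM mulVf//.
by rewrite -!scalar_mx_block.
Qed.

Lemma frameK : frame *m coframe = 1%:M.
Proof. by apply: mulmx1C_rect coframeK; lia. Qed.

End ConcreteFrame.

(** * The Killing form *)

Section KillingForm.
Variables (K : numFieldType) (N : nat) (J : 'M[K]_N) (g : {vspace 'M[K]_N}).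
Local Notation M := 'M[K]_N.
Hypotheses (Jsym : J^T = J) (J2 : J *m J = 1%:M)
  (gP : forall X, X \in g <-> X^T *m J = - (J *m X)).

(** The trace of the operator X -> a X b on the matrix space. *)
Lemma sum_mul_delta (a b : M) : \sum_i \sum_j (a *m delta_mx i j *m b) i j = \tr a * \tr b.
Proof.
rewrite /mxtrace mulr_suml; apply: eq_bigr => i _; rewrite mulr_sumr; apply: eq_bigr => j _.
rewrite mxE (bigD1 j) //= mxE (bigD1 i) //= mxE !eqxx mulr1 big1 ?addr0 => [|k ki].
  rewrite big1 ?addr0// => k kj; rewrite mxE big1 ?mul0r// => m _.
  by rewrite mxE (negbTE kj) andbF mulr0.
by rewrite mxE (negbTE ki) mulr0.
Qed.

(** The trace of the operator X -> a X^T b on the matrix space. *)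
Lemma sum_mul_delta_tr (a b : M) : \sum_i \sum_j (a *m delta_mx j i *m b) i j = \tr (a *m b^T).
Proof.
rewrite /mxtrace; apply: eq_bigr => i _; rewrite mxE; apply: eq_bigr => j _.
rewrite !mxE (bigD1 i) //= mxE (bigD1 j) //= mxE !eqxx mulr1 big1 ?addr0 => [|k kj].
  rewrite big1 ?addr0// => k ki; rewrite mxE big1 ?mul0r// => m _.
  by rewrite mxE (negbTE ki) andbF mulr0.
by rewrite mxE (negbTE kj) mulr0.
Qed.

(** The projection onto [g] along the matrices that are self-adjoint for the form. *)
Definition form_proj (X : M) : M := 2^-1 *: (X - J *m X^T *m J).

Lemma form_proj_linear : linear form_proj.
Proof.
move=> k X Y; rewrite /form_proj linearP /= mulmxDr mulmxDl -scalemxAr -scalemxAl.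
rewrite [k *: (_ *: _)]scalerA [k * _]mulrC -scalerA -scalerDr; congr (_ *: _).
by rewrite scalerBr opprD addrACA.
Qed.
HB.instance Definition _ := GRing.isLinear.Build K M M _ form_proj form_proj_linear.

Let gE X : X \in g -> J *m X^T *m J = - X.
Proof. by move=> /gP E; rewrite -mulmxA E mulmxN mulmxA J2 mul1mx. Qed.

(** The trace of ad x ad y on [g] is that of ad x ad y composed with [form_proj]. The part from X
    gives 2N tr(xy), the terms in tr x and tr y being zero; the part from J X^T J gives 4 tr(xy).
    Half the difference is (N - 2) tr(xy). *)
Lemma killing_form x y : x \in g -> y \in g -> killing g x y = (N%:R - 2) * \tr (x *m y).
Proof.
move=> xg yg.
have lg u v : u \in g -> v \in g -> lie u v \in g.
  move=> /gP hu /gP hv; apply/gP; rewrite /lie linearB /= !trmx_mul mulmxBl mulmxBr.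
  by rewrite -!mulmxA hu hv !mulmxN !mulmxA hu hv !mulNmx !opprK opprB.
have tr0 u : u \in g -> \tr u = 0.
  move=> /gE/(congr1 mxtrace)/eqP.
  by rewrite mxtrace_mulC mulmxA J2 mul1mx mxtrace_tr linearN /= -addr_eq0 -mulr2n mulrn_eq0 /= => /eqP.
have n2 : 2 != 0 :> K by rewrite pnatr_eq0.
rewrite /killing (subspace_trace (p := form_proj) (f := lie x \o lie y)) /=; first last.
- by move=> X Xg; apply: (lg) => //; apply: (lg).
- by move=> X Xg; rewrite /form_proj gE// opprK -mulr2n -scaler_nat scalerA mulVf// scale1r.
- move=> X; apply/gP; rewrite /form_proj linearZ linearB /= !trmx_mul trmxK Jsym.
  rewrite -scalemxAl -scalemxAr -scalerN mulmxBl mulmxBr opprB !mulmxA J2 mul1mx.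
  by rewrite -!mulmxA J2 mulmx1.
have fE X i j : lie x (lie y X) i j =
    (x *m y *m X *m 1%:M) i j - (x *m X *m y) i j - (y *m X *m x) i j + (1%:M *m X *m (y *m x)) i j.
  have -> : lie x (lie y X) = x *m y *m X *m 1%:M - x *m X *m y - y *m X *m x + 1%:M *m X *m (y *m x).
    by rewrite /lie mulmxBr mulmxBl mulmx1 mul1mx !mulmxA opprB addrA addrAC.
  move: (_ *m 1%:M) (x *m X *m y) (y *m X *m x) (1%:M *m X *m _) => a b c e.
  by rewrite !mxE.
have fpE i j : lie x (lie y (form_proj (delta_mx i j))) i j =
    2^-1 * (lie x (lie y (delta_mx i j)) i j - lie x (lie y (J *m delta_mx j i *m J)) i j).
  have lZ u k v : lie u (k *: v) = k *: lie u v :> M by exact: linearZ.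
  have lB u v w : lie u (v - w) = lie u v - lie u w :> M by exact: linearB.
  rewrite /form_proj trmx_delta (lZ y) (lZ x) (lB y) (lB x).
  by move: (lie x (lie y (delta_mx _ _))) (lie x (lie y (_ *m _))) => a b; rewrite !mxE.
under eq_bigr do under eq_bigr do rewrite fpE !fE.
under eq_bigr do rewrite -mulr_sumr.
rewrite -mulr_sumr.
have JJ i j (a b : M) : (a *m (J *m delta_mx j i *m J) *m b) i j = (a *m J *m delta_mx j i *m (J *m b)) i j.
  by rewrite !mulmxA.
under eq_bigr do under eq_bigr do rewrite !JJ.
have sum8 (I : finType) (a b c e a' b' c' e' : I -> K) :
  \sum_j (a j - b j - c j + e j - (a' j - b' j - c' j + e' j)) =
  \sum_j a j - \sum_j b j - \sum_j c j + \sum_j e j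
  - (\sum_j a' j - \sum_j b' j - \sum_j c' j + \sum_j e' j).
  by rewrite sumrB big_split [in X in _ - X]big_split /= !sumrB.
under eq_bigr do rewrite sum8.
rewrite sum8 !sum_mul_delta !sum_mul_delta_tr.
rewrite !mulmx1 mul1mx !trmx_mul Jsym (tr0 x xg) (tr0 y yg) mul0r mxtrace1.
rewrite [\tr (y *m x)]mxtrace_mulC -![_ *m J *m _]mulmxA.
have JtJ u : u \in g -> J *m (u^T *m J) = - u by move=> ug; rewrite mulmxA gE.
rewrite (JtJ x xg) (JtJ y yg) J2 mulmx1 !mulmxN !linearN /= [\tr (y *m x)]mxtrace_mulC.
have -> : \tr (J *m (x^T *m y^T *m J)) = \tr (x *m y).
  by rewrite mxtrace_mulC -[_ *m J *m J]mulmxA J2 mulmx1 -trmx_mul mxtrace_tr mxtrace_mulC.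
by field.
Qed.

End KillingForm.

(** * The graded pieces as modules *)

Section ImageModules.
Variables (K : numFieldType) (d N : nat) (phi : 'Hom('M[K]_d, 'M[K]_N)).
Local Notation skewv := (skewv K d).
Hypothesis (phi_inj : lker phi == 0%VS).

Lemma module_iso_img (W : {vspace 'M[K]_d}) (f f' : 'Hom('M[K]_d, 'M[K]_N)) :
  lker f == 0%VS -> lker f' == 0%VS ->
  {in skewv & W, forall x w, lie x w \in W} ->
  {in skewv & W, forall x w, lie (phi x) (f w) = f (lie x w)} ->
  {in skewv & W, forall x w, lie (phi x) (f' w) = f' (lie x w)} ->
  module_iso (phi @: skewv) (f @: W) (f' @: W).
Proof.
move=> fI f'I stab fl f'l; split.
- apply/lie_submoduleP => _ _ /memv_imgP[x xs ->] /memv_imgP[w ww ->].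
  by rewrite fl// memv_img// stab.
- apply/lie_submoduleP => _ _ /memv_imgP[x xs ->] /memv_imgP[w ww ->].
  by rewrite f'l// memv_img// stab.
have FE w : (f' \o f^-1)%VF (f w) = f' w by rewrite comp_lfunE lker0_lfunK.
exists (f' \o f^-1)%VF; split.
- apply/vspaceP => y; apply/memv_imgP/memv_imgP => -[].
    by move=> _ /memv_imgP[w ww ->] ->; exists w; rewrite ?FE.
  by move=> w ww ->; exists (f w); rewrite ?memv_img ?FE.
- by move=> _ _ /memv_imgP[w _ ->] /memv_imgP[w' _ ->]; rewrite !FE => /(lker0P f'I) ->.
- move=> _ _ /memv_imgP[x xs ->] /memv_imgP[w ww ->].
  by rewrite fl// !FE f'l.
Qed.

Lemma limg_capI (V : vectType K) (f : 'Hom(V, 'M[K]_N)) U W : lker f == 0%VS ->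
  (f @: U :&: f @: W)%VS = (f @: (U :&: W))%VS.
Proof.
move=> fI; apply/eqP; rewrite eqEsubv limg_cap andbT; apply/subvP => y.
rewrite memv_cap => /andP[/memv_imgP[u uU ->] /memv_imgP[w wW /(lker0P fI) E]].
by rewrite memv_img// memv_cap uU E.
Qed.

Lemma limg_dim_inj (V : vectType K) (f : 'Hom(V, 'M[K]_N)) U : lker f == 0%VS ->
  \dim (f @: U)%VS = \dim U.
Proof. by move=> /eqP fI; rewrite limg_dim_eq// fI capv0. Qed.

End ImageModules.

Lemma sym_split (K : numFieldType) d : (0 < d)%N ->
  symv K d = (<[1%:M]> + symv K d :&: tracelessv K d)%VS /\
  (<[1%:M]> :&: (symv K d :&: tracelessv K d))%VS = 0%VS.
Proof.
move=> d0; have dn : d%:R != 0 :> K by rewrite pnatr_eq0 -lt0n.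
have s1 : 1%:M \in symv K d by apply/symvP; rewrite trmx1.
split.
  apply/eqP; rewrite eqEsubv; apply/andP; split; apply/subvP => x.
    move=> xs; rewrite -[x](subrK ((\tr x / d%:R) *: 1%:M)) addrC.
    rewrite memv_add ?memvZ ?memv_line// memv_cap rpredB ?memvZ//=.
    by apply/tracelessvP; rewrite linearB linearZ /= mxtrace1 divfK ?subrr.
  by move=> /memv_addP[_ /vlineP[k ->] [y /=]]; rewrite memv_cap => /andP[ys _] ->; rewrite rpredD ?memvZ.
apply/eqP; rewrite -subv0; apply/subvP => x; rewrite !memv_cap memv0.
case/and3P=> /vlineP[k ->] _ /tracelessvP/eqP.
by rewrite linearZ /= mxtrace1 mulf_eq0 (negbTE dn) orbF => /eqP->; rewrite scale0r.
Qed.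

(** * The split algebra so(2n) *)

Section SwapOrd.
Variable n : nat.

Definition swap_ord (i : 'I_(n + n)) : 'I_(n + n) :=
  match fintype.split i with inl a => rshift n a | inr a => lshift n a end.

Lemma swap_ordE (i j : 'I_(n + n)) : (j == swap_ord i) = ((j == i + n :> nat) || (i == j + n :> nat))%N.
Proof.
rewrite /swap_ord; case: (splitP i) => a ia; rewrite -val_eqE /= ?ia;
  have := ltn_ord a; have := ltn_ord j => aj jn; apply/idP/idP; lia.
Qed.

Lemma swap_ordK : involutive swap_ord.
Proof. by move=> i; apply/esym/eqP; rewrite swap_ordE orbC -swap_ordE. Qed.

Lemma swap_ord_neq i : swap_ord i != i.
Proof. by rewrite eq_sym swap_ordE; have := ltn_ord i; lia. Qed.

End SwapOrd.

Section SoEvenForm.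
Variables (K : numFieldType) (im : K) (n : nat).
Hypothesis im2 : im * im = -1.
Local Notation N := (n + n)%N.
Local Notation J := (swap_mx K n).
Let two0 : 2 != 0 :> K. Proof. by rewrite pnatr_eq0. Qed.

Lemma swap_mx_sym : J^T = J.
Proof. by rewrite tr_block_mx !trmx0 !trmx1. Qed.

Lemma swap_mx_sqr : J *m J = 1%:M.
Proof. by rewrite mulmx_block !(mulmx0, mul0mx, mulmx1, addr0, add0r) -scalar_mx_block. Qed.

(** The square root Q of the form [J] conjugates the algebra to the skew matrices. The same Q
    diagonalizes a torus there, as Q Q^T = J pairs the coordinates by the exchange of the two
    halves; that exchange has no fixed point, whence type D. *)
Lemma simple_so_even : (3 <= n)%N -> simple_of_type_D (so_even K n) n.
Proof.
move=> n3; pose Q := invol_sqrt im J.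
have QQ : Q *m Q = J := invol_sqrtK im2 two0 swap_mx_sqr.
have Qu : Q \in unitmx := invol_sqrt_unit im2 two0 swap_mx_sqr.
have Qt : Q^T = Q := invol_sqrt_sym im swap_mx_sym.
have Q'u : invmx Q \in unitmx by rewrite unitmx_inv.
have Q't : (invmx Q)^T = invmx Q by rewrite trmx_inv Qt.
have JQ' : J *m invmx Q = Q by rewrite -QQ mulmxK.
have Q'J : invmx Q *m J = Q by rewrite -QQ mulKmx.
have -> : so_even K n = (Ad (invmx Q) @: skewv K N)%VS.
  apply/vspaceP => X; apply/idP/idP => [/so_even_form E|/memv_imgP[Y /skewvP Ys ->]].
    rewrite -(AdK X Qu) memv_img//; apply/skewvP; rewrite AdE !trmx_mul Qt Q't.
    apply: (can_inj (mulmxK Qu)); rewrite mulNmx mulmxKV// -!mulmxA QQ E.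
    by rewrite mulmxN -QQ !mulmxA mulVmx// mul1mx.
  apply/so_even_form; rewrite AdE invmxK !trmx_mul Qt Q't Ys.
  by rewrite !mulNmx !mulmxN !mulNmx -!mulmxA Q'J (mulmxA J) JQ'.
apply: (@simple_type_D _ _ _ (Ad (invmx Q)) _ _ Q (@swap_ord n)) => //.
- by apply/lker0P => X Y /(congr1 (Ad Q)); rewrite !Ad_invK.
- by move=> X Y _ _; rewrite !AdE conj_lie.
- exact: swap_ordK.
- by move=> i j; rewrite Qt QQ swap_mxE swap_ordE pnatr_eq0 eqb0 negbK.
- by rewrite mul2n addnn.
- exact: swap_ord_neq.
Qed.

End SoEvenForm.

(** * The graded pieces and the orders of the automorphisms *)

Section Pieces.
Variables (K : numClosedFieldType) (im : K) (l : nat).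
Hypotheses (im2 : im * im = -1) (hl : (1 <= l)%N).
Local Notation d := (2 * l).+1.
Local Notation n := (2 * l + 2)%N.
Local Notation N := (n + n)%N.
Local Notation J := (swap_mx K n).
Local Notation A0 := (big_A0 K l).
Local Notation A1 := (big_A1 im l).
Local Notation F := (frame im l).
Local Notation D := (coframe im l).
Local Notation g := (so_even K n).
Local Notation skewv := (skewv K d).
Local Notation symv := (symv K d).
Local Notation sym0 := (symv :&: tracelessv K d)%VS.
Local Notation even := (frame_map F D (@Y_even K d)).
Local Notation two e := (frame_map F D (@Y_two K d e)).
Local Notation one e := (frame_map F D (@Y_one K d e)).
Local Notation three e := (frame_map F D (@Y_three K d e)).
Local Notation triv := (triv_elt F D).
Local Notation G := (graded g (Ad A0) (Ad A1) (-1) im).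

Let FD := frameK l im2.
Let DF := coframeK l im2.
Let A0F := A0_frame l im2.
Let A1F : A1 *m F = F *m B1 d im. Proof. exact: A1_frame. Qed.
Let FJF := form_frame l im2.
Let gP := @so_even_form K n.
Let two0 : 2 != 0 :> K. Proof. by rewrite pnatr_eq0. Qed.
Let d3 : (2 < d)%N. Proof. lia. Qed.

Let A0A0 : A0 *m A0 = - 1%:M. Proof. exact: frame_A0_sqr FD A0F. Qed.
Let A1A1 : A1 *m A1 *m (A1 *m A1) = 1%:M. Proof. exact: (frame_A1_four im2 FD A1F). Qed.
Let anti : A0 *m A1 = - (A1 *m A0). Proof. exact: frame_anticomm FD A0F A1F. Qed.

Let A0u : A0 \in unitmx.
Proof. by case: (@mulmx1_unit _ _ A0 (- A0)); rewrite // mulmxN A0A0 opprK. Qed.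
Let A1u : A1 \in unitmx.
Proof. by case: (@mulmx1_unit _ _ A1 (A1 *m (A1 *m A1))); rewrite // -A1A1 !mulmxA. Qed.

Lemma aut_A0 : lie_automorphism g (Ad A0).
Proof. by apply: (Ad_automorphism gP A0u); apply: frame_A0_form FD A0F FJF. Qed.

Lemma aut_A1 : lie_automorphism g (Ad A1).
Proof. by apply: (Ad_automorphism gP A1u); apply: frame_A1_form FD A1F FJF. Qed.

Lemma aut_commute X : Ad A0 (Ad A1 X) = Ad A1 (Ad A0 X).
Proof. by rewrite !Ad_mul// anti AdN// unitmx_mul A1u. Qed.

Lemma graded_piece p q : graded_by A0 A1 J (G p q) ((-1) ^ p) (im ^ q).
Proof.
move=> X; rewrite gradedP; split=> -[h1 h2 h3]; split.
- exact/gP.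
- exact/Ad_eigP.
- exact/Ad_eigP.
- exact/gP.
- exact/Ad_eigP.
- exact/Ad_eigP.
Qed.

Let im0 : im != 0.
Proof. by apply/eqP => i0; move/eqP: im2; rewrite i0 mul0r eq_sym oppr_eq0 oner_eq0. Qed.

Lemma graded_shift p q a b : G (p + 2 * a) (q + 4 * b) = G p q.
Proof.
have h0 : (-1) ^ (p + 2 * a) = (-1) ^ p :> K.
  rewrite exprzDr ?unitrN1// -exprz_exp.
  have -> : (-1) ^ 2%:Z = 1 :> K by rewrite -exprnP expr2 mulrNN mulr1.
  by rewrite exp1rz mulr1.
have h1 : im ^ (q + 4 * b) = im ^ q.
  rewrite exprzDr ?unitfE// -exprz_exp.
  have -> : im ^ 4%:Z = 1 by rewrite -exprnP (exprM im 2 2) [im ^+ 2]im2 expr2 mulrNN mulr1.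
  by rewrite exp1rz mulr1.
by rewrite /graded h0 h1.
Qed.

Lemma piece00 : G 0 0 = (even @: skewv)%VS.
Proof. exact: (graded_even_skew im2 FD DF A0F A1F FJF (graded_piece 0 0)). Qed.

Lemma piece10 : G 1 0 = (even @: symv)%VS.
Proof. exact: (graded_even_sym im2 FD DF A0F A1F FJF (graded_piece 1 0)). Qed.

Let imsq : im ^ 2%:Z = -1. Proof. by rewrite -exprnP expr2. Qed.
Let imcb : im ^ 3%:Z = - im. Proof. by rewrite -exprnP exprS expr2 im2 mulrN1. Qed.

Lemma piece02 : G 0 2 = (two 1 @: skewv)%VS.
Proof.
apply: (graded_two im2 FD DF A0F A1F FJF).
by have := graded_piece 0 2; rewrite imsq.
Qed.

Lemma piece12 : G 1 2 = (two (-1) @: skewv + <[triv]>)%VS.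
Proof.
apply: (graded_two_triv im2 FD DF A0F A1F FJF).
by have := graded_piece 1 2; rewrite imsq.
Qed.

Let sgn2 (p : int) : (-1) ^ p * (-1) ^ p = 1 :> K.
Proof. by rewrite -exprzMl ?unitrN1// mulrNN mulr1 exp1rz. Qed.

Lemma piece1 p : G p 1 = (one ((-1) ^ p) @: fullv)%VS.
Proof.
by apply: (graded_one im2 FD DF A0F A1F FJF (sgn2 p)); apply: (graded_piece p 1).
Qed.

Lemma piece3 p : G p 3 = (three ((-1) ^ p) @: fullv)%VS.
Proof.
apply: (graded_three im2 FD DF A0F A1F FJF (sgn2 p)).
by have := graded_piece p 3; rewrite imcb.
Qed.

Let even_lie x y : x \in skewv -> lie (even x) (even y) = even (lie x y).
Proof. by move=> _; rewrite (lie_even DF). Qed.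

Lemma full_neq0 : fullv <> 0%VS :> {vspace 'cV[K]_d}.
Proof. by move=> E; have := dimvf 'cV[K]_d; rewrite E dimv0 dim_matrix. Qed.

Lemma vector_piece (f : 'Hom('cV[K]_d, 'M[K]_N)) : lker f == 0%VS ->
  {in skewv & fullv, forall x v, lie (even x) (f v) = f (x *m v)} ->
  lie_irreducible (even @: skewv) (f @: fullv) /\ \dim (f @: fullv) = (2 * l + 1)%N.
Proof.
move=> fI fl; split; last by rewrite limg_dim_inj// dimvf dim_matrix; lia.
apply: (@limg_irreducible _ _ _ even skewv _ f (fun x v => x *m v)) => //.
- exact: full_neq0.
- by move=> *; rewrite memvf.
- by move=> U _; apply: vector_irreducible.
Qed.

Lemma one_piece e : lie_irreducible (even @: skewv) (one e @: fullv) /\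
  \dim (one e @: fullv) = (2 * l + 1)%N.
Proof.
apply: vector_piece; first exact: one_injective DF _.
by move=> x v xs _; rewrite (lie_even_one DF).
Qed.

Lemma three_piece e : lie_irreducible (even @: skewv) (three e @: fullv) /\
  \dim (three e @: fullv) = (2 * l + 1)%N.
Proof.
apply: vector_piece; first exact: three_injective DF _.
by move=> x v xs _; rewrite (lie_even_three DF).
Qed.

Lemma pieces_odd p q : (p, q) \in [:: (0, 1); (1, 1); (0, 3); (1, 3)] ->
  lie_irreducible (G 0 0) (G p q) /\ \dim (G p q) = (2 * l + 1)%N.
Proof.
rewrite piece00 !inE => /or4P[] /eqP[-> ->]; rewrite ?piece1 ?piece3.
- exact: one_piece.
- exact: one_piece.
- exact: three_piece.
- exact: three_piece.
Qed.

Let sym0_lie : {in skewv & sym0, forall x v, lie x v \in sym0}.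
Proof. by move=> x v xs; rewrite !memv_cap tracelessv_lie => /andP[vs _]; rewrite symv_lie. Qed.

Let dim0 : \dim sym0 = (2 * l ^ 2 + 3 * l)%N.
Proof. by have := @dim_sym0 K d isT; rewrite -!mul2n expnS expn1; nia. Qed.

(** Symmetric matrices split into the scalars, which commute with everything, and the traceless
    ones. *)
Lemma pieces10 : exists U T, [/\ module_sum (G 0 0) (G 1 0) T U, \dim T = 1%N,
  lie_irreducible (G 0 0) U & \dim U = (2 * l ^ 2 + 3 * l)%N].
Proof.
have evI : lker even == 0%VS := even_injective DF.
have [Es E0] := @sym_split K d isT.
exists (even @: sym0)%VS, (even @: <[1%:M]>)%VS; rewrite piece00 piece10; split.
- split.
  + apply/lie_submoduleP => _ _ /memv_imgP[x xs ->] /memv_imgP[_ /vlineP[k ->] ->].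
    by rewrite even_lie// /lie -scalemxAr -scalemxAl mulmx1 mul1mx subrr linear0 mem0v.
  + apply/lie_submoduleP => _ _ /memv_imgP[x xs ->] /memv_imgP[v vs ->].
    by rewrite even_lie// memv_img// sym0_lie.
  + by rewrite -limgD -Es.
  + by rewrite limg_capI// E0 limg0.
- rewrite limg_dim_inj// dim_vline; case: eqP => // /matrixP/(_ 0 0).
  by rewrite !mxE => /eqP; rewrite oner_eq0.
- apply: (@limg_irreducible _ _ _ even skewv _ even (@lie K d)) => //.
  + by move=> x v xs _; apply: even_lie.
  + by move=> E; have := dim0; rewrite E dimv0; nia.
  + by move=> U U0 st; apply: sym0_irreducible.
- by rewrite limg_dim_inj.
Qed.

Lemma iso_two e : module_iso (even @: skewv) (two e @: skewv) (even @: skewv).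
Proof.
apply: module_iso_img.
- exact: two_injective DF _.
- exact: even_injective DF.
- by move=> x w xs ws; apply: skewv_lie.
- by move=> x w xs _; rewrite (lie_even_two DF).
- by move=> x w xs _; apply: even_lie.
Qed.

Lemma pieces02 : module_iso (G 0 0) (G 0 2) (G 0 0).
Proof. by rewrite piece00 piece02; apply: iso_two. Qed.

Lemma pieces12 : exists U T, [/\ module_sum (G 0 0) (G 1 2) U T,
  module_iso (G 0 0) U (G 0 0), \dim T = 1%N & lie_trivial (G 0 0) T].
Proof.
have nt : triv \notin (two (-1) @: skewv)%VS.
  by apply: (triv_elt_notin DF); rewrite oppr_eq0 oner_eq0.
have tr0 : lie_trivial (even @: skewv) <[triv]>.
  move=> _ _ /memv_imgP[x xs ->] /vlineP[k ->].
  by rewrite linearZ /= (lie_even_triv DF) scaler0.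
exists (two (-1) @: skewv)%VS, <[triv]>%VS; rewrite piece00 piece12; split=> //.
- split=> //.
  + by case: (iso_two (-1)).
  + by apply/lie_submoduleP => x w xs ws; rewrite tr0// mem0v.
  + apply/eqP; rewrite -subv0; apply/subvP => x; rewrite memv_cap memv0 => /andP[xU /vlineP[k E]].
    rewrite E; have [->|k0] := eqVneq k 0; first by rewrite scale0r.
    by case/negP: nt; rewrite -(scalerK k0 triv) memvZ -?E.
- exact: iso_two.
- by rewrite dim_vline; case: eqP nt => // ->; rewrite mem0v.
Qed.

(** The square of the matrix is -1, hence acts trivially; the image of the identity has degree
    (1,0), and sigma_0 changes its sign. *)
Lemma order_A0 : has_order g (Ad A0) 2.
Proof.
split=> //.
  move=> X _ /=; rewrite Ad_mul// A0A0.
  rewrite -[- 1%:M]/(- (1%:M)) AdN ?unitmx1//; apply: Ad_scalar; exact: oner_neq0.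
case=> [|[|m]]// _ /(_ (even 1%:M)) /=.
have eI : even 1%:M \in G 1 0 by rewrite piece10 memv_img//; apply/symvP; rewrite trmx1.
move: eI; rewrite gradedP expr1z => -[eg -> _] /(_ eg)/eqP.
rewrite scaleN1r -subr_eq0 -opprD oppr_eq0 -mulr2n -scaler_nat scaler_eq0 (negbTE two0) /=.
rewrite -(linear0 even) => /eqP/(lker0P (even_injective DF))/matrixP/(_ 0 0).
by rewrite !mxE => /eqP; rewrite oner_eq0.
Qed.

(** A nonzero element of degree (0,1) is an eigenvector for [im], whose first three powers differ
    from 1. *)
Lemma order_A1 : has_order g (Ad A1) 4.
Proof.
split=> //.
  move=> X _ /=; rewrite !Ad_mul ?unitmx_mul ?A1u// -!mulmxA mulmxA A1A1.
  by apply: Ad_scalar; apply: oner_neq0.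
move=> m m4 H; have G01 : G 0 1 != 0%VS.
  by rewrite -dimv_eq0 piece1 (one_piece _).2; lia.
pose X := vpick (G 0 1); have : X \in G 0 1 by apply: memv_pick.
rewrite gradedP expr1z => -[Xg _ sX]; have := H X Xg.
have -> : iter m (Ad A1) X = im ^+ m *: X.
  elim: {m4 H} m => [|m IH] /=; first by rewrite scale1r.
  by rewrite IH linearZ /= sX scalerA exprSr.
move/eqP; rewrite -[X in _ == X]scale1r -subr_eq0 -scalerBl scaler_eq0 vpick0 (negbTE G01) orbF subr_eq0.
have n11 : (1 == -1 :> K) = false.
  by apply/negbTE; rewrite -subr_eq0 opprK -(natrD _ 1 1) pnatr_eq0.
have im1 : (im == 1) = false.
  by apply/negbTE/eqP => E; move: im2; rewrite E mulr1 => /eqP; rewrite n11.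
case: m m4 H => [|[|[|[|m]]]]// _ _.
- by rewrite expr1 im1.
- by rewrite expr2 im2 eq_sym n11.
- rewrite exprS expr2 im2 mulrN1 => /eqP E.
  by have := im2; rewrite -[im]opprK E mulrNN mulr1 => /eqP; rewrite n11.
Qed.

(** The square root of [Theta] supplies the paired basis; the pairing is the reversal of indices,
    whose only fixed point is the middle index l. *)
Lemma simple_g00 : simple_of_type_B (G 0 0) l.
Proof.
rewrite piece00; apply: (@simple_type_B _ _ _ even (even_injective DF) _ (invol_sqrt im (Theta K l)) (@rev_ord d)) => //.
- by move=> x y xs ys; apply: even_lie.
- exact: invol_sqrt_unit im2 two0 (Theta_sqr _ _).
- exact: rev_ordK.
- move=> i j; rewrite (invol_sqrt_sym _ (Theta_sym _ _)) (invol_sqrtK im2 two0 (Theta_sqr _ _)) mxE.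
  rewrite mulf_eq0 signr_eq0 pnatr_eq0 eqb0 negbK.
  by apply/eqP/eqP => ->; rewrite rev_ordK.
- move=> i j /(congr1 val) /= hi /(congr1 val) /= hj; apply/val_inj => /=.
  by have := ltn_ord i; have := ltn_ord j; lia.
Qed.

Lemma killing_even : {in skewv &, forall x y,
  killing g (even x) (even y) = ((N%:R - 2) * 2) * \tr (x *m y)}.
Proof.
move=> x y xs ys.
have eg z : z \in skewv -> even z \in g.
  move=> zs; have : even z \in G 0 0 by rewrite piece00 memv_img.
  by move=> /gradedP[].
by rewrite (killing_form (swap_mx_sym K n) (swap_mx_sqr K n) gP (eg x xs) (eg y ys)) (trace_even DF) mulrA.
Qed.

End Pieces.

(** * Weights of the toroidal algebra *)

Section ToroidalWeights.
Variables (K : fieldType) (N : nat).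
Local Notation M := 'M[K]_N.
Variables (g : {vspace M}) (s0 s1 : 'End(M)) (n0 n1 : nat) (e0 e1 : K) (h : {vspace M}).

Lemma coef_sum (I : Type) (r : seq I) (F : I -> laurent M) a :
  (\sum_(i <- r) F i) a = \sum_(i <- r) F i a.
Proof. by elim/big_rec2: _ => // i x y _ <-. Qed.

Lemma mono_zero a : mono a (0 : M) = 0.
Proof. by apply/val_inj/funext => s /=; rewrite /mono_fun; case: ifP. Qed.

Lemma loop_bracket_mono0 v (X : laurent M) a : loop_bracket (mono 0 v) X a = lie v (X a).
Proof.
have lier0 u : lie u 0 = 0 :> M by rewrite linear0.
pose S := [set b | X b <> 0].
have Sf : finite_set S by have /asboolP := coef_fin_supp X.
rewrite /loop_bracket -(@fsbig_widen _ _ _ _ [set 0])//; last first.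
  move=> b [_ /= /eqP b0]; apply: fsbig1 => c _.
  by rewrite /= /mono_fun (negbTE b0) lie0l mono_zero.
rewrite fsbig_set1 -(@fsbig_widen _ _ _ _ S)//; last first.
  by move=> b [_ /= /contrapT ->]; rewrite lier0 mono_zero.
rewrite fsbig_finite// coef_sum.
have mE b : (mono (0 + b) (lie (mono 0 v 0) (X b))) a = if a == b then lie v (X b) else 0.
  by rewrite add0r /= /mono_fun eqxx.
under eq_bigr do rewrite mE.
have [aS|aS] := pselect (S a).
  rewrite (bigD1_seq a)/=; last exact: finmap.fset_uniq.
    by rewrite eqxx big1 ?addr0// => b; rewrite eq_sym => /negbTE ->.
  by rewrite in_fset_set// inE.
have -> : X a = 0 by apply: contrapT.
rewrite lier0 big_seq big1// => b; rewrite in_fset_set// inE => bS.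
by case: eqP => // E; case: aS; rewrite E.
Qed.

(** The cocycle contains the differential of t^0, which is zero. *)
Lemma cocycle_mono0 v (X : laurent M) : cocycle g (mono 0 v) X = 0.
Proof.
rewrite /cocycle; apply: fsbig1 => a _; apply: fsbig1 => b _.
have [->|a0] := eqVneq a 0; first by rewrite !mulr0z !scale0r addr0 scaler0.
rewrite /= /mono_fun (negbTE a0) /killing big1 ?scale0r// => i _.
by rewrite lie0l linear0.
Qed.

Lemma kder0 j : kder j 0 = 0 :> kaehler K.
Proof.
have E : 0 = class_form 0 :> kaehler K by rewrite [RHS]raddf0.
by rewrite {1}E kderE /= !linear0 E.
Qed.

Lemma cartan_bracket (s : subvs_of h) (c z : K^o * K^o) (X : laurent M) :
  tor_bracket g (cartan_elt s c z) (X, 0, 0) =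
  (loop_bracket (mono 0 (vsval s)) X + lder (c.1 : K) (c.2 : K) X, 0, 0).
Proof.
rewrite /tor_bracket /cartan_elt cocycle_mono0 /qder !kder0 !scaler0 /lder !scale0r.
by rewrite !addr0 subr0 subr0.
Qed.

Lemma coef_lder c0 c1 (X : laurent M) a :
  lder c0 c1 X a = (c0 * a.1%:~R + c1 * a.2%:~R) *: X a.
Proof. by rewrite scalerDl -!scalerA. Qed.

(** The vector chosen for the zero functional is some element orthogonal to [h], in particular to
    itself; no nondegeneracy is assumed here. *)
Lemma dual_form0 : dual_form g (0 : dual h) (0 : dual h) = 0.
Proof.
rewrite /dual_form; set t := dual_vec g 0.
have ht : forall s, killing g (vsval t) (vsval s) = (0 : dual h) s.
  apply: (@xgetPex _ 0 [set t | forall s, killing g (vsval t) (vsval s) = (0 : dual h) s]).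
  exists 0 => s; rewrite linear0 lfunE /= /killing big1// => i _.
  by rewrite lie0l linear0.
by rewrite ht lfunE.
Qed.

Lemma nonisotropicP (be : Vspace h) :
  nonisotropic_roots g s0 s1 n0 n1 e0 e1 h be <->
  dual_form g be.1.1 be.1.1 <> 0 /\ exists a b : int,
    [/\ be = (be.1.1, a%:~R, b%:~R) & has_weight (graded g s0 s1 e0 e1 a b) be.1.1].
Proof.
case: be => -[al x] y /=; split.
  move=> [/= nz [[[X k] c'] [[Xg _] xn0 hx]]]; split=> //.
  have [s as0] : exists s, al s <> 0.
    apply: contrapT => H; apply: nz; have -> : al = 0; last exact: dual_form0.
    by apply/lfunP => s; rewrite lfunE /=; apply: contrapT => as0; apply: H; exists s.
  (* Testing with this s alone: a bracket has no component along d_0, d_1, so [c'] vanishes, and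
     then so does the bracket's component in the central part, which gives k = 0. *)
  have := hx s 0 0; rewrite /tor_bracket /cartan_elt /Veval /= !mulr0 !addr0.
  rewrite cocycle_mono0 /qder /lder !scale0r !addr0 !add0r.
  have sc0 (V : lmodType K) (v : V) : 0 = al s *: v -> v = 0.
    by move/esym/eqP; rewrite scaler_eq0 => /orP[/eqP//|/eqP].
  move=> [_ hk /sc0 c1 /sc0 c2].
  have c0 : c' = 0 by rewrite [c']surjective_pairing c1 c2.
  have k0 : k = 0 by apply: sc0; rewrite -hk c0 /= !scale0r addr0 oppr0.
  subst c' k; have {}hx s' (c z : K^o * K^o) (a : int * int) : lie (vsval s') (X a) + (c.1 * a.1%:~R + c.2 * a.2%:~R) *: X a =
      (al s' + x * c.1 + y * c.2) *: X a.
    have : tor_bracket g (cartan_elt s' c z) (X, 0, 0) = _ := hx s' c z.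
    rewrite cartan_bracket => /(congr1 (fun Z : tor K N => Z.1.1 a)).
    by rewrite -loop_bracket_mono0 -coef_lder.
  (* d_0 and d_1 multiply the coefficient of t^a by its exponents, so one nonzero coefficient
     determines both delta components of the weight. *)
  have [a Xa] : exists a, X a <> 0.
    apply: contrapT => H; apply: xn0; congr (_, _, _); apply/val_inj/funext => a.
    by apply: contrapT => Xa; apply: H; exists a.
  have scI (u v : K) : u *: X a = v *: X a -> u = v.
    by move/eqP; rewrite -subr_eq0 -scalerBl scaler_eq0 subr_eq0 => /orP[/eqP//|/eqP].
  have l0 : lie (vsval (0 : subvs_of h)) (X a) = 0 by rewrite linear0 lie0l.
  exists a.1, a.2; split.
    congr (_, _, _).
      have := hx 0 (1, 0) 0 a; rewrite l0 linear0 /= !mulr0 !mul0r mul1r mulr1 !addr0 !add0r.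
      by move/scI.
    have := hx 0 (0, 1) 0 a; rewrite l0 linear0 /= !mulr0 !mul0r mul1r mulr1 !addr0 !add0r.
    by move/scI.
  exists (X a); split=> // s'; have := hx s' 0 0 a.
  by rewrite /= !mul0r !mulr0 !addr0 scale0r addr0.
move=> [nz [a [b [E [v [vG v0 hv]]]]]]; split=> //.
exists (mono (a, b) v, 0, 0); split.
- split=> /=; last by exists [::]; rewrite big_nil.
  by move=> r; rewrite /mono_fun; case: eqP => [->//|_]; rewrite mem0v.
- move=> /(congr1 (fun Z : tor K N => Z.1.1 (a, b))) /=.
  by rewrite /mono_fun eqxx.
- move=> s c z; rewrite cartan_bracket; congr (_, _, _).
  + apply/val_inj/funext => r.
    change (loop_bracket (mono 0 (vsval s)) (mono (a, b) v) r + lder (c.1 : K) (c.2 : K) (mono (a, b) v) r =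
      Veval (al, x, y) s c *: mono (a, b) v r).
    rewrite loop_bracket_mono0 coef_lder /= /mono_fun; case: eqP => [->|_] /=.
      rewrite hv -scalerDl /Veval /=; case: E => -> ->.
      by congr (_ *: _); rewrite -addrA; congr (_ + _); rewrite ![_ * _%:~R]mulrC.
    by rewrite linear0 !scaler0 addr0.
  + by rewrite scaler0.
  + by rewrite scaler0.
Qed.

End ToroidalWeights.

Lemma Vspace_comb (K : fieldType) N (h : {vspace 'M[K]_N}) (al : dual h) (m n : int) :
  Vinj al + delta0 h *~ m + delta1 h *~ n = (al, m%:~R, n%:~R).
Proof.
have fE (T U : zmodType) (x : T) (y : U) (k : int) : (x, y) *~ k = (x *~ k, y *~ k).
  by rewrite [LHS]surjective_pairing (raddfMz fst) (raddfMz snd).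
rewrite /Vinj /delta0 /delta1 !fE !mul0rz.
change ((al + 0 + 0, 0 + (m%:~R : K^o) + 0, 0 + 0 + (n%:~R : K^o)) = (al, m%:~R : K^o, n%:~R : K^o)).
by rewrite !addr0 !add0r.
Qed.

(** * The non-isotropic roots *)

(** [t] has weight 0 and lies outside the stable subspace [U], so a vector of nonzero weight has no
    component along it. *)
Lemma has_weight_add_triv (K : fieldType) N (h U : {vspace 'M[K]_N}) (t : 'M[K]_N) (al : dual h) :
  {in h & U, forall x u, lie x u \in U} -> {in h, forall x, lie x t = 0} -> t \notin U -> al <> 0 ->
  has_weight (U + <[t]>) al <-> has_weight U al.
Proof.
move=> Ust t0 tU al0; split; last first.
  by move=> [x [xU x0 hx]]; exists x; split=> //; apply: subvP xU; apply: addvSl.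
move=> [_ [/memv_addP[u uU [_ /vlineP[k ->] ->]] x0 hx]].
have hu s : lie (vsval s) u - al s *: u = (al s * k) *: t.
  have := hx s; rewrite linearD linearZ /= t0 ?subvsP// scaler0 addr0 => ->.
  by rewrite scalerDr scalerA addrC addKr.
have k0 : k = 0.
  apply/eqP; apply: contrapT => /negP k0; apply: al0; apply/lfunP => s; rewrite lfunE /=.
  apply/eqP; apply: contraNT tU => as0.
  have c0 : al s * k != 0 by rewrite mulf_neq0.
  by rewrite -(scalerK c0 t) memvZ// -hu memvB ?memvZ// Ust// subvsP.
exists u; split=> //; first by move: x0; rewrite k0 scale0r addr0.
by move=> s; apply/eqP; rewrite -subr_eq0 hu k0 mulr0 scale0r.
Qed.

(** * Root lengths and weights degree by degree *)

Section RootClause.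
Variables (K : numClosedFieldType) (im : K) (l : nat).
Hypotheses (im2 : im * im = -1) (hl : (1 <= l)%N).
Local Notation d := (2 * l).+1.
Local Notation n := (2 * l + 2)%N.
Local Notation N := (n + n)%N.
Local Notation A0 := (big_A0 K l).
Local Notation A1 := (big_A1 im l).
Local Notation F := (frame im l).
Local Notation D := (coframe im l).
Local Notation g := (so_even K n).
Local Notation skewv := (skewv K d).
Local Notation symv := (symv K d).
Local Notation even := (frame_map F D (@Y_even K d)).
Local Notation two e := (frame_map F D (@Y_two K d e)).
Local Notation one e := (frame_map F D (@Y_one K d e)).
Local Notation three e := (frame_map F D (@Y_three K d e)).
Local Notation triv := (triv_elt F D).
Local Notation G := (graded g (Ad A0) (Ad A1) (-1) im).
Let DF := coframeK l im2.
Let evI : lker even == 0%VS := even_injective DF.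
Let even_lie : {in skewv &, forall x y, lie (even x) (even y) = even (lie x y)}.
Proof. by move=> x y xs ys; rewrite (lie_even DF). Qed.

Variables (P : 'M[K]_d) (tau : 'I_d -> 'I_d) (h : {vspace 'M[K]_N}).
Hypotheses (Pu : P \in unitmx) (tauK : involutive tau)
  (Btau : forall i j, ((P *m P^T) i j != 0) = (j == tau i))
  (hh : forall X, X \in h <->
     exists x, [/\ x \in skewv, forall i j, i != j -> (P *m x *m invmx P) i j = 0 & X = even x]).
Variables (r : 'I_l -> 'I_d) (o : 'I_d).
Hypotheses (hr : half_system tau r) (to : tau o = o).

Local Notation eps i := (eps_weight even P h i).
Local Notation e k := (eps (r k)).

Let short_form : set (dual h) :=
  [set al | exists (k : 'I_l) (b : bool), al = (-1) ^+ b *: e k].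
Let long_form : set (dual h) :=
  [set al | exists (k k' : 'I_l) (b c : bool), k != k' /\ al = (-1) ^+ b *: e k + (-1) ^+ c *: e k'].

Let RB := lie_roots (G 0 0) h.

Let RBE : RB = short_form `|` long_form.
Proof. by rewrite /RB piece00// (lie_roots_B evI Pu tauK Btau hh hr even_lie to). Qed.

Lemma root_system_pieces : root_system_B l RB.
Proof.
by rewrite /RB piece00//; exact: (root_system_skew evI Pu tauK Btau hh hr even_lie to).
Qed.

Local Notation kappa := ((N%:R - 2) * 2 : K).
Let kappa_gt0 : 0 < kappa.
Proof. by rewrite mulr_gt0 ?ltr0n// subr_gt0 ltr_nat; lia. Qed.
Let c : K := (kappa *+ 2)^-1.
Let c_gt0 : 0 < c. Proof. by rewrite invr_gt0 mulrn_wgt0// kappa_gt0. Qed.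

(** The scaling x covers both the short roots, with x = 1, and their doubles, with x = 2. *)
Let norm_short k b x : dual_form g (x *: ((-1) ^+ b *: e k)) (x *: ((-1) ^+ b *: e k)) = c * x ^+ 2.
Proof.
have [sd hsd] := half_dual_basis evI Pu tauK Btau hh hr.
rewrite (dual_formE evI Pu tauK Btau hh hr kappa_gt0 (killing_even im2) hsd); congr (_ * _).
have vE j : (x *: ((-1) ^+ b *: e k) : dual h) (sd j) = x * ((-1) ^+ b * (k == j)%:R).
  by rewrite !scale_lfunE hsd.
under eq_bigr do rewrite vE.
rewrite (bigD1 k) //= big1 ?addr0 => [|j jk].
  by rewrite eqxx mulr1 mulrACA -!expr2 sqrr_sign mulr1.
by rewrite eq_sym (negbTE jk) !mulr0.
Qed.

Let norm_long k k' b b' : k != k' ->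
  dual_form g ((-1) ^+ b *: e k + (-1) ^+ b' *: e k') ((-1) ^+ b *: e k + (-1) ^+ b' *: e k') = c * 2.
Proof.
move=> kk; have [sd hsd] := half_dual_basis evI Pu tauK Btau hh hr.
rewrite (dual_formE evI Pu tauK Btau hh hr kappa_gt0 (killing_even im2) hsd); congr (_ * _).
have vE j : ((-1) ^+ b *: e k + (-1) ^+ b' *: e k' : dual h) (sd j) =
    (-1) ^+ b * (k == j)%:R + (-1) ^+ b' * (k' == j)%:R.
  by rewrite add_lfunE !scale_lfunE !hsd.
under eq_bigr do rewrite vE.
rewrite (bigD1 k) //= (bigD1 k') /=; last by rewrite eq_sym.
rewrite eqxx (eq_sym k' k) (negbTE kk) eqxx !mulr0 !mulr1 addr0 add0r.
rewrite big1 ?addr0 => [|j /andP[jk jk']]; first by rewrite -!expr2 !sqrr_sign.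
by rewrite ![_ == j]eq_sym (negbTE jk) (negbTE jk') !mulr0 addr0 mul0r.
Qed.

Let norm_short1 k b : dual_form g ((-1) ^+ b *: e k) ((-1) ^+ b *: e k) = c.
Proof. by have := norm_short k b 1; rewrite scale1r expr1n mulr1. Qed.

Let k0 : 'I_l := Ordinal hl.

(** The norms are c and 2c with c > 0, so the minimum is attained exactly at the vectors e_k and
    -e_k, of which there is one since l >= 1. For l = 1 there are no others. *)
Let shortE : short_roots g RB = short_form.
Proof.
rewrite RBE; apply/seteqP; split=> al.
  move=> [[//|[k [k' [b [b' [kk ->]]]]]] /(_ (e k0))]; rewrite (norm_long _ _ kk).
  have -> : dual_form g (e k0) (e k0) = c by have := norm_short1 k0 false; rewrite scale1r.
  move=> H; have : c * 2 <= c by apply: H; left; exists k0, false; rewrite scale1r.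
  by rewrite mulr_natr mulr2n gerDl (lt_geF c_gt0).
move=> [k [b ->]]; split; first by left; exists k, b.
rewrite norm_short1 => be [[k' [b' ->]]|[k' [k'' [b' [b'' [kk ->]]]]]].
  by rewrite norm_short1.
by rewrite norm_long// mulr_natr mulr2n lerDl ltW.
Qed.

Let longE : long_roots g RB = long_form.
Proof.
rewrite /long_roots shortE RBE; apply/seteqP; split=> al.
  by case=> -[].
move=> hal; split; first by right.
move: hal => [k [k' [b [b' [kk E]]]]] [k1 [b1 E1]].
have := norm_long b b' kk; rewrite -E E1 norm_short1 => /eqP.
by rewrite mulr_natr mulr2n -subr_eq0 opprD addrA subrr sub0r oppr_eq0 gt_eqF.
Qed.

Let eps_short i : eps i <> 0 -> short_form (eps i).
Proof.
have [[_ ->]//|[k [b ->]]] := eps_cases evI Pu Btau hh hr i.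
by move=> _; exists k, b; rewrite (eps_pt evI Pu Btau hh).
Qed.

Let short_eps al : short_form al -> exists i, al = eps i.
Proof. by move=> [k [b ->]]; exists (if b then tau (r k) else r k); rewrite (eps_pt evI Pu Btau hh). Qed.

Let skew_weight (al : dual h) := exists i j : 'I_d, i != j /\ al = eps i + eps j.

Let RB_skew al : al <> 0 -> RB al <-> skew_weight al.
Proof.
move=> al0; rewrite /RB piece00// lie_rootsP (weight_skew evI Pu hh al evI even_lie) //.
by split=> [[]|].
Qed.

Let RB_neq0 al : RB al -> al <> 0. Proof. by rewrite /RB lie_rootsP => -[]. Qed.

Let G_shift p q p' q' a b : p' = p + 2 * a -> q' = q + 4 * b -> G p' q' = G p q.
Proof. by move=> -> ->; apply: graded_shift. Qed.

Let odd_weight p q al : has_weight (G p (2 * q + 1)) al <-> exists i, al = eps i.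
Proof.
have [m [E|E]] : exists m : int, q = 2 * m \/ q = 2 * m + 1.
  by exists (q %/ 2)%Z; lia.
- have -> : G p (2 * q + 1) = G p 1.
    by apply: (G_shift (a := 0) (b := m)); rewrite ?E; lia.
  rewrite piece1//; apply: weight_vector => //; first exact: (one_injective DF).
  by move=> x v xs; rewrite (lie_even_one DF).
- have -> : G p (2 * q + 1) = G p 3.
    by apply: (G_shift (a := 0) (b := m)); rewrite ?E; lia.
  rewrite piece3//; apply: weight_vector => //; first exact: (three_injective DF).
  by move=> x v xs; rewrite (lie_even_three DF).
Qed.

Let even_weight p q al : has_weight (G (2 * p) (4 * q)) al <-> skew_weight al.
Proof.
have -> : G (2 * p) (4 * q) = G 0 0.
  by apply: (G_shift (a := p) (b := q)); lia.
by rewrite piece00//; apply: weight_skew.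
Qed.

Let sym_weight p q al : has_weight (G (2 * p + 1) (4 * q)) al <-> exists i j, al = eps i + eps j.
Proof.
have -> : G (2 * p + 1) (4 * q) = G 1 0.
  by apply: (G_shift (a := p) (b := q)); lia.
rewrite piece10//; apply: weight_sym => // x y _ _.
by rewrite (lie_even DF).
Qed.

Let two_lie e : {in skewv & skewv, forall x y, lie (even x) (two e y) = two e (lie x y)}.
Proof. by move=> x y xs _; rewrite (lie_even_two DF). Qed.

Let two_skew e al := weight_skew evI Pu hh al (two_injective DF e) (two_lie e).

Let two_weight p q al : al <> 0 -> has_weight (G p (4 * q + 2)) al <-> skew_weight al.
Proof.
move=> al0; have [m [E|E]] : exists m : int, p = 2 * m \/ p = 2 * m + 1.
  by exists (p %/ 2)%Z; lia.
- have -> : G p (4 * q + 2) = G 0 2.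
    by apply: (G_shift (a := m) (b := q)); lia.
  by rewrite piece02//; exact: (two_skew 1 al).
- have -> : G p (4 * q + 2) = G 1 2.
    by apply: (G_shift (a := m) (b := q)); lia.
  rewrite piece12//; apply: (iff_trans _ (two_skew (-1) al)); apply: has_weight_add_triv => //.
  + move=> _ _ /hh[x [xs _ ->]] /memv_imgP[y ys ->].
    by rewrite (lie_even_two DF)// memv_img// skewv_lie.
  + by move=> _ /hh[x [_ _ ->]]; rewrite (lie_even_triv DF).
  + by apply: (triv_elt_notin DF); rewrite oppr_eq0 oner_eq0.
Qed.

Let div2 (p : int) : exists m : int, p = 2 * m \/ p = 2 * m + 1.
Proof. by exists (p %/ 2)%Z; lia. Qed.

Let div4 (q : int) : exists m : int, [\/ q = 2 * m + 1, q = 4 * m | q = 4 * m + 2].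
Proof.
have [m [->|->]] := div2 q; last by exists m; constructor 1.
have [m' [->|->]] := div2 m; exists m'; [constructor 2|constructor 3]; lia.
Qed.

(** Every piece of even second degree contains a copy of the skew or of the symmetric matrices, and
    the weights of the former are among those of the latter. *)
Let RB_weight p q al : RB al -> has_weight (G p (2 * q)) al.
Proof.
move=> hal; have al0 := RB_neq0 hal; have [i [j [ij E]]] := (RB_skew al0).1 hal.
have [m [->|->]] := div2 q.
  have -> : 2 * (2 * m) = 4 * m by lia.
  have [m' [->|->]] := div2 p; first by apply/even_weight; exists i, j.
  by apply/sym_weight; exists i, j.
have -> : 2 * (2 * m + 1) = 4 * m + 2 by lia.
by apply/two_weight => //; exists i, j.
Qed.

Lemma nonisotropic_pieces n0 n1 :
  nonisotropic_roots g (Ad A0) (Ad A1) n0 n1 (-1) im h =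
    [set be | exists al (a b : int),
       short_roots g RB al /\ be = Vinj al + delta0 h *~ a + delta1 h *~ b] `|`
    [set be | exists al (a b : int),
       long_roots g RB al /\ be = Vinj al + delta0 h *~ a + delta1 h *~ (2 * b)] `|`
    [set be | exists al (a b : int),
       short_roots g RB al /\ be = Vinj (al *+ 2) + delta0 h *~ (2 * a + 1) + delta1 h *~ (4 * b)].
Proof.
rewrite shortE longE; apply/seteqP; split=> be.
  case: be => -[al x] y /nonisotropicP[/= nz [p [q [[-> ->] hw]]]].
  have al0 : al <> 0 by move=> E; apply: nz; rewrite E dual_form0.
  have evenq q' : q = 2 * q' -> RB al -> ([set be | exists al (a b : int),
       short_form al /\ be = Vinj al + delta0 h *~ a + delta1 h *~ b] `|`
    [set be | exists al (a b : int),
       long_form al /\ be = Vinj al + delta0 h *~ a + delta1 h *~ (2 * b)]) (al, p%:~R, q%:~R).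
    rewrite RBE => -> [hs|hL]; [left|right].
      by exists al, p, (2 * q'); rewrite Vspace_comb.
    by exists al, p, q'; rewrite Vspace_comb.
  have [m [E|E|E]] := div4 q; rewrite E in hw.
  - have [i ai] := (odd_weight p m al).1 hw; left; left.
    exists al, p, q; rewrite Vspace_comb; split=> //; rewrite ai.
    by apply: eps_short; rewrite -ai.
  - have [m' [Ep|Ep]] := div2 p; rewrite Ep in hw.
      left; apply: (evenq (2 * m)); first by rewrite E; lia.
      by move: ((even_weight m' m al).1 hw) => /((RB_skew al0).2).
    have [i [j aij]] := (sym_weight m' m al).1 hw.
    (* Symmetric matrices allow i = j: this is the only source of the weights 2 eps i, hence of the
       third family. *)
    have [ij|ij] := eqVneq i j; last first.
      left; apply: (evenq (2 * m)); first by rewrite E; lia.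
      by apply/(RB_skew al0); exists i, j.
    have a2 : al = eps i *+ 2 by rewrite aij -ij mulr2n.
    right; exists (eps i), m', m; rewrite Vspace_comb -a2 Ep E; split=> //.
    by apply: eps_short => e0; apply: al0; rewrite a2 e0 mul0rn.
  - left; apply: (evenq (2 * m + 1)); first by rewrite E; lia.
    by move: ((two_weight p m al0).1 hw) => /((RB_skew al0).2).
have RBs al : short_form al -> RB al by rewrite RBE; left.
have c0 : c <> 0 by move=> E; move: c_gt0; rewrite E ltxx.
case=> [[]|] [al [a [b [hal ->]]]]; rewrite Vspace_comb; apply/nonisotropicP => /=.
- split; first by move: hal => [k [b' ->]]; rewrite norm_short1.
  exists a, b; split=> //; have [b' [->|->]] := div2 b; first exact/RB_weight/RBs.
  exact/odd_weight/short_eps.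
- split.
    move: hal => [k [k' [b1 [b2 [kk ->]]]]]; rewrite norm_long//.
    by apply/eqP; rewrite mulf_neq0 ?pnatr_eq0//; apply/eqP.
  by exists a, (2 * b); split=> //; apply: RB_weight; rewrite RBE; right.
- split.
    move: hal => [k [b1 ->]]; rewrite -scaler_nat norm_short.
    by apply/eqP; rewrite mulf_neq0 ?expf_neq0 ?pnatr_eq0//; apply/eqP.
  exists (2 * a + 1), (4 * b); split=> //; apply/sym_weight.
  by have [i ->] := short_eps hal; exists i, i; rewrite mulr2n.
Qed.

End RootClause.

(** * Reduction of an arbitrary Cartan subalgebra to so(d) *)

Section CartanClause.
Variables (K : numClosedFieldType) (im : K) (l : nat).
Hypotheses (im2 : im * im = -1) (hl : (1 <= l)%N).
Local Notation d := (2 * l).+1.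
Local Notation n := (2 * l + 2)%N.
Local Notation N := (n + n)%N.
Local Notation g := (so_even K n).
Local Notation G := (graded g (Ad (big_A0 K l)) (Ad (big_A1 im l)) (-1) im).

(** [h] is pulled back along the isomorphism from the skew matrices, where [cartan_skew_witt]
    applies; d being odd, the resulting pairing has l pairs and one self-paired coordinate. *)
Lemma roots_pieces n0 n1 (h : {vspace 'M[K]_N}) : cartan_subalgebra (G 0 0) h ->
  let RB := lie_roots (G 0 0) h in
  root_system_B l RB /\
  nonisotropic_roots g (Ad (big_A0 K l)) (Ad (big_A1 im l)) n0 n1 (-1) im h =
    [set be | exists al (a b : int),
       short_roots g RB al /\ be = Vinj al + delta0 h *~ a + delta1 h *~ b] `|`
    [set be | exists al (a b : int),
       long_roots g RB al /\ be = Vinj al + delta0 h *~ a + delta1 h *~ (2 * b)] `|`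
    [set be | exists al (a b : int),
       short_roots g RB al /\ be = Vinj (al *+ 2) + delta0 h *~ (2 * a + 1) + delta1 h *~ (4 * b)].
Proof.
have DF := coframeK l im2; have evI := even_injective DF.
rewrite {1}piece00// => /(cartan_preim evI)[].
  by move=> x y _ _; rewrite (lie_even DF).
move=> h0 [h0C hE] /=.
have [P [tau [[Pu tauK Btau tfix] h0P]]] := cartan_skew_witt h0C.
have [h0s _ _ _] := h0C.
have hh X : X \in h <-> exists x, [/\ x \in skewv K d,
    forall i j, i != j -> (P *m x *m invmx P) i j = 0 &
    X = frame_map (frame im l) (coframe im l) (@Y_even K d) x].
  rewrite hE; split=> [/memv_imgP[x xh ->]|[x [xs xd ->]]].
    by have xs := subvP h0s _ xh; exists x; split=> //; apply/(h0P x xs).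
  by rewrite memv_img//; apply/(h0P x xs).
have [r [hr [o to]]] := half_system_odd (erefl d) tauK tfix.
split; first exact: root_system_pieces Pu tauK Btau hh _ _ hr to.
exact: nonisotropic_pieces Pu tauK Btau hh _ _ hr to _ _.
Qed.

End CartanClause.

(** * The roots of unity of orders 2 and 4 *)

Section Specialization.
Variables (R : realType) (l : nat).

Lemma eps2E : eps R 2 = -1.
Proof.
by rewrite /eps mulrAC divff ?pnatr_eq0// mul1r cospi sinpi; apply/eqP; rewrite eq_complex /= oppr0 !eqxx.
Qed.

Lemma eps4E : eps R 4 = 'i%C.
Proof.
rewrite /eps (_ : 2%:R * pi / 4%:R = pi / 2 :> R); last by field.
by rewrite cos_pihalf sin_pihalf.
Qed.

Lemma gpartE p q : gpart R l p q =
  graded (so_even _ (2 * l + 2)) (Ad (big_A0 _ l)) (Ad (big_A1 'i%C l)) (-1) 'i%C p q.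
Proof. by rewrite /gpart eps2E eps4E. Qed.

End Specialization.

Theorem mainTheorem14 (R : realType) (l : nat) (hl : (1 <= l)%N) :
  let g := gD R l in
  let s0 := sigma0 R l in
  let s1 := sigma1 R l in
  let G := gpart R l in
  let g00 := G 0 0 in
  [/\ simple_of_type_D g (2 * l + 2),
      lie_automorphism g s0, lie_automorphism g s1,
      {in g, forall x, s0 (s1 x) = s1 (s0 x)} &
      has_order g s0 2 /\ has_order g s1 4] /\
  simple_of_type_B g00 l /\
  (forall p q : int, (p, q) \in [:: (0, 1); (1, 1); (0, 3); (1, 3)] ->
     lie_irreducible g00 (G p q) /\ \dim (G p q) = (2 * l + 1)%N) /\
  (exists U T, [/\ module_sum g00 (G 1 0) T U, \dim T = 1%N,
     lie_irreducible g00 U & \dim U = (2 * l ^ 2 + 3 * l)%N]) /\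
  module_iso g00 (G 0 2) g00 /\
  (exists U T, [/\ module_sum g00 (G 1 2) U T, module_iso g00 U g00,
     \dim T = 1%N & lie_trivial g00 T]) /\
  (forall h, cartan_subalgebra g00 h ->
     let RB := lie_roots g00 h in
     let short := short_roots g RB in
     let long := long_roots g RB in
     let d0 := delta0 h in
     let d1 := delta1 h in
     root_system_B l RB /\
     nonisotropic_roots g s0 s1 2 4 (eps R 2) (eps R 4) h =
       [set be | exists al (m n : int),
          short al /\ be = Vinj al + d0 *~ m + d1 *~ n] `|`
       [set be | exists al (m n : int),
          long al /\ be = Vinj al + d0 *~ m + d1 *~ (2 * n)] `|`
       [set be | exists al (m n : int),
          short al /\ be = Vinj (al *+ 2) + d0 *~ (2 * m + 1) + d1 *~ (4 * n)]).
Proof.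
have im2 : 'i%C * 'i%C = -1 :> R[i] by rewrite -expr2 sqr_i.
move=> g s0 s1 G g00.
have GE : G = graded (so_even _ (2 * l + 2)) (Ad (big_A0 _ l)) (Ad (big_A1 'i%C l)) (-1) 'i%C.
  by apply/funext => p; apply/funext => q; rewrite /G gpartE.
rewrite eps2E eps4E /g00 GE {g00 G GE}.
split; first split.
- by apply: (simple_so_even im2); lia.
- exact: (aut_A0 l im2).
- exact: (aut_A1 l im2).
- by move=> x _; apply: (aut_commute im2 x).
- by split; [apply: (order_A0 l im2)|apply: (order_A1 im2 hl)].
split; first exact: simple_g00.
split; first by move=> p q; apply: pieces_odd.
split; first exact: pieces10.
split; first exact: pieces02.
split; first exact: pieces12.
by move=> h; apply: roots_pieces.
Qed.
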